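(* Let $A\in\mathrm{gl}_n\bigl(\mathcal{O}_{\mathcal U}(\{x-\alpha(t)\})\bigr)$ and assume that the equation $\frac{\partial Y}{\partial x}=AY$ has parameterized regular singular points near $0$. Then there is a nonempty open connected subset $\mathcal U'$ of $\mathcal U$ such that: 1) the equation $\frac{\partial Y}{\partial x}=AY$ has a (fundamental matrix) solution $Y$ of the form $$Y(x,t)=\Bigl(\sum_{i\ge i_0}(x-\alpha(t))^i Q_i(t)\Bigr)(x-\alpha(t))^{\tilde A(t)}$$ for some $i_0\in\mathbb Z$, with $\tilde A\in\mathrm{gl}_n(\mathcal{O}_{\mathcal U'})$ and $Q_i\in\mathrm{gl}_n(\mathcal{O}_{\mathcal U'})$ for all $i\ge i_0$; 2) for any $r$-tuple $(m_1,\ldots,m_r)$ of nonnegative integers there is an integer $N$ such that for any fixed $t\in\mathcal U'$ and any sector $\mathcal S_t$ from $\alpha(t)$ in the complex plane, of opening less than $2\pi$, $$\lim_{x\to\alpha(t),\ x\in\mathcal S_t}\bigl(x-\alpha(t)\bigr)^N\,\frac{\partial^{m_1+\cdots+m_r}Y(x,t)}{\partial t_1^{m_1}\cdots\partial t_r^{m_r}}=0 .$$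
   Context: $\mathcal U$ is an open connected subset of $\mathbb C^r$ with $0\in\mathcal U$; $\mathcal{O}_{\mathcal U}$ is the ring of analytic functions of $t=(t_1,\dots,t_r)$ on $\mathcal U$; $\alpha\in\mathcal{O}_{\mathcal U}$ with $\alpha(0)=0$. $\mathcal{O}_{\mathcal U}((x-\alpha(t)))$ is the ring of formal Laurent series $f(x,t)=\sum_{i\ge m}a_i(t)(x-\alpha(t))^i$ with $a_i\in\mathcal{O}_{\mathcal U}$ and $m\in\mathbb Z$ independent of $t$; $\mathcal{O}_{\mathcal U}(\{x-\alpha(t)\})$ is the ring of those $f$ that, for each fixed $t\in\mathcal U$, converge for $0<|x-\alpha(t)|<R_t$ for some $R_t>0$. Two equations $\frac{\partial Y}{\partial x}=AY$ and $\frac{\partial Y}{\partial x}=BY$ with $A,B\in\mathrm{gl}_n(\mathcal{O}_{\mathcal U}(\{x-\alpha(t)\}))$ are equivalent if there is $P\in\mathrm{GL}_n(\mathcal{O}_{\mathcal U}(\{x-\alpha(t)\}))$ with $B=\frac{\partial P}{\partial x}P^{-1}+PAP^{-1}$. The equation $\frac{\partial Y}{\partial x}=AY$, with $A=\sum_{i\ge -m}(x-\alpha(t))^iA_i(t)$, $A_i\in\mathrm{gl}_n(\mathcal{O}_{\mathcal U})$, has simple singular points near $0$ if $m=1$ and $A_{-1}\neq0$ (i.e. $A_{-1}$ is not identically zero). It has parameterized regular singular points near $0$ if it is equivalent to an equation with simple singular points near $0$. $(x-\alpha(t))^{\tilde A(t)}$ means $\exp(\tilde A(t)\log(x-\alpha(t)))$;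 on a sector from $\alpha(t)$ a branch of the logarithm is chosen. In 2), $Y$ is the solution from 1). *)

(* Defs.v *)
From HB Require Import structures.
From mathcomp Require Import all_boot all_order all_algebra.
From mathcomp Require Import all_classical all_reals all_analysis.
From mathcomp Require Import complex.
From mathcomp Require summability.

Set Implicit Arguments.
Unset Strict Implicit.
Unset Printing Implicit Defensive.

Import Order.TTheory GRing.Theory Num.Theory.
Import numFieldNormedType.Exports.

Local Open Scope classical_set_scope.
Local Open Scope ring_scope.

HB.instance Definition _ (R : realType) := NormedModule.copy R[i] R[i]^o.

(* Radii are elements e of R[i] with 0 < e, which forces e to be real. *)

(* Near t0, f is the sum of a power series in t - t0.  The sum over the
   multi-indices k is the limit of the finite partial sums along the inclusion
   of finite sets of multi-indices, i.e. unconditional (absolute) summation. *)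
Definition analytic_at (R : realType) (r : nat) (f : 'rV[R[i]]_r -> R[i])
    (t0 : 'rV[R[i]]_r) : Prop :=
  exists (c : {ffun 'I_r -> nat} -> R[i]) (e : R[i]), 0 < e /\
    forall t : 'rV[R[i]]_r, (forall j, `|t 0 j - t0 0 j| < e) ->
      summability.partial_sum
        (fun k : {ffun 'I_r -> nat} =>
           c k * \prod_(j < r) (t 0 j - t0 0 j) ^+ k j)
        @ summability.totally --> f t.

(* f represents an element of O_U; its values outside U are irrelevant. *)
Definition analytic_on (R : realType) (r : nat) (U : set 'rV[R[i]]_r)
    (f : 'rV[R[i]]_r -> R[i]) : Prop :=
  forall t, U t -> analytic_at f t.

Definition mx_analytic_at (R : realType) (r n : nat)
    (F : 'rV[R[i]]_r -> 'M[R[i]]_n) (t : 'rV[R[i]]_r) : Prop :=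
  forall i j, analytic_at (fun t' => F t' i j) t.

Definition mx_analytic_on (R : realType) (r n : nat) (U : set 'rV[R[i]]_r)
    (F : 'rV[R[i]]_r -> 'M[R[i]]_n) : Prop :=
  forall i j, analytic_on U (fun t => F t i j).

(* d^(m_1 + ... + m_r) / dt_1^m_1 ... dt_r^m_r *)
Definition pderiv (R : realType) (r n : nat) (m : 'I_r -> nat)
    (F : 'rV[R[i]]_r -> 'M[R[i]]_n) : 'rV[R[i]]_r -> 'M[R[i]]_n :=
  foldr (fun j G => iter (m j) (fun H t => 'D_(delta_mx 0 j) H t) G)
    F (enum 'I_r).

(* Laurent m a stands for \sum_(k : nat) (x - alpha(t))^(m + k) a_k(t).  A
   matrix of Laurent series is the same thing as a Laurent series with matrix
   coefficients (take for m the least of the finitely many orders).  Leading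
   coefficients may vanish, so a series has several representations and is
   determined only by its coefficients lcoef, see leq_on below. *)
Record laurent (R : realType) (r n : nat) := Laurent {
  lord : int;
  lseq : nat -> 'rV[R[i]]_r -> 'M[R[i]]_n }.

Definition lcoef (R : realType) (r n : nat) (f : laurent R r n) (i : int)
    (t : 'rV[R[i]]_r) : 'M[R[i]]_n :=
  if lord f <= i then lseq f `|i - lord f|%N t else 0.

Definition leq_on (R : realType) (r n : nat) (U : set 'rV[R[i]]_r)
    (f g : laurent R r n) : Prop :=
  forall i t, U t -> lcoef f i t = lcoef g i t.

Definition lone (R : realType) (r n : nat) : laurent R r n :=
  Laurent 0 (fun k _ => if k == 0%N then 1%:M else 0).

Definition ladd (R : realType) (r n : nat) (f g : laurent R r n) :
    laurent R r n :=
  let m := Num.min (lord f) (lord g) in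
  Laurent m (fun k t => lcoef f (m + k%:Z) t + lcoef g (m + k%:Z) t).

Definition lmul (R : realType) (r n : nat) (f g : laurent R r n) :
    laurent R r n :=
  Laurent (lord f + lord g)
    (fun k t => \sum_(j < k.+1) lseq f j t *m lseq g (k - j)%N t).

Definition lderiv (R : realType) (r n : nat) (f : laurent R r n) :
    laurent R r n :=
  Laurent (lord f - 1) (fun k t => (lord f + k%:Z)%:~R *: lseq f k t).

Definition lterm (R : realType) (r n : nat) (alpha : 'rV[R[i]]_r -> R[i])
    (f : laurent R r n) (x : R[i]) (t : 'rV[R[i]]_r) : nat -> 'M[R[i]]_n :=
  fun k => (x - alpha t) ^ (lord f + k%:Z) *: lseq f k t.

(* The value f(x, t); meaningful where the series converges. *)
Definition leval (R : realType) (r n : nat) (alpha : 'rV[R[i]]_r -> R[i])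
    (f : laurent R r n) (x : R[i]) (t : 'rV[R[i]]_r) : 'M[R[i]]_n :=
  limn (series (lterm alpha f x t)).

(* f is in gl_n(O_U({x - alpha(t)})) *)
Definition in_gl (R : realType) (r n : nat) (U : set 'rV[R[i]]_r)
    (alpha : 'rV[R[i]]_r -> R[i]) (f : laurent R r n) : Prop :=
  (forall k, mx_analytic_on U (lseq f k)) /\
  (forall t, U t -> exists2 e : R[i], 0 < e &
     forall x, 0 < `|x - alpha t| < e -> cvgn (series (lterm alpha f x t))).

(* P ranges over GL_n(O_U({x - alpha(t)})), P' being its inverse. *)
Definition equiv_eqn (R : realType) (r n : nat) (U : set 'rV[R[i]]_r)
    (alpha : 'rV[R[i]]_r -> R[i]) (A B : laurent R r n) : Prop :=
  exists P P' : laurent R r n,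
    [/\ in_gl U alpha P, in_gl U alpha P',
        leq_on U (lmul P P') (lone R r n),
        leq_on U (lmul P' P) (lone R r n) &
        leq_on U B (ladd (lmul (lderiv P) P') (lmul (lmul P A) P'))].

Definition simple_singular (R : realType) (r n : nat) (U : set 'rV[R[i]]_r)
    (A : laurent R r n) : Prop :=
  (forall i t, i < -1 -> U t -> lcoef A i t = 0) /\
  (exists2 t, U t & lcoef A (-1) t != 0).

Definition param_regular_singular (R : realType) (r n : nat)
    (U : set 'rV[R[i]]_r) (alpha : 'rV[R[i]]_r -> R[i])
    (A : laurent R r n) : Prop :=
  exists B : laurent R r n,
    [/\ in_gl U alpha B, simple_singular U B & equiv_eqn U alpha A B].

Definition cexp (R : realType) (z : R[i]) : R[i] :=
  let: Complex a b := z in Complex (expR a * cos b) (expR a * sin b).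

Definition sector (R : realType) (a : R[i]) (th0 th1 : R) : set R[i] :=
  [set x | exists rho th : R,
     [/\ 0 < rho, th0 < th, th < th1 &
         x = a + Complex (rho * cos th) (rho * sin th)]].

Definition log_branch (R : realType) (S : set R[i]) (L : R[i] -> R[i]) : Prop :=
  (forall z, S z -> {for z, continuous L}) /\ (forall z, S z -> cexp (L z) = z).

Definition expm (R : realType) (n : nat) (M : 'M[R[i]]_n) : 'M[R[i]]_n :=
  limn (series (fun k => (k`!%:R)^-1 *: M ^+ k)).

(* (\sum_i (x - alpha(t))^i Q_i(t)) (x - alpha(t))^(At(t)), where the power
   is taken with the branch L of the logarithm. *)
Definition Ysol (R : realType) (r n : nat) (alpha : 'rV[R[i]]_r -> R[i])
    (Q : laurent R r n) (At : 'rV[R[i]]_r -> 'M[R[i]]_n) (L : R[i] -> R[i])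
    (x : R[i]) (t : 'rV[R[i]]_r) : 'M[R[i]]_n :=
  leval alpha Q x t *m expm (L (x - alpha t) *: At t).

(* For each fixed t in U and every branch of the logarithm, x |-> Ysol x t is a
   fundamental matrix solution of dY/dx = A Y in a punctured neighbourhood of
   alpha(t); moreover it depends analytically on t, so that the partial
   derivatives with respect to t exist. *)
Definition fundamental_solution (R : realType) (r n : nat)
    (U : set 'rV[R[i]]_r) (alpha : 'rV[R[i]]_r -> R[i]) (A Q : laurent R r n)
    (At : 'rV[R[i]]_r -> 'M[R[i]]_n) : Prop :=
  forall t, U t -> exists2 e : R[i], 0 < e &
    forall (th0 th1 : R) (L : R[i] -> R[i]) (x : R[i]),
      th0 < th1 -> th1 - th0 < 2 * pi -> log_branch (sector 0 th0 th1) L ->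
      sector (alpha t) th0 th1 x -> `|x - alpha t| < e ->
      let Y := Ysol alpha Q At L in
      [/\ is_derive x 1 (fun y => Y y t) (leval alpha A x t *m Y x t),
          Y x t \in unitmx & mx_analytic_at (Y x) t].

(* Main.v *)
(** Proof idea.  On the unknown polydisc everything must become uniform in t:
    a Baire argument bounds the coefficients of z B and of P^-1 by K^(k+1) on
    some polydisc, and the maximum principle plus Cauchy's estimates turn these
    sup bounds into bounds on the l^1 norms of the Taylor coefficients in t.
    Write z Y' = C(z) Y, with C = z B.  Near the centre t0, C_0(t) is
    conjugate to diag(lam) plus a small matrix, lam being the spectrum of
    C_0(t0); so a contraction yields a gauge transformation T Q(z) after which
    the system is z Y' = N(z) Y where the entry (i, j) of N is a monomial
    in z^(lam_i - lam_j), analytic in t.  With d_i the integer part of Re lam_i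
    and z^D = diag(z^(d_i)), the gauge transformation z^D makes the system
    constant in z, namely z Y' = At Y with At = z^-D N z^D - D.  Hence
    Y = P^-1 T Q z^D z^At.
    For the growth of the derivatives in t, Y(x, .) extends to a polydisc of
    radius proportional to |z| around t, where it is O(|z|^-N0) with N0
    independent of t, since Re log z = ln |z| and Im log z is bounded on a
    sector.  Cauchy's estimates give d^m Y = O(|z|^(-N0 - |m|)). *)

Require Import Defs.
From mathcomp Require Import all_boot all_order all_algebra.
From mathcomp Require Import all_classical all_reals all_analysis.
From mathcomp Require Import complex finmap.
From mathcomp Require Import ring lra cyclic separable cyclotomic mxred spectral.
From mathcomp Require summability.
Set Implicit Arguments.
Unset Strict Implicit.
Unset Printing Implicit Defensive.
Import Order.TTheory GRing.Theory Num.Theory.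
Import numFieldNormedType.Exports.
Import Normc.
Local Open Scope classical_set_scope.
Local Open Scope ring_scope.
Local Open Scope complex_scope.
Arguments Normc.normc : simpl never.

(** * The modulus *)

(** The domain of convergence in x may shrink without control as t varies, so uniformity is obtained
    on some polydisc only, which need not contain 0. No contour integral is used: the norm
    $\sum_k|c_k|\rho^{|k|}$ is submultiplicative, survives recentring and passes to norm-convergent
    series, so a function built by sums, products, exponentials or iteration is analytic as soon as
    the norms of its pieces add up. The eigenvalues of $C_0(t)$ need not be analytic in t; hence
    only their values [lam] at $t_0$ are used, and the variation of $C_0$ counts as part of the
    perturbation. Removing a term of order $z^k$ means dividing by $k-(\lambda_i-\lambda_j)$; where
    this vanishes the term must be kept, which gives N its monomial shape. In the derivatives with
    respect to t, the obstacle is that x is fixed while $\alpha(s)$ moves: $\log(x-\alpha(s))=\log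
    z+\log(1-(\alpha(s)-\alpha(t))/z)$ is controlled only while $|\alpha(s)-\alpha(t)|$ is a
    fraction of $|z|$, so each derivative costs a factor $1/|z|$. *)

Lemma normcE_norm (R : realType) (z : R[i]) : `|z| = (normc z)%:C.
Proof. by rewrite normc_def; case: z. Qed.

Lemma normc_ge0 (R : realType) (z : R[i]) : 0 <= normc z.
Proof. by rewrite -ler0c -normcE_norm. Qed.

Lemma normc_eq0 (R : realType) (z : R[i]) : (normc z == 0) = (z == 0).
Proof. by rewrite -[LHS](inj_eq (@complexI R)) -normcE_norm normr_eq0. Qed.

Lemma normc_gt0 (R : realType) (z : R[i]) : (0 < normc z) = (z != 0).
Proof. by rewrite lt_def normc_eq0 normc_ge0 andbT. Qed.

Lemma normcD (R : realType) (x y : R[i]) :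
  normc (x + y) <= normc x + normc y.
Proof. exact: le_normcD. Qed.

Lemma normcB (R : realType) (x y : R[i]) : normc (x - y) = normc (y - x).
Proof. by rewrite -normcN opprB. Qed.

Lemma normcX (R : realType) (z : R[i]) k : normc (z ^+ k) = normc z ^+ k.
Proof.
by elim: k => [|k IH]; rewrite ?expr0 ?normc1 // !exprS normcM IH.
Qed.

Lemma normc_real (R : realType) (x : R) : normc x%:C = `|x|.
Proof. by apply: (@complexI R); rewrite -normcE_norm normc_def /= expr0n addr0 sqrtr_sqr. Qed.

Lemma normc_ler0 (R : realType) (x : R) : 0 <= x -> normc x%:C = x.
Proof. by move=> x0; rewrite normc_real ger0_norm. Qed.

Lemma normc_nat (R : realType) k : normc (k%:R : R[i]) = k%:R.
Proof. by rewrite -[k%:R](rmorph_nat (real_complex R)) normc_ler0. Qed.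

Lemma normc_Re (R : realType) (z : R[i]) : `|complex.Re z| <= normc z.
Proof. by rewrite -lecR -normcE_norm normc_ge_Re. Qed.

Lemma normc_Im (R : realType) (z : R[i]) : `|complex.Im z| <= normc z.
Proof.
case: z => a b; rewrite /= -sqrtr_sqr ler_sqrt ?lerDr ?sqr_ge0 //.
by rewrite addr_ge0 ?sqr_ge0.
Qed.

Lemma normc_le_ReIm (R : realType) (z : R[i]) :
  normc z <= `|complex.Re z| + `|complex.Im z|.
Proof.
rewrite {1}[z]complexE; apply: (le_trans (normcD _ _)).
rewrite normcM !normc_real.
by rewrite (_ : normc 'i = 1) ?mul1r // /normc /= expr0n add0r expr1n sqrtr1.
Qed.

Lemma normc_sum (R : realType) (I : Type) (s : seq I) (P : pred I)
    (F : I -> R[i]) :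
  normc (\sum_(i <- s | P i) F i) <= \sum_(i <- s | P i) normc (F i).
Proof.
elim/big_ind2: _ => [|x1 x2 y1 y2 h1 h2|//]; first by rewrite normc0.
by apply: le_trans (normcD _ _) _; apply: lerD.
Qed.

Lemma normc_prod (R : realType) (I : Type) (s : seq I) (P : pred I)
    (F : I -> R[i]) :
  normc (\prod_(i <- s | P i) F i) = \prod_(i <- s | P i) normc (F i).
Proof. by apply: (big_morph _ (@normcM R)); rewrite normc1. Qed.

Lemma ltc_real_exists (R : realType) (e : R[i]) :
  0 < e -> exists2 e' : R, 0 < e' & e = e'%:C.
Proof.
move=> e0; exists (complex.Re e); last by rewrite RRe_real // gtr0_real.
by move: e0; rewrite ltcE /= => /andP[].
Qed.

Lemma normc_ltC (R : realType) (z : R[i]) (e : R) :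
  (`|z| < e%:C) = (normc z < e).
Proof. by rewrite normcE_norm ltcR. Qed.

(** The norm of [R[i]] takes its values in [R[i]]; limits are restated with real radii, on which
    order arithmetic is available. *)
Lemma cvgcP (R : realType) (T : Type) (F : set_system T) {FF : Filter F}
    (f : T -> R[i]) (l : R[i]) :
  f @ F --> l <->
  forall e : R, 0 < e -> \forall x \near F, normc (f x - l) < e.
Proof.
split=> [/cvgr_dist_lt h e e0|h].
  have e0' : 0 < e%:C by rewrite ltcR.
  by near=> x; rewrite normcB -normc_ltC; near: x; exact: h.
apply/cvgrPdist_lt => e /ltc_real_exists[e' e0 ->].
by near=> x; rewrite normc_ltC normcB; near: x; exact: h.
Unshelve. all: by end_near.
Qed.

Lemma cvgn_normcP (R : realType) (f : nat -> R[i]) (l : R[i]) :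
  f @ \oo --> l <->
  forall e : R, 0 < e -> exists N, forall k, (N <= k)%N -> normc (f k - l) < e.
Proof.
rewrite cvgcP; split=> h e e0; first by have [N _ hN] := h e e0; exists N.
by have [N hN] := h e e0; exists N.
Qed.

Lemma nbhscP (R : realType) (z : R[i]) (P : set R[i]) :
  nbhs z P <-> exists2 e : R, 0 < e & forall x, normc (x - z) < e -> P x.
Proof.
split=> [/nbhs_normP[e e0 h]|[e e0 h]].
  have [e' e0' ee] := ltc_real_exists e0; exists e' => // x xz; apply: h => /=.
  by rewrite ee normc_ltC normcB.
apply/nbhs_normP; exists e%:C; first by rewrite /= ltcR.
by move=> x /=; rewrite normc_ltC normcB; exact: h.
Qed.

Lemma nbhs_mxcP (R : realType) m n (z : 'M[R[i]]_(m, n)) (P : set 'M[R[i]]_(m, n)) :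
  nbhs z P <->
  exists2 e : R, 0 < e &
    (forall x : 'M[R[i]]_(m, n), (forall i j, normc (x i j - z i j) < e) -> P x).
Proof.
split=> [/nbhs_ballP[e e0 h]|[e e0 h]].
  have [e' e0' ee] := ltc_real_exists e0; exists e' => // x xz; apply: h; split=> // i j.
  by rewrite ee -ball_normE /= normc_ltC normcB.
apply/nbhs_ballP; exists e%:C; first by rewrite /= ltcR.
move=> x [_ xz]; apply: h => i j; have := xz i j.
by rewrite -ball_normE /= normc_ltC normcB.
Qed.

Lemma cvg_mxcP (R : realType) m n (T : Type) (F : set_system T) {FF : Filter F}
    (f : T -> 'M[R[i]]_(m, n)) (l : 'M[R[i]]_(m, n)) :
  f @ F --> l <-> forall i j, (fun x => f x i j) @ F --> l i j.
Proof.
split=> [h i j|h].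
  apply/cvgcP => e e0; apply: (h [set x | normc (x i j - l i j) < e]).
  by apply/nbhs_mxcP; exists e => // x; exact.
move=> P /nbhs_mxcP[e e0 hP]; rewrite /nbhs /=.
suff: \forall x \near F, forall ij : 'I_m * 'I_n, normc (f x ij.1 ij.2 - l ij.1 ij.2) < e.
  by apply: filterS => x hx; apply: hP => i j; exact: (hx (i, j)).
apply: filter_forall => -[i j] /=.
by move/cvgcP: (h i j); apply.
Qed.

(** * Unconditional sums *)

Definition hsum (R : realType) (I : choiceType) (a : I -> R[i]) (s : R[i]) :=
  forall e : R, 0 < e -> exists J0 : {fset I}, forall J : {fset I},
    (J0 `<=` J)%fset -> normc (\sum_(i <- J) a i - s) <= e.

(** The bound [M] is kept explicit because it becomes the norm of a power series. *)
Definition asum (R : realType) (I : choiceType) (a : I -> R[i]) (M : R) :=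
  forall J : {fset I}, \sum_(i <- J) normc (a i) <= M.

Lemma hsumP (R : realType) (I : choiceType) (a : I -> R[i]) (s : R[i]) :
  summability.partial_sum a @ summability.totally --> s <-> hsum a s.
Proof.
have PF := @summability.totally_filter I.
split=> [h e e0|h].
  have [J0 _ hJ] : \forall x \near summability.totally, normc (summability.partial_sum a x - s) < e.
    by move/cvgcP: h; apply.
   exists J0 => J /hJ /ltW.
  by rewrite /summability.partial_sum -(big_seq_fsetE _ _ xpredT).
apply/cvgcP => e e0; have [J0 hJ] := h (e / 2) (divr_gt0 e0 (ltr0Sn _ 1)).
exists J0 => // J /hJ hh.
rewrite /summability.partial_sum -(big_seq_fsetE _ _ xpredT) /=.
by apply: le_lt_trans hh _; rewrite ltr_pdivrMr // mulr_natr mulr2n ltrDl.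
Qed.

Lemma big_fset_sub (R : realType) (I : choiceType) (V : nmodType) (F : I -> V)
    (J0 J : {fset I}) : (J0 `<=` J)%fset ->
  \sum_(i <- J | i \in J0) F i = \sum_(i <- J0) F i.
Proof.
move=> /fsubsetP sub; rewrite -big_filter; apply: perm_big.
apply: uniq_perm; rewrite ?filter_uniq ?fset_uniq //.
move=> i; rewrite mem_filter; case: (boolP (i \in J0)) => //= /sub.
by move->.
Qed.

Lemma sum_fset_sub (R : realType) (I : choiceType) (w : I -> R)
    (J0 J : {fset I}) : (forall i, 0 <= w i) -> (J0 `<=` J)%fset ->
  \sum_(i <- J0) w i <= \sum_(i <- J) w i.
Proof.
move=> w0 sub; rewrite -(big_fset_sub R _ sub) [leRHS](bigID (mem J0)) /=.
by rewrite lerDl sumr_ge0.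
Qed.

Lemma hsum_unique (R : realType) (I : choiceType) (a : I -> R[i]) s s' :
  hsum a s -> hsum a s' -> s = s'.
Proof.
move=> h h'; apply/eqP; rewrite -subr_eq0 -normc_eq0 eq_le normc_ge0 andbT.
apply/ler_addgt0Pr => e e0; rewrite add0r.
have e20 : 0 < e / 2 by rewrite divr_gt0.
have [J1 h1] := h _ e20; have [J2 h2] := h' _ e20.
have {}h1 := h1 _ (fsubsetUl _ J2); have {}h2 := h2 _ (fsubsetUr J1 _).
have -> : s - s' = (\sum_(i <- (J1 `|` J2)%fset) a i - s')
   - (\sum_(i <- (J1 `|` J2)%fset) a i - s) by ring.
apply: le_trans (normcD _ _) _; rewrite normcN; lra.
Qed.

Lemma hsum_ext (R : realType) (I : choiceType) (a b : I -> R[i]) s :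
  a =1 b -> hsum a s -> hsum b s.
Proof. by move=> /funext ->. Qed.

Lemma asum_ext (R : realType) (I : choiceType) (a b : I -> R[i]) M :
  a =1 b -> asum a M -> asum b M.
Proof. by move=> /funext ->. Qed.

Lemma asum_ge0 (R : realType) (I : choiceType) (a : I -> R[i]) M :
  asum a M -> 0 <= M.
Proof. by move=> /(_ fset0); rewrite big_seq_fset0. Qed.

Lemma asum_le (R : realType) (I : choiceType) (a b : I -> R[i]) M :
  (forall i, normc (a i) <= normc (b i)) -> asum b M -> asum a M.
Proof. by move=> h hb J; apply: le_trans (hb J); apply: ler_sum. Qed.

Lemma hsumD (R : realType) (I : choiceType) (a b : I -> R[i]) s s' :
  hsum a s -> hsum b s' -> hsum (fun i => a i + b i) (s + s').
Proof.
move=> h h' e e0; have e20 : 0 < e / 2 by rewrite divr_gt0.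
have [J1 h1] := h _ e20; have [J2 h2] := h' _ e20.
exists (J1 `|` J2)%fset => J sub.
have {}h1 := h1 _ (fsubset_trans (fsubsetUl _ _) sub).
have {}h2 := h2 _ (fsubset_trans (fsubsetUr J1 _) sub).
rewrite big_split /= (_ : _ + _ - _ = (\sum_(i <- J) a i - s) +
  (\sum_(i <- J) b i - s')); last by ring.
apply: le_trans (normcD _ _) _; lra.
Qed.

Lemma hsumZ (R : realType) (I : choiceType) (a : I -> R[i]) s c :
  hsum a s -> hsum (fun i => c * a i) (c * s).
Proof.
move=> h e e0; have c1 : 0 < normc c + 1 by rewrite ltr_wpDl ?normc_ge0.
have [J0 hJ] := h (e / (normc c + 1)) (divr_gt0 e0 c1).
exists J0 => J /hJ; rewrite -mulr_sumr -mulrBr normcM => hh.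
apply: le_trans (ler_wpM2l (normc_ge0 c) hh) _.
rewrite mulrC -mulrA ger_pMr // mulrC ler_pdivrMr // mul1r.
by rewrite lerDl.
Qed.

Lemma asumD (R : realType) (I : choiceType) (a b : I -> R[i]) M N :
  asum a M -> asum b N -> asum (fun i => a i + b i) (M + N).
Proof.
move=> ha hb J; apply: le_trans (lerD (ha J) (hb J)).
by rewrite -big_split; apply: ler_sum => i _; exact: normcD.
Qed.

Lemma asumZ (R : realType) (I : choiceType) (a : I -> R[i]) M c :
  asum a M -> asum (fun i => c * a i) (normc c * M).
Proof.
move=> ha J; under eq_bigr do rewrite normcM.
by rewrite -mulr_sumr ler_wpM2l ?normc_ge0.
Qed.

Lemma asum_hsum_real (R : realType) (I : choiceType) (w : I -> R) M :
  (forall i, 0 <= w i) -> asum (fun i => (w i)%:C) M ->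
  exists s, hsum (fun i => (w i)%:C) s.
Proof.
move=> w0 hw; pose S := [set x | exists J : {fset I}, x = \sum_(i <- J) w i].
have hM (J : {fset I}) : \sum_(i <- J) w i <= M.
  by apply: le_trans (hw J); apply: ler_sum => i _; rewrite normc_real ler_norm.
have hS : has_sup S.
  by split; [exists (\sum_(i <- fset0) w i), fset0 | exists M => _ [J ->]].
exists (sup S)%:C => e e0.
have [_ [J0 ->] hJ0] := sup_adherent e0 hS.
exists J0 => J sub; rewrite -rmorph_sum -rmorphB normc_real.
have h1 := sum_fset_sub w0 sub.
have h2 : \sum_(i <- J) w i <= sup S by apply: ub_le_sup; [case: hS|exists J].
rewrite ler0_norm ?subr_le0 // opprB lerBlDl -lerBlDr; apply: le_trans h1.
exact: ltW.
Qed.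

(** For [g] the real or the imaginary part, $g(a_i)=(|a_i|+g(a_i))-|a_i|$ is a difference of two
    nonnegative families, whose sums are suprema of finite partial sums. *)
Lemma asum_hsum (R : realType) (I : choiceType) (a : I -> R[i]) M :
  asum a M -> exists s, hsum a s.
Proof.
move=> ha.
have key (g : R[i] -> R) : (forall z, `|g z| <= normc z) ->
    exists s, hsum (fun i => (g (a i))%:C) s.
  move=> hg.
  have [||s1 h1] := @asum_hsum_real R I (fun i => normc (a i) + g (a i)) (M + M).
  - by move=> i; have := hg (a i); rewrite ler_norml => /andP[]; lra.
  - move=> J; apply: le_trans (lerD (ha J) (ha J)); rewrite -big_split.
    apply: ler_sum => i _; rewrite normc_real; apply: le_trans (ler_normD _ _) _.
    by rewrite lerD ?hg // ger0_norm ?normc_ge0.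
  have [||s2 h2] := @asum_hsum_real R I (fun i => normc (a i)) M.
  - by move=> i; exact: normc_ge0.
  - by move=> J; apply: le_trans (ha J); apply: ler_sum => i _; rewrite normc_ler0 ?normc_ge0.
  exists (s1 + -1 * s2); apply: hsum_ext (hsumD h1 (hsumZ (-1) h2)) => i /=.
  by rewrite rmorphD; ring.
have [s1 h1] := key _ (@normc_Re R); have [s2 h2] := key _ (@normc_Im R).
by exists (s1 + 'i * s2); apply: hsum_ext (hsumD h1 (hsumZ 'i h2)) => i; rewrite -complexE.
Qed.

Lemma hsum_norm (R : realType) (I : choiceType) (a : I -> R[i]) M s :
  asum a M -> hsum a s -> normc s <= M.
Proof.
move=> ha hs; apply/ler_addgt0Pr => e e0; have [J0 /(_ _ (fsubset_refl _)) h] := hs _ e0.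
rewrite (_ : s = \sum_(i <- J0) a i - (\sum_(i <- J0) a i - s)); last by ring.
apply: le_trans (normcD _ _) _; rewrite normcN lerD //.
by apply: le_trans (normc_sum _ _ _) (ha J0).
Qed.

Lemma asum_tail (R : realType) (I : choiceType) (a : I -> R[i]) M (e : R) :
  asum a M -> 0 < e -> exists J0 : {fset I}, forall J : {fset I},
    \sum_(i <- J | i \notin J0) normc (a i) <= e.
Proof.
move=> ha e0; pose S := [set x | exists J : {fset I}, x = \sum_(i <- J) normc (a i)].
have hS : has_sup S.
  by split; [exists (\sum_(i <- fset0) normc (a i)), fset0 | exists M => _ [J ->]].
have [_ [J0 ->] hJ0] := sup_adherent e0 hS.
exists J0 => J; have h2 : \sum_(i <- (J0 `|` J)%fset) normc (a i) <= sup S.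
  by apply: ub_le_sup; [case: hS|exists (J0 `|` J)%fset].
have := h2; rewrite (bigID (mem J0)) /= (big_fset_sub R _ (fsubsetUl _ _)).
have : \sum_(i <- J | i \notin J0) normc (a i) <=
   \sum_(i <- (J0 `|` J)%fset | i \notin J0) normc (a i).
  rewrite [leLHS]big_mkcond [leRHS]big_mkcond; apply: sum_fset_sub; last exact: fsubsetUr.
  by move=> i; case: ifP; rewrite ?normc_ge0.
lra.
Qed.

Lemma hsum_group_family (R : realType) (I J : choiceType) (a : I -> R[i])
    (pi : I -> J) (e : J -> R[i]) (K : seq J) (d : R) : 0 < d ->
  (forall j, hsum (fun i => if pi i == j then a i else 0) (e j)) ->
  exists J0 : {fset I}, forall L : {fset I}, (J0 `<=` L)%fset ->
    forall j, j \in K -> normc (\sum_(i <- L | pi i == j) a i - e j) <= d.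
Proof.
move=> d0 he; elim: K => [|k K [J0 IH]]; first by exists fset0.
have [J1 h1] := he k d d0; exists (J0 `|` J1)%fset => L sub j.
rewrite inE => /orP[/eqP ->|]; last first.
  by apply: IH; apply: fsubset_trans sub; exact: fsubsetUl.
by rewrite big_mkcond; apply: h1; apply: fsubset_trans sub; exact: fsubsetUr.
Qed.

Lemma sum_fibers (R : realType) (I J : choiceType) (V : nmodType) (f : I -> V)
    (pi : I -> J) (K : {fset J}) (L : seq I) :
  \sum_(j <- K) \sum_(i <- L | pi i == j) f i = \sum_(i <- L | pi i \in K) f i.
Proof.
rewrite [RHS]big_mkcond.
rewrite (eq_bigr (fun j => \sum_(i <- L) if pi i == j then f i else 0)); last first.
  by move=> j _; rewrite big_mkcond.
rewrite exchange_big /=; apply: eq_bigr => i _.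
case: ifP => hi; last first.
  rewrite big_seq big1 // => j jK; case: eqP => // ij; by rewrite ij jK in hi.
rewrite (big_fsetD1 _ hi) /= eqxx big_seq big1 ?addr0 // => j.
by rewrite in_fsetD1 eq_sym; case: eqP.
Qed.

(** The packet sums [e j], for all [j] in [K] at once, are approximated within [d / n] by partial
    sums over one finite set [L]. The successor in [n] keeps it nonzero when [K] is empty. *)
Lemma asum_group (R : realType) (I J : choiceType) (a : I -> R[i])
    (pi : I -> J) (e : J -> R[i]) M :
  asum a M ->
  (forall j, hsum (fun i => if pi i == j then a i else 0) (e j)) ->
  asum e M.
Proof.
move=> ha he K; apply/ler_addgt0Pr => d d0.
pose n := (size (enum_fset K)).+1%:R : R.
have n0 : 0 < n by rewrite ltr0n.
have [L /(_ L (fsubset_refl _)) hL] := hsum_group_family (enum_fset K) (divr_gt0 d0 n0) he.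
have h1 : \sum_(j <- K) normc (e j) <= \sum_(j <- K)
   (\sum_(i <- L | pi i == j) normc (a i) + d / n).
  rewrite big_seq [leRHS]big_seq; apply: ler_sum => j jK.
  have -> : e j = \sum_(i <- L | pi i == j) a i - (\sum_(i <- L | pi i == j) a i - e j) by ring.
  apply: le_trans (normcD _ _) _; rewrite normcN lerD ?hL //.
  exact: normc_sum.
apply: (le_trans h1); rewrite big_split /= sum_fibers //; apply: lerD.
  apply: le_trans (ha L); rewrite [leRHS](bigID (fun i => pi i \in K)) /= lerDl.
  by apply: sumr_ge0 => i _; exact: normc_ge0.
rewrite big_const_seq count_predT iter_addr addr0 -mulr_natr -mulrA ger_pMr //.
by rewrite mulrC ler_pdivrMr // mul1r ler_nat leqnSn.
Qed.

(** Once [K] contains the image of [J0], an index of [L] whose packet is not in [K] lies outside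
    [J1], so the part of the sum missed by [K] belongs to a tail. *)
Lemma hsum_group (R : realType) (I J : choiceType) (a : I -> R[i])
    (pi : I -> J) (e : J -> R[i]) M s :
  asum a M ->
  (forall j, hsum (fun i => if pi i == j then a i else 0) (e j)) ->
  hsum a s -> hsum e s.
Proof.
move=> ha he hs d d0; have d3 : 0 < d / 3 by rewrite divr_gt0.
have [J1 hJ1] := asum_tail ha d3.
have [J2 hJ2] := hs _ d3.
pose J0 := (J1 `|` J2)%fset.
exists [fset pi i | i in J0]%fset => K sub.
pose n := (size (enum_fset K)).+1%:R : R.
have n0 : 0 < n by rewrite ltr0n.
have [L0 hL] := hsum_group_family (enum_fset K) (divr_gt0 d3 n0) he.
pose L := (L0 `|` J0)%fset; have {}hL := hL L (fsubsetUl _ _).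
have h1 : normc (\sum_(j <- K) (\sum_(i <- L | pi i == j) a i - e j)) <= d / 3.
  apply: le_trans (normc_sum _ _ _) _.
  have : \sum_(j <- K) normc (\sum_(i <- L | pi i == j) a i - e j) <= \sum_(j <- K) (d / 3 / n).
    by rewrite big_seq [leRHS]big_seq; apply: ler_sum => j /hL.
  move/le_trans; apply.
  rewrite big_const_seq count_predT iter_addr addr0 -[X in X <= _]mulr_natr -mulrA ger_pMr //.
  by rewrite mulrC ler_pdivrMr // mul1r ler_nat leqnSn.
have h2 : normc (\sum_(i <- L) a i - s) <= d / 3.
  by apply: hJ2; apply: fsubset_trans (fsubsetUr L0 _); exact: fsubsetUr.
have h3 : normc (\sum_(i <- L | pi i \notin K) a i) <= d / 3.
  apply: le_trans (normc_sum _ _ _) _; apply: le_trans (hJ1 L).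
  rewrite [leLHS]big_mkcond [leRHS]big_mkcond; apply: ler_sum => i _.
  case: ifP; case: ifP; rewrite ?normc_ge0 // => /negbFE iJ1.
  suff -> : pi i \in K by [].
  by apply: (fsubsetP sub); apply/imfsetP; exists i => //=; rewrite inE iJ1.
move: h1; rewrite sumrB sum_fibers // => h1.
move: h2; rewrite (bigID (fun i => pi i \in K)) /= => h2.
rewrite (_ : _ - s = - (\sum_(i <- L | pi i \in K) a i - \sum_(i <- K) e i)
  + (\sum_(i <- L | pi i \in K) a i + \sum_(i <- L | pi i \notin K) a i - s)
  - \sum_(i <- L | pi i \notin K) a i); last by ring.
apply: le_trans (normcD _ _) _; rewrite normcN.
apply: le_trans (lerD (normcD _ _) (lexx _)) _; rewrite normcN.
lra.
Qed.

(** Absolute summability provides some sum of [a]; grouping and uniqueness identify it. *)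
Lemma hsum_ungroup (R : realType) (I J : choiceType) (a : I -> R[i])
    (pi : I -> J) (e : J -> R[i]) M s :
  asum a M ->
  (forall j, hsum (fun i => if pi i == j then a i else 0) (e j)) ->
  hsum e s -> hsum a s.
Proof.
move=> ha he hs; have [s' hs'] := asum_hsum ha.
by rewrite (hsum_unique hs (hsum_group ha he hs')).
Qed.

Lemma asum_restrict (R : realType) (I : choiceType) (a : I -> R[i])
    (P : pred I) M : asum a M -> asum (fun i => if P i then a i else 0) M.
Proof. by apply: asum_le => i; case: ifP; rewrite ?normc0 ?normc_ge0. Qed.

Lemma hsum_fin (R : realType) (I : choiceType) (a : I -> R[i]) (K : {fset I}) :
  (forall i, i \notin K -> a i = 0) -> hsum a (\sum_(i <- K) a i).
Proof.
move=> h e e0; exists K => J sub; rewrite (bigID (mem K)) /= big_fset_sub //.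
by rewrite [X in _ + X - _]big1 // addr0 subrr normc0 ltW.
Qed.

Lemma hsum_series (R : realType) (a : nat -> R[i]) s :
  hsum a s -> series a @ \oo --> s.
Proof.
move=> h; apply/cvgn_normcP => e e0.
have [J0 hJ] := h _ (divr_gt0 e0 (ltr0Sn _ 1)).
exists (\max_(i <- J0) i).+1 => k hk; pose J := [fset i | i in iota 0 k]%fset.
have -> : series a k = \sum_(i <- J) a i.
  rewrite /series /= big_mkord -(big_mkord xpredT) /index_iota subn0.
  apply: perm_big; apply: uniq_perm; rewrite ?iota_uniq ?fset_uniq //.
  by move=> i; rewrite !inE.
have /hJ/le_lt_trans -> // : (J0 `<=` J)%fset.
  apply/fsubsetP => i iJ; rewrite !inE mem_iota /= add0n; apply: leq_trans hk.
  by rewrite ltnS (big_rem i) //= leq_max leqnn.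
by rewrite ltr_pdivrMr // mulr_natr mulr2n ltrDl.
Qed.

Lemma big_fset_seq (I : choiceType) (V : nmodType) (F : I -> V) (l : seq I) :
  uniq l -> \sum_(i <- [fset i | i in l]%fset) F i = \sum_(i <- l) F i.
Proof.
move=> ul; apply: perm_big; apply: uniq_perm; rewrite ?fset_uniq //.
by move=> i; rewrite !inE.
Qed.

Lemma sum_fst_fiber (I J : choiceType) (V : nmodType) (K : {fset I * J}) (i : I)
    (F : I * J -> V) :
  \sum_(p <- K | p.1 == i) F p =
  \sum_(j <- [fset j | j in [seq p.2 | p <- [seq p <- K | p.1 == i]]]%fset) F (i, j).
Proof.
rewrite big_fset_seq; last first.
  rewrite map_inj_in_uniq ?filter_uniq ?fset_uniq // => -[i1 j1] [i2 j2].
  by rewrite !mem_filter /= => /andP[/eqP -> _] /andP[/eqP -> _] ->.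
rewrite big_map -[LHS]big_filter [LHS]big_seq [RHS]big_seq; apply: eq_bigr => -[a b].
by rewrite mem_filter /= => /andP[/eqP ->].
Qed.

Lemma hsum_fst_fiber (R : realType) (I J : choiceType) (a : I * J -> R[i]) i s :
  hsum (fun j => a (i, j)) s -> hsum (fun p => if p.1 == i then a p else 0) s.
Proof.
move=> h e e0; have [J0 hJ] := h e e0.
exists [fset (i, j) | j in J0]%fset => K sub.
rewrite -big_mkcond sum_fst_fiber.
apply: hJ; apply/fsubsetP => j jJ; rewrite !inE; apply/mapP; exists (i, j) => //.
by rewrite mem_filter eqxx /=; apply: (fsubsetP sub); apply/imfsetP; exists j.
Qed.

Lemma asum_pair (R : realType) (I J : choiceType) (a : I * J -> R[i])
    (M : I -> R) N :
  (forall i, asum (fun j => a (i, j)) (M i)) ->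
  (forall K : {fset I}, \sum_(i <- K) M i <= N) -> asum a N.
Proof.
move=> ha hN K; apply: le_trans (hN [fset p.1 | p in K]%fset).
rewrite (_ : \sum_(i <- K) _ = \sum_(p <- K | p.1 \in [fset p.1 | p in K]%fset) normc (a p)).
  by rewrite -sum_fibers //; apply: ler_sum => i _; rewrite sum_fst_fiber; exact: ha.
rewrite [LHS]big_seq [RHS]big_seq_cond; apply: eq_bigl => p.
case: (boolP (p \in K)) => //= pK; apply/esym/imfsetP; by exists p.
Qed.

(** Grouping the products by their first index reduces the double sum to $\sum_i a_i t$. *)
Lemma hsum_mul (R : realType) (I J : choiceType) (a : I -> R[i]) (b : J -> R[i])
    M N s t :
  asum a M -> asum b N -> hsum a s -> hsum b t ->
  asum (fun p : I * J => a p.1 * b p.2) (M * N) /\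
  hsum (fun p : I * J => a p.1 * b p.2) (s * t).
Proof.
move=> ha hb hs ht.
have hab : asum (fun p : I * J => a p.1 * b p.2) (M * N).
  apply: (@asum_pair _ _ _ _ (fun i => normc (a i) * N)) => [i|K].
    exact: (asumZ (a i) hb).
  by rewrite -mulr_suml ler_wpM2r ?(asum_ge0 hb).
split=> //.
apply: (@hsum_ungroup _ _ _ _ fst (fun i => a i * t) _ _ hab); last first.
  by under eq_fun do rewrite mulrC; rewrite mulrC; exact: hsumZ.
by move=> i; apply: (@hsum_fst_fiber _ _ _ (fun p => a p.1 * b p.2)); exact: (hsumZ (a i) ht).
Qed.

Lemma fset_nat_sub_iota (K : {fset nat}) :
  exists n, (K `<=` [fset i | i in iota 0 n])%fset.
Proof.
suff [n hn] : exists n, forall i, i \in K -> (i < n)%N.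
  by exists n; apply/fsubsetP => i /hn ilt; rewrite !inE mem_iota.
exists (\max_(i <- K) i).+1 => i iJ.
by rewrite ltnS (big_rem i) //= leq_max leqnn.
Qed.

Lemma sum_fset_nat (R : realType) (w : nat -> R) M : (forall i, 0 <= w i) ->
  (forall n, \sum_(0 <= i < n) w i <= M) -> forall K : {fset nat}, \sum_(i <- K) w i <= M.
Proof.
move=> w0 h K; have [n sub] := fset_nat_sub_iota K.
apply: le_trans (sum_fset_sub w0 sub) _; rewrite big_fset_seq ?iota_uniq //.
by apply: le_trans (h n); rewrite /index_iota subn0.
Qed.

Lemma asum_nat (R : realType) (a : nat -> R[i]) M :
  (forall n, \sum_(0 <= i < n) normc (a i) <= M) -> asum a M.
Proof. by move=> h; apply: sum_fset_nat h => i; exact: normc_ge0. Qed.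

Lemma hsum_of_series (R : realType) (a : nat -> R[i]) M s :
  asum a M -> series a @ \oo --> s -> hsum a s.
Proof.
move=> ha hs; have [s' hs'] := asum_hsum ha.
by rewrite (cvg_unique _ hs (hsum_series hs')).
Qed.

(** A term outside [J0] is the difference between the partial sums over [J0] and over [J0] with one
    index added, both within 1 of [s]. *)
Lemma hsum_bounded (R : realType) (I : choiceType) (a : I -> R[i]) s :
  hsum a s -> exists2 B, 0 <= B & forall i, normc (a i) <= B.
Proof.
move=> h; have [J0 hJ] := h 1 ltr01.
have S0 : 0 <= \sum_(i <- J0) normc (a i) by apply: sumr_ge0 => i _; exact: normc_ge0.
exists (2 + \sum_(i <- J0) normc (a i)) => [|i]; first exact: addr_ge0.
have [iJ|iJ] := boolP (i \in J0).
  rewrite (big_fsetD1 _ iJ) /= addrCA lerDl addr_ge0 //.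
  by apply: sumr_ge0 => j _; exact: normc_ge0.
have h1 := hJ _ (fsubset_refl _); have := hJ _ (fsubsetU1 i J0).
rewrite big_fsetU1 //= => h2.
rewrite (_ : a i = (a i + \sum_(j <- J0) a j - s) - (\sum_(j <- J0) a j - s)); last by ring.
apply: le_trans (normcD _ _) _; rewrite normcN; lra.
Qed.

(** * Power series on polydiscs *)

Definition mdeg r (k : {ffun 'I_r -> nat}) := (\sum_j k j)%N.

Definition mono (R : realType) r (t0 t : 'rV[R[i]]_r) (k : {ffun 'I_r -> nat}) :=
  \prod_(j < r) (t 0 j - t0 0 j) ^+ k j.

Definition pdisc (R : realType) r (t0 : 'rV[R[i]]_r) (rho : R) : set 'rV[R[i]]_r :=
  [set t | forall j, normc (t 0 j - t0 0 j) <= rho].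

(* f is, on the closed polydisc of radius rho, the sum of a power series whose
   Wiener norm \sum_k |c_k| rho^|k| is at most M. *)
Definition wiener (R : realType) r (t0 : 'rV[R[i]]_r) (rho M : R)
    (f : 'rV[R[i]]_r -> R[i]) :=
  exists c : {ffun 'I_r -> nat} -> R[i],
    asum (fun k => (rho ^+ mdeg k)%:C * c k) M /\
    forall t, pdisc t0 rho t -> hsum (fun k => c k * mono t0 t k) (f t).

Lemma normc_mono (R : realType) r (t0 t : 'rV[R[i]]_r) rho k :
  0 <= rho -> pdisc t0 rho t -> normc (mono t0 t k) <= rho ^+ mdeg k.
Proof.
move=> r0 h; rewrite /mono normc_prod /mdeg expr_sum; apply: ler_prod => j _.
by rewrite normc_ge0 normcX lerXn2r ?nnegrE ?normc_ge0 // h.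
Qed.

Lemma wiener_asum (R : realType) r (t0 t : 'rV[R[i]]_r) rho M c :
  0 <= rho -> asum (fun k => (rho ^+ mdeg k)%:C * c k) M -> pdisc t0 rho t ->
  asum (fun k => c k * mono t0 t k) M.
Proof.
move=> r0 hc ht; apply: asum_le hc => k; rewrite mulrC !normcM.
by rewrite ler_wpM2r ?normc_ge0 // normc_ler0 ?exprn_ge0 // normc_mono.
Qed.

(** Monomials indexed by any [I], with repeated exponents, become a genuine power series once equal
    exponents are collected. Products, infinite sums and derivatives below go through this. *)
Lemma wiener_intro (R : realType) r (t0 : 'rV[R[i]]_r) rho M f
    (I : choiceType) (b : I -> R[i]) (kap : I -> {ffun 'I_r -> nat}) :
  0 < rho -> asum (fun i => (rho ^+ mdeg (kap i))%:C * b i) M ->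
  (forall t, pdisc t0 rho t -> hsum (fun i => b i * mono t0 t (kap i)) (f t)) ->
  wiener t0 rho M f.
Proof.
move=> r0 hb hf.
have hr k : (rho ^+ mdeg k)%:C != 0 :> R[i] by rewrite -normc_eq0 normc_ler0 ?exprn_ge0 ?expf_neq0 ?gt_eqF // ltW.
(* Summability is known for the weighted family; on one fibre the weight is a nonzero constant and
   is divided out afterwards. *)
have /choice[e' he'] k : exists e, hsum
    (fun i => if kap i == k then (rho ^+ mdeg (kap i))%:C * b i else 0) e.
  exact: asum_hsum (asum_restrict _ hb).
pose e k := (rho ^+ mdeg k)%:C^-1 * e' k.
have he k : hsum (fun i => if kap i == k then b i else 0) (e k).
  apply: hsum_ext (hsumZ _ (he' k)) => i.
  by case: eqP => [->|]; rewrite ?mulr0 // mulKf.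
exists e; split.
  apply: asum_ext (asum_group hb he') => k.
  by rewrite /e mulVKf.
move=> t ht; apply: (hsum_group (pi := kap) _ _ (hf t ht)).
  apply: asum_le hb => i; rewrite mulrC !normcM.
  rewrite ler_wpM2r ?normc_ge0 // normc_ler0 ?exprn_ge0 ?(ltW r0) // normc_mono //.
  exact: ltW.
move=> k; have := hsumZ (mono t0 t k) (he k); rewrite mulrC; apply: hsum_ext => i.
by case: eqP => [->|]; rewrite ?mulr0 // mulrC.
Qed.

Lemma wiener_ge0 (R : realType) r (t0 : 'rV[R[i]]_r) rho M f :
  wiener t0 rho M f -> 0 <= M.
Proof. by move=> [c [/asum_ge0]]. Qed.

Lemma wiener_bound (R : realType) r (t0 t : 'rV[R[i]]_r) rho M f :
  0 <= rho -> wiener t0 rho M f -> pdisc t0 rho t -> normc (f t) <= M.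
Proof.
by move=> r0 [c [hc hf]] ht; apply: hsum_norm (hf t ht); exact: wiener_asum ht.
Qed.

Lemma wiener_le (R : realType) r (t0 : 'rV[R[i]]_r) rho M M' f :
  M <= M' -> wiener t0 rho M f -> wiener t0 rho M' f.
Proof. by move=> MM [c [hc hf]]; exists c; split=> // J; apply: le_trans MM. Qed.

Lemma wiener_ext (R : realType) r (t0 : 'rV[R[i]]_r) rho M f g :
  (forall t, pdisc t0 rho t -> f t = g t) -> wiener t0 rho M f -> wiener t0 rho M g.
Proof.
by move=> fg [c [hc hf]]; exists c; split=> // t ht; rewrite -fg //; exact: hf.
Qed.

Lemma pdisc_le (R : realType) r (t0 : 'rV[R[i]]_r) rho rho' :
  rho' <= rho -> pdisc t0 rho' `<=` pdisc t0 rho.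
Proof. by move=> rr t ht j; apply: le_trans rr. Qed.

Lemma wiener_shrink (R : realType) r (t0 : 'rV[R[i]]_r) rho rho' M f :
  0 <= rho' -> rho' <= rho -> wiener t0 rho M f -> wiener t0 rho' M f.
Proof.
move=> r0 rr [c [hc hf]]; exists c; split; last by move=> t /(pdisc_le rr); exact: hf.
apply: asum_le hc => k; rewrite !normcM ler_wpM2r ?normc_ge0 //.
by rewrite !normc_ler0 ?exprn_ge0 ?(le_trans r0) // lerXn2r ?nnegrE // (le_trans r0).
Qed.

Lemma hsum_unit (R : realType) (a : unit -> R[i]) : hsum a (a tt).
Proof.
by have := @hsum_fin R unit a [fset tt]%fset; rewrite big_seq_fset1; apply=> -[]; rewrite inE.
Qed.

Lemma asum_unit (R : realType) (a : unit -> R[i]) M : normc (a tt) <= M -> asum a M.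
Proof.
move=> h K; apply: le_trans h.
have <- : \sum_(i <- [fset tt]%fset) normc (a i) = normc (a tt) by rewrite big_seq_fset1.
apply: (sum_fset_sub (w := fun i => normc (a i))) => [?|]; first exact: normc_ge0.
by apply/fsubsetP => -[]; rewrite inE.
Qed.

Lemma wiener_const (R : realType) r (t0 : 'rV[R[i]]_r) rho a :
  0 < rho -> wiener t0 rho (normc a) (fun _ => a).
Proof.
move=> r0; apply: (@wiener_intro _ _ _ _ _ _ unit (fun _ => a) (fun _ => [ffun=> 0%N])) => //.
  apply: asum_unit; rewrite /mdeg big1 ?expr0 ?mul1r // => j _; by rewrite ffunE.
move=> t _; have := @hsum_unit R (fun=> a * mono t0 t [ffun=> 0%N]).
by rewrite {2}/mono big1 ?mulr1 // => j _; rewrite ffunE expr0.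
Qed.

Lemma wiener_coord (R : realType) r (t0 : 'rV[R[i]]_r) rho j :
  0 < rho -> wiener t0 rho rho (fun t => t 0 j - t0 0 j).
Proof.
move=> r0; pose k0 : {ffun 'I_r -> nat} := [ffun i => (i == j) : nat].
apply: (@wiener_intro _ _ _ _ _ _ unit (fun _ => 1) (fun _ => k0)) => //.
  apply: asum_unit; rewrite /mdeg (bigD1 j) //= big1 ?addn0.
    by rewrite ffunE eqxx expr1 mulr1 normc_ler0 // ltW.
  by move=> i ij; rewrite ffunE (negbTE ij).
move=> t _; have := @hsum_unit R (fun=> 1 * mono t0 t k0).
rewrite {2}/mono (bigD1 j) //= big1 ?mulr1 ?mul1r ?ffunE ?eqxx ?expr1 //.
by move=> i ij; rewrite ffunE (negbTE ij).
Qed.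

Lemma wiener_add (R : realType) r (t0 : 'rV[R[i]]_r) rho M N f g :
  wiener t0 rho M f -> wiener t0 rho N g -> wiener t0 rho (M + N) (fun t => f t + g t).
Proof.
move=> [c [hc hf]] [d [hd hg]]; exists (fun k => c k + d k); split.
  by apply: asum_ext (asumD hc hd) => k; rewrite mulrDr.
by move=> t ht; apply: hsum_ext (hsumD (hf t ht) (hg t ht)) => k; rewrite mulrDl.
Qed.

Lemma wiener_scale (R : realType) r (t0 : 'rV[R[i]]_r) rho M f a :
  wiener t0 rho M f -> wiener t0 rho (normc a * M) (fun t => a * f t).
Proof.
move=> [c [hc hf]]; exists (fun k => a * c k); split.
  by apply: asum_ext (asumZ a hc) => k; rewrite mulrCA.
by move=> t ht; apply: hsum_ext (hsumZ a (hf t ht)) => k; rewrite mulrA.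
Qed.

Lemma wiener_opp (R : realType) r (t0 : 'rV[R[i]]_r) rho M f :
  wiener t0 rho M f -> wiener t0 rho M (fun t => - f t).
Proof.
move=> /(wiener_scale (-1)); rewrite normcN normc1 mul1r.
by apply: wiener_ext => t _; rewrite mulN1r.
Qed.

Lemma wiener_sub (R : realType) r (t0 : 'rV[R[i]]_r) rho M N f g :
  wiener t0 rho M f -> wiener t0 rho N g -> wiener t0 rho (M + N) (fun t => f t - g t).
Proof. by move=> hf /wiener_opp; exact: wiener_add. Qed.

Lemma wiener_mul (R : realType) r (t0 : 'rV[R[i]]_r) rho M N f g : 0 < rho ->
  wiener t0 rho M f -> wiener t0 rho N g -> wiener t0 rho (M * N) (fun t => f t * g t).
Proof.
move=> r0 [c [hc hf]] [d [hd hg]].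
pose kap (p : {ffun 'I_r -> nat} * {ffun 'I_r -> nat}) := [ffun j => (p.1 j + p.2 j)%N].
apply: (@wiener_intro _ _ _ _ _ _ _ (fun p => c p.1 * d p.2) kap) => //.
  have [h1 h2] := asum_hsum hc; have [h3 h4] := asum_hsum hd.
  have [+ _] := hsum_mul hc hd h2 h4; apply: asum_ext => p.
  rewrite /mdeg; under [X in (rho ^+ X)%:C * (c _ * d _)]eq_bigr do rewrite ffunE.
  by rewrite big_split /= exprD rmorphM; ring.
move=> t ht; have [_] := hsum_mul (wiener_asum (ltW r0) hc ht) (wiener_asum (ltW r0) hd ht)
  (hf t ht) (hg t ht).
apply: hsum_ext => p; rewrite mulrACA; congr (_ * _).
by rewrite /mono -big_split /=; apply: eq_bigr => j _; rewrite ffunE exprD.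
Qed.

(** This replaces Weierstrass's theorem on limits of analytic functions: if the norms are summable,
    so is the double family of all monomials, and it may be summed in either order. *)
Lemma wiener_hsum (R : realType) r (t0 : 'rV[R[i]]_r) rho (J : choiceType)
    (M : J -> R) N (F : J -> 'rV[R[i]]_r -> R[i]) f : 0 < rho ->
  (forall j, wiener t0 rho (M j) (F j)) ->
  (forall K : {fset J}, \sum_(j <- K) M j <= N) ->
  (forall t, pdisc t0 rho t -> hsum (fun j => F j t) (f t)) ->
  wiener t0 rho N f.
Proof.
move=> r0 /choice[c hc] hN hf.
apply: (@wiener_intro _ _ _ _ _ _ _ (fun p : J * _ => c p.1 p.2) snd) => //.
  by apply: asum_pair hN => j; have [] := hc j.
move=> t ht; have ha : asum (fun p : J * {ffun 'I_r -> nat} => c p.1 p.2 * mono t0 t p.2) N.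
  apply: asum_pair hN => j; apply: (wiener_asum (ltW r0)) ht.
  by have [] := hc j.
apply: (hsum_ungroup (pi := fst) ha _ (hf t ht)) => j.
apply: (@hsum_fst_fiber _ _ _ (fun p => c p.1 p.2 * mono t0 t p.2)).
by have [_] := hc j; apply.
Qed.

Lemma wiener_series (R : realType) r (t0 : 'rV[R[i]]_r) rho
    (M : nat -> R) N (F : nat -> 'rV[R[i]]_r -> R[i]) f : 0 < rho ->
  (forall j, wiener t0 rho (M j) (F j)) ->
  (forall n, \sum_(0 <= j < n) M j <= N) ->
  (forall t, pdisc t0 rho t -> series (fun j => F j t) @ \oo --> f t) ->
  wiener t0 rho N f.
Proof.
move=> r0 hF hN hf; apply: (wiener_hsum r0 hF).
  by apply: sum_fset_nat => // i; apply: wiener_ge0 (hF i).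
move=> t ht; apply: hsum_of_series (hf t ht); apply: asum_nat => n.
apply: le_trans (hN n); apply: ler_sum => j _; apply: wiener_bound (hF j) ht.
exact: ltW.
Qed.

Lemma hsum_reindex (R : realType) (I J : choiceType) (a : I -> R[i])
    (pi : I -> J) (b : J -> R[i]) M s : injective pi ->
  (forall i, b (pi i) = a i) -> (forall j, (forall i, pi i <> j) -> b j = 0) ->
  asum a M -> hsum a s -> asum b M /\ hsum b s.
Proof.
move=> ipi hb hb0 ha hs.
have hf j : hsum (fun i => if pi i == j then a i else 0) (b j).
  have [[i ij]|hn] := pselect (exists i, pi i = j).
    have := @hsum_fin _ _ (fun i => if pi i == j then a i else 0) [fset i]%fset.
    rewrite big_seq_fset1 ij eqxx -ij hb; apply => i'; rewrite inE.
    by move=> /negbTE ne; case: eqP => // /ipi ii; rewrite ii eqxx in ne.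
  have hn' i : pi i <> j by move=> ij; apply: hn; exists i.
  rewrite (hb0 _ hn'); have := @hsum_fin _ _ (fun i => if pi i == j then a i else 0) fset0.
  by rewrite big_seq_fset0; apply => i _; case: eqP => // /hn'.
by split; [exact: asum_group ha hf | exact: hsum_group ha hf hs].
Qed.

Lemma wiener_prod (R : realType) r (t0 : 'rV[R[i]]_r) rho (I : Type) (l : seq I)
    (M : I -> R) (F : I -> 'rV[R[i]]_r -> R[i]) : 0 < rho ->
  (forall i, wiener t0 rho (M i) (F i)) ->
  wiener t0 rho (\prod_(i <- l) M i) (fun t => \prod_(i <- l) F i t).
Proof.
move=> r0 h; elim: l => [|i l IH].
  rewrite big_nil -(normc1 R); apply: wiener_ext (wiener_const _ _ r0) => t _.
  by rewrite big_nil.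
rewrite big_cons; apply: wiener_ext (wiener_mul r0 (h i) IH) => t _.
by rewrite big_cons.
Qed.

Lemma wiener_sum (R : realType) r (t0 : 'rV[R[i]]_r) rho (I : Type) (l : seq I)
    (P : pred I) (M : I -> R) (F : I -> 'rV[R[i]]_r -> R[i]) : 0 < rho ->
  (forall i, P i -> wiener t0 rho (M i) (F i)) ->
  wiener t0 rho (\sum_(i <- l | P i) M i) (fun t => \sum_(i <- l | P i) F i t).
Proof.
move=> r0 h; elim: l => [|i l IH].
  rewrite big_nil -(normc0 R); apply: wiener_ext (wiener_const _ _ r0) => t _.
  by rewrite big_nil.
rewrite big_cons; case: ifP => Pi.
  apply: wiener_ext (wiener_add (h i Pi) IH) => t _.
  by rewrite big_cons Pi.
by apply: wiener_ext IH => t _; rewrite big_cons Pi.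
Qed.

Lemma wiener_exp (R : realType) r (t0 : 'rV[R[i]]_r) rho M f k : 0 < rho ->
  wiener t0 rho M f -> wiener t0 rho (M ^+ k) (fun t => f t ^+ k).
Proof.
move=> r0 h; elim: k => [|k IH].
  by rewrite expr0 -(normc1 R); exact: wiener_const.
by rewrite exprS; apply: wiener_ext (wiener_mul r0 h IH) => t _; rewrite exprS.
Qed.

(** Each factor of a monomial is written $(t^1_j-t^0_j)+(t_j-t^1_j)$, which has norm at most $\rho$
    on the new polydisc; so $c_k(t-t_0)^k$ keeps a norm of at most $|c_k|\rho^{|k|}$. *)
Lemma wiener_recenter (R : realType) r (t0 t1 : 'rV[R[i]]_r) rho rho' M f :
  0 < rho' -> 0 <= rho -> (forall j, normc (t1 0 j - t0 0 j) + rho' <= rho) ->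
  wiener t0 rho M f -> wiener t1 rho' M f.
Proof.
move=> r0 rho0 hj [c [hc hf]].
apply: (wiener_hsum (F := fun k t => c k * mono t0 t k)
   (M := fun k => normc (c k) * \prod_(j < r) rho ^+ k j)) => //.
- move=> k; apply: wiener_scale; apply: wiener_prod => // j; apply: wiener_exp => //.
  apply: (wiener_le (hj j)).
  apply: wiener_ext (wiener_add (wiener_const _ (t1 0 j - t0 0 j) r0) (wiener_coord t1 j r0)) => t _.
  by ring.
- move=> K; apply: le_trans (hc K); apply: ler_sum => k _.
  by rewrite normcM normc_ler0 ?exprn_ge0 // mulrC /mdeg expr_sum.
- move=> t ht; apply: hf => j.
  rewrite (_ : _ - _ = (t1 0 j - t0 0 j) + (t 0 j - t1 0 j)); last by ring.
  by apply: le_trans (normcD _ _) _; apply: le_trans (hj j); rewrite lerD2l.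
Qed.

Lemma pdisc_center (R : realType) r (t0 : 'rV[R[i]]_r) rho : 0 <= rho -> pdisc t0 rho t0.
Proof. by move=> r0 j; rewrite subrr normc0. Qed.

Lemma mono_center (R : realType) r (t0 : 'rV[R[i]]_r) k :
  mono t0 t0 k = if k == [ffun=> 0%N] then 1 else 0.
Proof.
case: eqP => [->|/eqP k0]; first by rewrite /mono big1 // => j _; rewrite ffunE expr0.
have [j kj] : exists j, k j != 0%N.
  apply/existsP; apply: contraNT k0 => /existsPn h; apply/eqP/ffunP => j.
  by rewrite ffunE; have := h j; rewrite negbK => /eqP.
by rewrite /mono (bigD1 j) //= subrr expr0n (negbTE kj) mul0r.
Qed.

Lemma wiener_center_coef (R : realType) r (t0 : 'rV[R[i]]_r) rho f
    (c : {ffun 'I_r -> nat} -> R[i]) : 0 <= rho ->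
  (forall t, pdisc t0 rho t -> hsum (fun k => c k * mono t0 t k) (f t)) ->
  f t0 = c [ffun=> 0%N].
Proof.
move=> r0 hf; apply: hsum_unique (hf _ (pdisc_center _ r0)) _.
have := @hsum_fin _ _ (fun k => c k * mono t0 t0 k) [fset [ffun=> 0%N]]%fset.
rewrite big_seq_fset1 mono_center eqxx mulr1; apply => k; rewrite inE => /negbTE k0.
by rewrite mono_center k0 mulr0.
Qed.

(** Without its constant term a series has only monomials of degree at least 1, for which
    $(\rho'/\rho)^{|k|}\le\rho'/\rho$. Smallness and continuity in t are later drawn from this
    factor. *)
Lemma wiener_schwarz (R : realType) r (t0 : 'rV[R[i]]_r) rho rho' M f :
  0 < rho' -> rho' <= rho -> wiener t0 rho M f ->
  wiener t0 rho' (M * (rho' / rho)) (fun t => f t - f t0).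
Proof.
move=> r0 rr [c [hc hf]]; have rho0 := lt_le_trans r0 rr.
pose k0 : {ffun 'I_r -> nat} := [ffun=> 0%N].
exists (fun k => if k == k0 then 0 else c k); split.
  have := asumZ (rho' / rho)%:C hc; rewrite normc_ler0 ?divr_ge0 ?ltW // [_ * M]mulrC.
  apply: asum_le => k; rewrite !normcM; case: eqP => [->|/eqP kk].
    by rewrite normc0 mulr0 !mulr_ge0 ?normc_ge0.
  have rho'0 := ltW r0; have rho0' := ltW rho0.
  rewrite mulrA ler_wpM2r ?normc_ge0 // !normc_ler0 ?exprn_ge0 ?divr_ge0 //.
  have : (0 < mdeg k)%N.
    rewrite lt0n; apply: contra kk; rewrite sum_nat_eq0 => /forallP h.
    by apply/eqP/ffunP => j; rewrite ffunE; apply/eqP/(implyP (h j)).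
  case: (mdeg k) => // m _; rewrite !exprS.
  rewrite (_ : rho' / rho * (rho * rho ^+ m) = rho' * rho ^+ m).
    by rewrite ler_wpM2l // lerXn2r ?nnegrE.
  by rewrite mulrA divfK ?gt_eqF.
move=> t ht; have h1 := hf t (pdisc_le rr ht).
have h2 := @hsum_fin _ _ (fun k => if k == k0 then c k0 else 0) [fset k0]%fset.
have {}h2 := h2 (fun k => _); rewrite big_seq_fset1 eqxx in h2.
have {}h2 : hsum (fun k => if k == k0 then c k0 else 0) (f t0).
  rewrite (wiener_center_coef (ltW rho0) hf); apply: h2 => k; rewrite inE.
  by case: eqP.
have := hsumD h1 (hsumZ (-1) h2); rewrite mulN1r; apply: hsum_ext => k.
case: eqP => [->|_]; last by rewrite mulr0 addr0.
by rewrite /mono big1 ?mulr1 ?mulN1r ?subrr ?mul0r // => j _; rewrite ffunE expr0.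
Qed.

Lemma geo_half_le2 (R : realType) n : \sum_(i < n) (2^-1 : R) ^+ i <= 2.
Proof.
suff -> : \sum_(i < n) (2^-1 : R) ^+ i = 2 - 2 * 2^-1 ^+ n.
  by rewrite gerDl oppr_le0 mulr_ge0 // exprn_ge0 // invr_ge0.
elim: n => [|n IH]; first by rewrite big_ord0 expr0; lra.
by rewrite big_ord_recr /= IH exprS; field.
Qed.

(** A finite set of exponents lies in a box, over which the sum factors into [r] geometric sums,
    each at most 2. *)
Lemma asum_geo_multi (R : realType) r :
  asum (fun k : {ffun 'I_r -> nat} => (2^-1 ^+ mdeg k : R)%:C) (2 ^+ r).
Proof.
move=> K; pose N := (\max_(k <- K) mdeg k).+1.
have hK k j : k \in K -> (k j < N)%N.
  move=> kK; rewrite ltnS; apply: (@leq_trans (mdeg k)).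
    by rewrite /mdeg (bigD1 j) //= leq_addr.
  by rewrite (big_rem k) //= leq_max leqnn.
pose lft (p : {ffun 'I_r -> 'I_N}) : {ffun 'I_r -> nat} := [ffun j => nat_of_ord (p j)].
have lfti : injective lft.
  move=> p q /ffunP h; apply/ffunP => j; apply: val_inj; have := h j.
  by rewrite !ffunE.
pose w (k : {ffun 'I_r -> nat}) : R := 2^-1 ^+ mdeg k.
have w0 k : 0 <= w k by rewrite exprn_ge0 // invr_ge0.
have sub : (K `<=` [fset k | k in [seq lft p | p <- enum {ffun 'I_r -> 'I_N}]])%fset.
  apply/fsubsetP => k kK; rewrite !inE; apply/mapP.
  exists [ffun j => Ordinal (hK k j kK)]; first by rewrite mem_enum.
  by apply/ffunP => j; rewrite !ffunE.
have := sum_fset_sub w0 sub; rewrite big_fset_seq; last first.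
  by rewrite map_inj_uniq // enum_uniq.
under eq_bigr do rewrite -[w _]normc_ler0 //.
move/le_trans; apply; rewrite big_map big_enum /=.
have -> : \sum_p w (lft p) = \sum_(p : {ffun 'I_r -> 'I_N}) \prod_(j < r) (2^-1 : R) ^+ p j.
  apply: eq_bigr => p _; rewrite /w /mdeg expr_sum; apply: eq_bigr => j _.
  by rewrite ffunE.
rewrite -(bigA_distr_bigA (fun (j : 'I_r) (i : 'I_N) => (2^-1 : R) ^+ i)) /=.
apply: le_trans (_ : \prod_(j < r) 2 <= _); last by rewrite prodr_const card_ord.
by apply: ler_prod => j _; rewrite geo_half_le2 andbT sumr_ge0 // => i _; rewrite exprn_ge0 // invr_ge0.
Qed.

(* The terms of a summable family are bounded, so the series is dominated by a
   geometric one on a smaller polydisc. *)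
Lemma analytic_atP (R : realType) r (f : 'rV[R[i]]_r -> R[i]) t0 :
  analytic_at f t0 <-> exists rho M, 0 < rho /\ wiener t0 rho M f.
Proof.
split=> [[c [_ [/ltc_real_exists[e e0 ->] hf]]]|[rho [M [r0 [c [hc hf]]]]]]; last first.
  exists c, rho%:C; split; first by rewrite ltcR.
  by move=> t ht; apply/hsumP/hf => j; apply/ltW; rewrite -normc_ltC.
have e20 : 0 < e / 2 by rewrite divr_gt0.
have [B B0 hB] : exists2 B, 0 <= B & forall k, normc (c k) * (e / 2) ^+ mdeg k <= B.
  pose t := \row_j (t0 0 j + (e / 2)%:C).
  have /hf/hsumP/hsum_bounded[B B0 hB] : forall j, `|t 0 j - t0 0 j| < e%:C.
    move=> j; rewrite normc_ltC !mxE (_ : _ - _ = (e / 2)%:C); last by ring.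
    by rewrite normc_ler0 ?ltW // ltr_pdivrMr // ltr_pMr // ltr1n.
  exists B => // k; apply: le_trans (hB k); rewrite normcM ler_wpM2l ?normc_ge0 //.
  rewrite normc_prod /mdeg expr_sum; rewrite le_eqVlt; apply/orP; left; apply/eqP; apply: eq_bigr => j _.
  rewrite !mxE normcX (_ : t0 0 j + _ - _ = (e / 2)%:C); last by ring.
  by rewrite normc_ler0 // ltW.
exists (e / 4), (B * 2 ^+ r); split; first by rewrite divr_gt0.
exists c; split.
  have := asumZ B%:C (@asum_geo_multi R r); rewrite normc_ler0 //.
  have e40 : 0 <= e / 4 by rewrite ltW ?divr_gt0.
  apply: asum_le => k; rewrite !normcM !normc_ler0 ?exprn_ge0 ?invr_ge0 //.
  have := hB k; rewrite (_ : e / 4 = (e / 2) * 2^-1); last by field.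
  rewrite [((e / 2) / 2) ^+ _]exprMn => h; rewrite [leLHS]mulrC mulrA.
  by rewrite ler_wpM2r // exprn_ge0 // invr_ge0.
move=> t ht; apply/hsumP/hf => j; rewrite normc_ltC; apply: le_lt_trans (ht j) _.
by rewrite ltr_pdivrMr // ltr_pMr // ltr1n.
Qed.

(** * The maximum principle and Cauchy's estimates *)

(** The regularity that the maximum principle requires: a remainder of order 3 is beaten by a gain
    of order 2. The property passes to difference quotients away from 0 ([taylor2_divdiff]). *)
Definition taylor2 (R : realType) (g : R[i] -> R[i]) (p : R[i]) :=
  exists b1 b2 : R[i], exists C e : R, [/\ 0 < e, 0 <= C & forall x,
    normc x <= e -> normc (g (p + x) - g p - b1 * x - b2 * x ^+ 2) <= C * normc x ^+ 3].

Lemma taylor2_lipschitz (R : realType) (g : R[i] -> R[i]) p : taylor2 g p ->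
  exists C e : R, [/\ 0 < e, 0 <= C & forall x, normc x <= e ->
    normc (g (p + x) - g p) <= C * normc x].
Proof.
move=> [b1 [b2 [C [e [e0 C0 h]]]]].
exists (normc b1 + normc b2 + C), (Num.min e 1); split=> [||x].
- by rewrite lt_min e0 ltr01.
- by rewrite !addr_ge0 ?normc_ge0.
rewrite le_min => /andP[/h hx x1].
rewrite (_ : _ - _ = (g (p + x) - g p - b1 * x - b2 * x ^+ 2) + (b1 * x + b2 * x ^+ 2)); last by ring.
apply: le_trans (normcD _ _) _; apply: le_trans (lerD hx (normcD _ _)) _.
have x0 := normc_ge0 x; have B2 := normc_ge0 b2.
rewrite normcM [normc (b2 * _)]normcM normcX.
have h2 : normc x ^+ 2 <= normc x by rewrite expr2 ler_piMl.
have h3 : normc x ^+ 3 <= normc x.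
  by rewrite exprS (le_trans _ h2) // expr2 ler_wpM2l // ler_piMl.
have := ler_wpM2l C0 h3; have := ler_wpM2l B2 h2; lra.
Qed.

Lemma normc_dist (R : realType) (x y : R[i]) : `|normc x - normc y| <= normc (x - y).
Proof.
have := normcD x (y - x); have := normcD y (x - y); rewrite ![_ + (_ - _)]addrC !subrK.
by rewrite [normc (y - x)]normcB => h1 h2; rewrite ler_norml; apply/andP; split; lra.
Qed.

Lemma for_continuous_normc (R : realType) (f : R[i] -> R) p :
  (forall e : R, 0 < e -> exists2 d, 0 < d &
    forall x, normc (x - p) < d -> `|f x - f p| < e) -> {for p, continuous f}.
Proof.
move=> h A /nbhs_ballP[e e0 hA]; apply/nbhscP; have [d d0 hd] := h e e0.
by exists d => // x /hd hx; apply: hA; rewrite /ball /= distrC.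
Qed.

Lemma continuous_Complex (R : realType) : continuous (fun p : R * R => Complex p.1 p.2).
Proof.
move=> [a b]; apply/cvgcP => e e0.
have e2 : 0 < e / 2 by rewrite divr_gt0.
exists (ball a (e / 2), ball b (e / 2)); first by split; exact: nbhsx_ballx.
move=> [c d] [] /=; rewrite /ball /= => h1 h2.
apply: le_lt_trans (normc_le_ReIm _) _ => /=.
by rewrite [ltRHS](splitr e) ltrD // distrC.
Qed.

(** A closed part of a square in the real plane, carried over by the continuous map [Complex]. *)
Lemma compact_cdisc (R : realType) (rho : R) :
  compact [set z : R[i] | normc z <= rho].
Proof.
pose A := [set p : R * R | normc (Complex p.1 p.2) <= rho].
have cA : compact A.
  apply: (@subclosed_compact _ _ (`[- rho, rho]%classic `*` `[- rho, rho]%classic)).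
  - have cN : continuous (fun p : R * R => normc (Complex p.1 p.2)).
      move=> p P /nbhs_ballP[e e0 hP].
      have /cvgcP/(_ e e0) := @continuous_Complex R p.
      apply: filterS => q hq; apply: hP; rewrite /ball /=; apply: le_lt_trans hq.
      by rewrite distrC normc_dist.
    rewrite (_ : A = (fun p : R * R => normc (Complex p.1 p.2)) @^-1` [set x | x <= rho]) //.
    by apply: closed_comp (@closed_le R rho) => p _; exact: cN.
  - by apply: compact_setX; exact: segment_compact.
  - move=> [a b]; rewrite /A /= => h; split=> /=; rewrite in_itv /= -ler_norml.
      by apply: le_trans h; exact: (normc_Re (Complex a b)).
    by apply: le_trans h; exact: (normc_Im (Complex a b)).
rewrite (_ : [set z | _] = (fun p : R * R => Complex p.1 p.2) @` A).
  apply: continuous_compact cA; apply: continuous_subspaceT.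
  exact: continuous_Complex.
apply/seteqP; split=> [[a b] h|_ [[a b] h <-]] //.
by exists (a, b).
Qed.

Lemma cdisc_EVT (R : realType) (u : R[i] -> R) rho : 0 <= rho ->
  (forall z, normc z <= rho -> {for z, continuous u}) ->
  exists2 z0, normc z0 <= rho & forall z, normc z <= rho -> u z <= u z0.
Proof.
move=> r0 uc; have [|||z0 z0A h] := @compact_EVT_max _ R u [set z : R[i] | normc z <= rho].
- by exists 0; rewrite /= normc0.
- exact: compact_cdisc.
- by apply: continuous_in_subspaceT => z /set_mem; exact: uc.
by exists z0; [exact: set_mem z0A|move=> z zr; apply: h; exact: mem_set].
Qed.

Lemma normc_sqr (R : realType) (z : R[i]) :
  normc z ^+ 2 = complex.Re z ^+ 2 + complex.Im z ^+ 2.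
Proof. by case: z => a b; rewrite sqr_sqrtr // addr_ge0 ?sqr_ge0. Qed.

Lemma normc_i (R : realType) : normc (Complex 0 1 : R[i]) = 1.
Proof. by rewrite /normc expr0n add0r expr1n sqrtr1. Qed.

Lemma for_continuous_lipschitz (R : realType) (f : R[i] -> R) p (D e : R) :
  0 < e -> 0 <= D ->
  (forall x, normc x <= e -> `|f (p + x) - f p| <= D * normc x) ->
  {for p, continuous f}.
Proof.
move=> e0 D0 hf; apply: for_continuous_normc => e1 e10.
have D1 : 0 < D + 1 by rewrite ltr_wpDl.
exists (Num.min e (e1 / (D + 1))); first by rewrite lt_min e0 divr_gt0.
move=> x; rewrite lt_min => /andP[/ltW h1 h2].
have := hf _ h1; rewrite [p + _]addrC subrK => /le_lt_trans; apply.
rewrite ltr_pdivlMr // in h2; apply: le_lt_trans h2.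
by rewrite mulrC ler_wpM2l ?normc_ge0 // lerDl.
Qed.

(* At an interior maximum z0 of |g| + eps |z|^2, averaging over the points
   z0 + tau w with w^4 = 1 kills the terms of orders 1 and 2 of g and increases
   |z|^2 by tau^2. *)
Lemma max_modulus (R : realType) (g : R[i] -> R[i]) (rho m : R) : 0 <= rho ->
  (forall p, normc p <= rho -> taylor2 g p) ->
  (forall z, normc z = rho -> normc (g z) <= m) ->
  forall z, normc z <= rho -> normc (g z) <= m.
Proof.
move=> r0 tg hm z zr; apply/ler_addgt0Pr => d d0.
(* On the disc $\varepsilon|z|^2\le d$; the added 1 allows for [rho = 0]. *)
pose eps := d / (rho ^+ 2 + 1).
have rho20 : 0 <= rho ^+ 2 by rewrite exprn_ge0.
have r1 : 0 < rho ^+ 2 + 1 by rewrite ltr_wpDl.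
have eps0 : 0 < eps by rewrite divr_gt0.
have eps0' := ltW eps0.
pose u z := normc (g z) + eps * normc z ^+ 2.
have uc p : normc p <= rho -> {for p, continuous u}.
  move=> /tg/taylor2_lipschitz[C [e [e0 C0 h]]].
  apply: continuousD.
    apply: (for_continuous_lipschitz (D := C) (e := e)) => // x /h hx.
    by apply: le_trans hx; exact: normc_dist.
  apply: (for_continuous_lipschitz (D := eps * (normc p *+ 2 + 1)) (e := 1)) => //.
    by rewrite mulr_ge0 // addr_ge0 // mulrn_wge0 // normc_ge0.
  move=> x x1; rewrite -mulrBr normrM (gtr0_norm eps0) -[leRHS]mulrA; apply: ler_wpM2l => //.
  rewrite subr_sqr normrM mulrC; apply: ler_pM => //.
    rewrite ger0_norm ?addr_ge0 ?normc_ge0 //; have := normcD p x; lra.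
  by apply: le_trans (normc_dist _ _) _; rewrite addrC addKr.
have [z0 z0r hz0] := cdisc_EVT r0 uc.
have [z0e|z0ne] := eqVneq (normc z0) rho.
  apply: (@le_trans _ _ (u z)); first by rewrite /u lerDl mulr_ge0 ?exprn_ge0 ?normc_ge0.
  apply: le_trans (hz0 z zr) _; rewrite /u z0e lerD ?hm //.
  by rewrite /eps mulrAC ler_pdivrMr // ler_wpM2l ?lerDl // ltW.
have z0lt : normc z0 < rho by rewrite lt_def eq_sym z0ne.
exfalso.
have [b1 [b2 [C [e [e0 C0 h]]]]] := tg z0 z0r.
have C1 : 0 < C + 1 by rewrite ltr_wpDl.
(* A step [tau < mu] keeps the expansion valid, keeps the four points in the disc and gives
   $(C+1)\tau<\varepsilon$, so that the remainder $C\tau^3$ cannot outweigh the gain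
   $\varepsilon\tau^2$. *)
pose mu := Num.min e (Num.min (rho - normc z0) (eps / (C + 1))).
have mu0 : 0 < mu by rewrite !lt_min e0 subr_gt0 z0lt divr_gt0.
pose tau := mu / 2.
have t0 : 0 < tau by rewrite divr_gt0.
have : tau < mu by rewrite ltr_pdivrMr // ltr_pMr // ltr1n.
rewrite {1}/mu !lt_min => /andP[te /andP[tr tep]].
have hw w : normc w = 1 ->
    normc (g (z0 + tau%:C * w) - g z0 - b1 * (tau%:C * w) - b2 * (tau%:C * w) ^+ 2) <= C * tau ^+ 3 /\
    u (z0 + tau%:C * w) <= u z0.
  move=> w1; have nt : normc (tau%:C * w) = tau by rewrite normcM w1 mulr1 normc_ler0 // ltW.
  split; first by have := h (tau%:C * w); rewrite nt; apply; exact: ltW.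
  apply: hz0; apply: le_trans (normcD _ _) _; rewrite nt; lra.
pose ci : R[i] := Complex 0 1.
have [h1 u1] := hw 1 (normc1 R).
have [h2 u2] := hw (-1) (etrans (normcN _) (normc1 R)).
have [h3 u3] := hw ci (normc_i R).
have [h4 u4] := hw (- ci) (etrans (normcN _) (normc_i R)).
have i2 : ci * ci = -1 :> R[i] by rewrite -expr2; exact: sqr_i.
have key : 4 * normc (g z0) <= normc (g (z0 + tau%:C * 1)) + normc (g (z0 + tau%:C * -1))
   + normc (g (z0 + tau%:C * ci)) + normc (g (z0 + tau%:C * - ci)) + 4 * (C * tau ^+ 3).
  have -> : 4 * normc (g z0) = normc (4 * g z0) by rewrite normcM normc_nat.
  set e1 := (X in normc X <= _) in h1; set e2 := (X in normc X <= _) in h2.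
  set e3 := (X in normc X <= _) in h3; set e4 := (X in normc X <= _) in h4.
  have -> : 4 * g z0 = g (z0 + tau%:C * 1) + g (z0 + tau%:C * -1) + g (z0 + tau%:C * ci)
     + g (z0 + tau%:C * - ci) + - e1 + - e2 + - e3 + - e4.
    rewrite /e1 /e2 /e3 /e4 !exprMn !expr2 !mulrNN !i2; ring.
  move: (g (z0 + tau%:C * 1)) (g (z0 + tau%:C * -1)) (g (z0 + tau%:C * ci))
    (g (z0 + tau%:C * - ci)) e1 e2 e3 e4 h1 h2 h3 h4 => G1 G2 G3 G4 e1 e2 e3 e4 h1 h2 h3 h4.
  have := normcD (G1 + G2 + G3 + G4 + - e1 + - e2 + - e3) (- e4).
  have := normcD (G1 + G2 + G3 + G4 + - e1 + - e2) (- e3).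
  have := normcD (G1 + G2 + G3 + G4 + - e1) (- e2).
  have := normcD (G1 + G2 + G3 + G4) (- e1).
  have := normcD (G1 + G2 + G3) G4; have := normcD (G1 + G2) G3; have := normcD G1 G2.
  rewrite !normcN; lra.
have S : normc (z0 + tau%:C * 1) ^+ 2 + normc (z0 + tau%:C * -1) ^+ 2
   + normc (z0 + tau%:C * ci) ^+ 2 + normc (z0 + tau%:C * - ci) ^+ 2
   = 4 * normc z0 ^+ 2 + 4 * tau ^+ 2.
  by rewrite !normc_sqr; case: (z0) => a b /=; ring.
have : 4 * (eps * tau ^+ 2) <= 4 * (C * tau ^+ 3).
  move: u1 u2 u3 u4 key S; rewrite /u; clear.
  set N1 := normc (_ + _ * 1); set N2 := normc (_ + _ * -1).
  set N3 := normc (_ + _ * ci); set N4 := normc (_ + _ * - ci).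
  move=> u1 u2 u3 u4 key S.
  have : eps * (N1 ^+ 2 + N2 ^+ 2 + N3 ^+ 2 + N4 ^+ 2) = eps * (4 * normc z0 ^+ 2 + 4 * tau ^+ 2).
    by rewrite S.
  lra.
rewrite ler_pM2l // (_ : C * tau ^+ 3 = (C * tau) * tau ^+ 2); last by ring.
rewrite ler_pM2r ?exprn_gt0 //.
rewrite leNgt => /negP; apply; rewrite ltr_pdivlMr // in tep.
by apply: le_lt_trans tep; rewrite mulrC ler_wpM2l ?lerDl // ltW.
Qed.

(** * Power series in one variable and their difference quotients *)

Definition wiener1 (R : realType) (rho M : R) (a : nat -> R[i]) (g : R[i] -> R[i]) :=
  asum (fun d => (rho ^+ d)%:C * a d) M /\
  forall x, normc x <= rho -> hsum (fun d => a d * x ^+ d) (g x).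

Lemma wiener1_asum (R : realType) (rho M : R) a x : 0 <= rho ->
  asum (fun d => (rho ^+ d)%:C * a d) M -> normc x <= rho ->
  asum (fun d => a d * x ^+ d) M.
Proof.
move=> r0 h xr; apply: asum_le h => d; rewrite !normcM normcX mulrC.
by rewrite normc_ler0 ?exprn_ge0 // ler_wpM2r ?normc_ge0 // lerXn2r ?nnegrE ?normc_ge0.
Qed.

Lemma wiener1_0 (R : realType) (rho M : R) a g : 0 <= rho -> wiener1 rho M a g ->
  g 0 = a 0%N.
Proof.
move=> r0 [_ /(_ 0)]; rewrite normc0 => /(_ r0) h; apply: hsum_unique h _.
have := @hsum_fin _ _ (fun d => a d * 0 ^+ d) [fset 0%N]%fset.
rewrite big_seq_fset1 expr0 mulr1; move=> hh; apply: hh => -[|d] //; by rewrite ?inE // exprS mul0r mulr0.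
Qed.

(** The difference quotient at 0 with its singularity removed; [a1] stands for the derivative at
    0. *)
Definition divdiff (R : realType) (a1 : R[i]) (g : R[i] -> R[i]) x :=
  if x == 0 then a1 else (g x - g 0) / x.

Lemma hsum_shift (R : realType) (b : nat -> R[i]) M s : asum b M -> hsum b s ->
  hsum (fun d => b d.+1) (s - b 0%N).
Proof.
move=> hb hs.
have hbS : asum (fun d => b d.+1) M.
  move=> K; rewrite -(big_map succn xpredT (fun i => normc (b i))).
  rewrite -big_fset_seq ?map_inj_uniq ?fset_uniq //; last exact: succn_inj.
have [s' hs'] := asum_hsum hbS.
have [] := @hsum_reindex _ _ _ _ succn (fun d => if d is 0 then 0 else b d) _ _ succn_inj _ _ hbS hs' => //.
  by move=> [|j] // /(_ j).
move=> _ h1.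
have h2 : hsum (fun d => if d == 0%N then b 0%N else 0) (b 0%N).
  have := @hsum_fin _ _ (fun d => if d == 0%N then b 0%N else 0) [fset 0%N]%fset.
  by rewrite big_seq_fset1 /=; apply=> -[|d]; rewrite ?inE.
suff -> : s - b 0%N = s' by [].
apply/eqP; rewrite subr_eq; apply/eqP; apply: hsum_unique hs _.
by apply: hsum_ext (hsumD h1 h2) => -[|d] /=; rewrite ?add0r ?addr0.
Qed.

Lemma wiener1_divdiff (R : realType) (rho M : R) a g : 0 < rho -> wiener1 rho M a g ->
  wiener1 rho (M / rho) (fun d => a d.+1) (divdiff (a 1%N) g).
Proof.
move=> r0 hw; have [ha hg] := hw; have g0 := wiener1_0 (ltW r0) hw.
have hr : rho%:C != 0 :> R[i] by rewrite -normc_eq0 normc_ler0 ?gt_eqF // ltW.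
split.
  have [s hs] := asum_hsum ha.
  have ha' : asum (fun d => (rho ^+ d.+1)%:C * a d.+1) M.
    move=> K; rewrite -(big_map succn xpredT (fun i => normc ((rho ^+ i)%:C * a i))).
    by rewrite -big_fset_seq ?map_inj_uniq ?fset_uniq //; exact: succn_inj.
  have := asumZ rho%:C^-1 ha'; rewrite normcV normc_ler0 ?(ltW r0) // mulrC.
  by apply: asum_ext => d; rewrite exprS rmorphM mulrA mulKf.
move=> x xr; rewrite /divdiff; case: eqVneq => [->|x0].
  have := @hsum_fin _ _ (fun d => a d.+1 * 0 ^+ d) [fset 0%N]%fset.
  by rewrite big_seq_fset1 expr0 mulr1; apply=> -[|d]; rewrite ?inE // exprS mul0r mulr0.
have := hsumZ x^-1 (hsum_shift (wiener1_asum (ltW r0) ha xr) (hg x xr)).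
rewrite expr0 mulr1 -g0 mulrC; apply: hsum_ext => d.
by rewrite exprS mulrCA mulKf.
Qed.

(** Induction on [D]: subtracting $g(0)$ and dividing by $x$ shifts the coefficients and turns the
    norm [M] into [M / rho]. *)
Lemma wiener1_tail (R : realType) (rho M : R) a g D x : 0 < rho ->
  wiener1 rho M a g -> normc x <= rho ->
  normc (g x - \sum_(d < D) a d * x ^+ d) <= M * (normc x / rho) ^+ D.
Proof.
move=> r0; elim: D M a g => [|D IH] M a g hw xr.
  rewrite big_ord0 subr0 expr0 mulr1; have [ha hg] := hw.
  exact: hsum_norm (wiener1_asum (ltW r0) ha xr) (hg x xr).
have := IH _ _ _ (wiener1_divdiff r0 hw) xr; rewrite /divdiff.
have g0 := wiener1_0 (ltW r0) hw.
case: eqVneq => [->|x0] h.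
  rewrite normc0 mul0r exprS mul0r mulr0 big_ord_recl /= big1 ?addr0 ?mulr1.
    by rewrite -g0 subrr normc0.
  by move=> i _; rewrite exprS mul0r mulr0.
have -> : g x - \sum_(d < D.+1) a d * x ^+ d =
   x * ((g x - g 0) / x - \sum_(d < D) a d.+1 * x ^+ d).
  rewrite big_ord_recl /= mulr1 mulrBr mulrCA divff // mulr1 g0 mulr_sumr.
  rewrite opprD addrA; congr (_ - _); apply: eq_bigr => i _.
  by rewrite mulrCA -exprS.
rewrite normcM (_ : M * _ = normc x * (M / rho * (normc x / rho) ^+ D)).
  by apply: ler_wpM2l => //; exact: normc_ge0.
by rewrite exprS; ring.
Qed.

Lemma wiener1_taylor2 (R : realType) (rho M : R) a g : 0 < rho ->
  wiener1 rho M a g -> taylor2 g 0.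
Proof.
move=> r0 hw; exists (a 1%N), (a 2%N), (M / rho ^+ 3), rho; split=> //.
  by rewrite divr_ge0 ?exprn_ge0 ?(ltW r0) //; case: hw => /asum_ge0.
move=> x xr; have := wiener1_tail 3 r0 hw xr; rewrite add0r.
rewrite !big_ord_recl big_ord0 /= -(wiener1_0 (ltW r0) hw) mulr1 expr1 addr0.
rewrite expr_div_n !opprD !addrA => h; apply: le_trans h _.
by rewrite mulrA mulrAC.
Qed.

(** [h0], [h1], [h2] come from the long division by $p+x$ of the expansion of $g-g(0)$ at $p$; what
    is left is of order $x^3$, and $|p+x|\ge|p|/2$. *)
Lemma taylor2_divdiff (R : realType) a1 (g : R[i] -> R[i]) p : p != 0 ->
  taylor2 g p -> taylor2 (divdiff a1 g) p.
Proof.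
move=> p0 [b1 [b2 [C [e [e0 C0 h]]]]].
pose h0 := (g p - g 0) / p; pose h1 := (b1 - h0) / p; pose h2 := (b2 - h1) / p.
have np : 0 < normc p by rewrite normc_gt0.
exists h1, h2, (2 * (C + normc h2) / normc p), (Num.min e (normc p / 2)); split.
- by rewrite lt_min e0 divr_gt0.
- by rewrite divr_ge0 ?(ltW np) // mulr_ge0 // addr_ge0 // normc_ge0.
move=> x; rewrite le_min => /andP[xe xp].
have hpx : normc p / 2 <= normc (p + x).
  have := normcD (p + x) (- x); rewrite addrK normcN; lra.
have px0 : p + x != 0 by rewrite -normc_gt0; apply: lt_le_trans hpx; rewrite divr_gt0.
rewrite /divdiff (negbTE p0) (negbTE px0) -/h0.
have key : (p + x) * ((g (p + x) - g 0) / (p + x) - h0 - h1 * x - h2 * x ^+ 2) =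
   (g (p + x) - g p - b1 * x - b2 * x ^+ 2) - h2 * x ^+ 3.
  by rewrite /h2 /h1 /h0; field; rewrite px0 p0.
have : normc ((g (p + x) - g p - b1 * x - b2 * x ^+ 2) - h2 * x ^+ 3) <=
    (C + normc h2) * normc x ^+ 3.
  apply: le_trans (normcD _ _) _; rewrite normcN [normc (h2 * _)]normcM normcX mulrDl.
  by rewrite lerD2r h.
rewrite -key normcM => hh.
have : normc p / 2 * normc ((g (p + x) - g 0) / (p + x) - h0 - h1 * x - h2 * x ^+ 2) <=
   (C + normc h2) * normc x ^+ 3.
  by apply: le_trans hh; rewrite ler_wpM2r ?normc_ge0.
set Z := normc (_ - _ - _ - _).
move=> hz; rewrite (_ : 2 * (C + normc h2) / normc p * normc x ^+ 3 =
  ((C + normc h2) * normc x ^+ 3) * 2 / normc p); last by ring.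
by rewrite ler_pdivlMr //; lra.
Qed.

(* Cauchy estimates, with 2/rho for 1/rho, by iterating the maximum principle on
   the difference quotients (g z - g 0) / z. *)
Lemma cauchy1 (R : realType) (g : R[i] -> R[i]) (rho M s M' : R) a D :
  0 < rho -> 0 < s ->
  (forall p, normc p <= rho -> taylor2 g p) ->
  (forall p, normc p <= rho -> normc (g p) <= M) -> wiener1 s M' a g ->
  normc (a D) <= M * (2 / rho) ^+ D /\
  forall x, normc x <= rho ->
    normc (g x - \sum_(d < D) a d * x ^+ d) <= M * (2 / rho * normc x) ^+ D.
Proof.
move=> r0 s0; elim: D g M M' a => [|D IH] g M M' a tg hM hw.
  have g0 := wiener1_0 (ltW s0) hw.
  rewrite expr0 mulr1 -g0; split; first by apply: hM; rewrite normc0 ltW.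
  by move=> x xr; rewrite big_ord0 subr0 hM.
have g0 := wiener1_0 (ltW s0) hw.
have hw' := wiener1_divdiff s0 hw.
(* At 0 the quotient has an expansion by its power series, elsewhere by that of [g]. *)
have tg' p : normc p <= rho -> taylor2 (divdiff (a 1%N) g) p.
  move=> /tg tp; have [->|p0] := eqVneq p 0; first exact: wiener1_taylor2 hw'.
  exact: taylor2_divdiff.
have hM' p : normc p <= rho -> normc (divdiff (a 1%N) g p) <= M * (2 / rho).
  apply: max_modulus => //; first exact: ltW.
  move=> z zr; rewrite /divdiff ifN; last by rewrite -normc_gt0 zr.
  rewrite normcM normcV zr mulrA; apply: ler_wpM2r; first by rewrite invr_ge0 ltW.
  apply: le_trans (normcD _ _) _; rewrite normcN mulr_natr mulr2n lerD // hM ?zr //.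
  by rewrite normc0 ltW.
have [h1 h2] := IH _ _ _ _ tg' hM' hw'; split.
  by rewrite exprS mulrA.
move=> x xr; have := h2 x xr; rewrite /divdiff.
case: eqVneq => [->|x0] h.
  rewrite normc0 mulr0 [X in _ <= M * X]exprS mul0r mulr0 big_ord_recl /= big1 ?addr0 ?mulr1.
    by rewrite -g0 subrr normc0.
  by move=> i _; rewrite exprS mul0r mulr0.
have -> : g x - \sum_(d < D.+1) a d * x ^+ d =
   x * ((g x - g 0) / x - \sum_(d < D) a d.+1 * x ^+ d).
  rewrite big_ord_recl /= mulr1 mulrBr mulrCA divff // mulr1 g0 mulr_sumr.
  rewrite opprD addrA; congr (_ - _); apply: eq_bigr => i _.
  by rewrite mulrCA -exprS.
rewrite normcM exprS mulrA [M * (_ * _)]mulrA mulrAC.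
rewrite [X in _ <= X]mulrC; apply: ler_wpM2l; first exact: normc_ge0.
exact: h.
Qed.

(** * Roots of unity and the extraction of coefficients *)

Lemma prim_root_exists (R : realType) n : (0 < n)%N ->
  exists z : R[i], n.-primitive_root z.
Proof.
pose p : {poly R[i]} := 'X^n - 1; have [r Dp] := closed_field_poly_normal p.
move=> n_gt0; rewrite (monicP _) ?monicXnsubC // scale1r in Dp.
have rn1: all n.-unity_root r by apply/allP=> z; rewrite -root_prod_XsubC -Dp.
have sz_r: (n < (size r).+1)%N.
  by rewrite -(size_prod_XsubC r id) -Dp size_XnsubC.
have [|z] := hasP (has_prim_root n_gt0 rn1 _ sz_r); last by exists z.
by rewrite -separable_prod_XsubC -Dp separable_Xn_sub_1 // pnatr_eq0 -lt0n.
Qed.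

Lemma normc_prim_root (R : realType) n (z : R[i]) : (0 < n)%N ->
  n.-primitive_root z -> normc z = 1.
Proof.
move=> n0 /prim_expr_order/(congr1 (@normc R)); rewrite normcX normc1 => h.
by apply/eqP; rewrite -(pexpr_eq1 n0 (normc_ge0 z)) h.
Qed.

(** Orthogonality of characters of Z/n: for distinct exponents the summands are powers of
    $q=w^{k}/w^{k_0}\ne1$, and $(q-1)\sum_l q^l=q^n-1=0$. *)
Lemma sum_prim_root (R : realType) n (w : R[i]) (k k0 : nat) :
  n.-primitive_root w -> (k < n)%N -> (k0 < n)%N ->
  \sum_(l < n) w ^+ (l * k) * w ^- (l * k0) = if k == k0 then n%:R else 0.
Proof.
move=> pw kn k0n.
have w0 : w != 0.
  by rewrite -normc_gt0 (normc_prim_root _ pw) // (leq_ltn_trans _ kn).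
case: eqP => [->|/eqP kk].
  under eq_bigr do rewrite divff ?expf_neq0 //.
  by rewrite sumr_const card_ord.
pose q := w ^+ k / w ^+ k0.
have -> : \sum_(l < n) w ^+ (l * k) * w ^- (l * k0) = \sum_(l < n) q ^+ l.
  apply: eq_bigr => l _; rewrite /q expr_div_n -!exprM mulnC.
  by rewrite [(k0 * l)%N]mulnC.
have q1 : q != 1.
  rewrite -subr_eq0 /q; apply: contra kk; rewrite subr_eq0 => /eqP h.
  have := congr1 (fun x => x * w ^+ k0) h; rewrite divfK ?expf_neq0 // mul1r => /eqP.
  by rewrite (eq_prim_root_expr pw) !modn_small.
have : (q - 1) * \sum_(l < n) q ^+ l = 0.
  rewrite -subrX1 /q expr_div_n -!exprM ![(_ * n)%N]mulnC !exprM.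
  by rewrite (prim_expr_order pw) !expr1n divr1 subrr.
by move/eqP; rewrite mulf_eq0 subr_eq0 (negbTE q1) => /eqP.
Qed.

Lemma hsum_big (R : realType) (I : choiceType) (L : Type) (l : seq L)
    (a : L -> I -> R[i]) (s : L -> R[i]) : (forall x, hsum (a x) (s x)) ->
  hsum (fun i => \sum_(x <- l) a x i) (\sum_(x <- l) s x).
Proof.
move=> h; elim: l => [|x l IH].
  rewrite big_nil; have := @hsum_fin _ _ (fun i => \sum_(x <- [::]) a x i) fset0.
  by rewrite big_seq_fset0; apply => i _; rewrite big_nil.
rewrite big_cons; apply: hsum_ext (hsumD (h x) IH) => i.
by rewrite big_cons.
Qed.

Lemma geo_half_lt (R : realType) (M e : R) : 0 < e ->
  exists N, forall D, (N <= D)%N -> M * 2^-1 ^+ D < e.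
Proof.
move=> e0; exists (Num.bound (M / e)) => D ND.
rewrite exprVn ltr_pdivrMr ?exprn_gt0 // mulrC -ltr_pdivrMr //.
have [M0|M0] := leP (M / e) 0; first by apply: le_lt_trans M0 _; rewrite exprn_gt0.
apply: lt_trans (archi_boundP (ltW M0)) _.
by rewrite -natrX ltr_nat; apply: leq_ltn_trans ND _; exact: ltn_expl.
Qed.

(* Averaging p over r-tuples of n-th roots of unity against a character of
   (Z/n)^r isolates one coefficient as soon as n > d. *)
Lemma coef_bound_torus (R : realType) r (c : {ffun 'I_r -> nat} -> R[i]) (d : nat) M
    (p : 'rV[R[i]]_r -> R[i]) : 0 <= M ->
  (forall v : 'rV[R[i]]_r, (forall j, normc (v 0 j) <= 1) ->
    hsum (fun k => if mdeg k == d then c k * \prod_j v 0 j ^+ k j else 0) (p v) /\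
    normc (p v) <= M) ->
  forall k, mdeg k = d -> normc (c k) <= M.
Proof.
move=> M0 hp k0 k0d; have [w pw] := prim_root_exists R (ltn0Sn d).
have w1 := normc_prim_root (ltn0Sn d) pw.
have lek k : mdeg k = d -> forall j, (k j < d.+1)%N.
  by move=> <- j; rewrite ltnS /mdeg (bigD1 j) //= leq_addr.
pose N := d.+1; pose T := {ffun 'I_r -> 'I_N}.
pose v (l : T) : 'rV[R[i]]_r := \row_j w ^+ l j.
pose ch (l : T) := \prod_j w ^- (l j * k0 j).
have v1 l j : normc (v l 0 j) <= 1 by rewrite mxE normcX w1 expr1n.
have ch1 l : normc (ch l) = 1.
  by rewrite normc_prod big1 // => j _; rewrite normcV normcX w1 expr1n invr1.
have h1 := hsum_big (enum T) (fun l => hsumZ (ch l) (hp _ (v1 l)).1).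
have key : \sum_(l <- enum T) ch l * p (v l) = (N ^ r)%:R * c k0.
  apply: hsum_unique h1 _.
  have := @hsum_fin _ _ (fun k => if k == k0 then (N ^ r)%:R * c k0 else 0) [fset k0]%fset.
  rewrite big_seq_fset1 eqxx => hh.
  have {}hh := hh (fun k => _); apply: hsum_ext (hh _) => [k|k]; last first.
    by rewrite inE => /negbTE ->.
  case: (eqVneq (mdeg k) d) => [kd|kd]; last first.
    rewrite big1 => [|l _]; last by rewrite mulr0.
    by case: (eqVneq k k0) kd => // ->; rewrite k0d eqxx.
  have -> : \sum_(l <- enum T) ch l * (c k * \prod_j v l 0 j ^+ k j) =
     c k * \sum_(l : T) \prod_j (w ^+ (l j * k j) * w ^- (l j * k0 j)).
    rewrite mulr_sumr big_enum /=; apply: eq_bigr => l _.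
    rewrite mulrCA; congr (_ * _); rewrite /ch -big_split /=; apply: eq_bigr => j _.
    by rewrite mxE -exprM mulrC.
  rewrite -(bigA_distr_bigA (fun j (l : 'I_N) => w ^+ (l * k j) * w ^- (l * k0 j))) /=.
  have -> : \prod_j \sum_(l < N) w ^+ (l * k j) * w ^- (l * k0 j) =
     \prod_j (if k j == k0 j then N%:R else 0).
    by apply: eq_bigr => j _; rewrite (sum_prim_root pw) ?lek.
  case: eqP => [->|/eqP kk].
    rewrite (eq_bigr (fun=> N%:R)) => [|j _]; last by rewrite eqxx.
    by rewrite prodr_const card_ord mulrC natrX.
  have [j kj] : exists j, k j != k0 j.
    apply/existsP; apply: contraNT kk => /existsPn h; apply/eqP/ffunP => j.
    by have := h j; rewrite negbK => /eqP.
  by rewrite (bigD1 j) //= (negbTE kj) mul0r mulr0.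
have NN : 0 < (N ^ r)%:R :> R by rewrite ltr0n expn_gt0.
rewrite -(ler_pM2l NN) -[X in X * normc _]normc_nat -normcM -key.
apply: le_trans (normc_sum _ _ _) _.
apply: le_trans (_ : \sum_(l <- enum T) M <= _).
  by apply: ler_sum => l _; rewrite normcM ch1 mul1r; have [] := hp _ (v1 l).
by rewrite big_enum /= sumr_const card_ffun !card_ord mulr_natl.
Qed.

(** [p d] is the homogeneous part of degree [d]. On a complex line through [t0] these parts are the
    coefficients of a one-variable series, with the same norm bound for all directions [v]. *)
Lemma wiener_graded (R : realType) r (t0 : 'rV[R[i]]_r) rho c M f : 0 < rho ->
  asum (fun k => (rho ^+ mdeg k)%:C * c k) M ->
  (forall t, pdisc t0 rho t -> hsum (fun k => c k * mono t0 t k) (f t)) ->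
  exists p : nat -> 'rV[R[i]]_r -> R[i],
   forall v : 'rV[R[i]]_r, (forall j, normc (v 0 j) <= 1) ->
   (forall d, hsum (fun k => if mdeg k == d then c k * \prod_j v 0 j ^+ k j else 0) (p d v)) /\
   wiener1 rho M (fun d => p d v) (fun x => f (t0 + x *: v)).
Proof.
move=> r0 hc hf.
have hr d : (rho ^+ d)%:C != 0 :> R[i].
  by rewrite -normc_eq0 normc_ler0 ?exprn_ge0 ?expf_neq0 ?gt_eqF // ltW.
have hcv (v : 'rV[R[i]]_r) : (forall j, normc (v 0 j) <= 1) ->
    asum (fun k => (rho ^+ mdeg k)%:C * (c k * \prod_j v 0 j ^+ k j)) M.
  move=> v1; apply: asum_le hc => k; rewrite mulrA normcM ler_piMr ?normc_ge0 //.
  rewrite normc_prod; apply: (@le_trans _ _ (\prod_(j < r) 1)); last by rewrite big1.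
  apply: ler_prod => j _.
  by rewrite normc_ge0 normcX exprn_ile1 ?normc_ge0.
have /choice[q hq] (dv : nat * 'rV[R[i]]_r) : exists y, (forall j, normc (dv.2 0 j) <= 1) ->
    hsum (fun k => if mdeg k == dv.1 then c k * \prod_j dv.2 0 j ^+ k j else 0) y.
  have [v1|nv1] := pselect (forall j, normc (dv.2 0 j) <= 1); last by exists 0.
  have [y hy] := asum_hsum (asum_restrict (fun k => mdeg k == dv.1) (hcv _ v1)).
  exists ((rho ^+ dv.1)%:C^-1 * y) => _; apply: hsum_ext (hsumZ _ hy) => k.
  by case: eqP => [->|]; rewrite ?mulr0 // mulKf.
exists (fun d v => q (d, v)) => v v1; have hqv d := hq (d, v) v1.
split=> //; split.
  apply: (asum_group (pi := @mdeg r) (hcv v v1)) => d.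
  apply: hsum_ext (hsumZ (rho ^+ d)%:C (hqv d)) => k /=.
  by case: eqP => [->|]; rewrite ?mulr0.
move=> x xr; have tx : pdisc t0 rho (t0 + x *: v).
  move=> j; rewrite !mxE [t0 0 j + _]addrC addrK normcM; apply: le_trans xr.
  by rewrite ler_piMr ?normc_ge0.
apply: (hsum_group (pi := @mdeg r) (wiener_asum (ltW r0) hc tx) _ (hf _ tx)) => d.
have := hsumZ (x ^+ d) (hqv d); rewrite [q _ * _]mulrC; apply: hsum_ext => k /=.
case: eqP => [<-|]; rewrite ?mulr0 //.
rewrite mulrCA; congr (_ * _); rewrite /mono /mdeg expr_sum -big_split /=.
by apply: eq_bigr => j _; rewrite !mxE [t0 0 j + _]addrC addrK exprMn.
Qed.

Lemma pdisc_line (R : realType) r (t0 v : 'rV[R[i]]_r) rho x : normc x <= rho ->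
  (forall j, normc (v 0 j) <= 1) -> pdisc t0 rho (t0 + x *: v).
Proof.
move=> xr v1 j; rewrite !mxE [t0 0 j + _]addrC addrK normcM; apply: le_trans xr.
by rewrite ler_piMr ?normc_ge0.
Qed.

(** The passage from sup bounds to Wiener norms. On lines through [t0], the estimates in one
    variable bound the homogeneous part of degree $d$ by $M(2/\rho)^d$, hence each of its
    coefficients as well; at radius $\rho/4$ the series is dominated by $M\sum_k2^{-|k|}$, whence
    the factor $2^r$. *)
Theorem analytic_bounded_wiener (R : realType) r (t0 : 'rV[R[i]]_r) rho M f :
  0 < rho ->
  (forall t, pdisc t0 rho t -> analytic_at f t /\ normc (f t) <= M) ->
  wiener t0 (rho / 4) (M * 2 ^+ r) f.
Proof.
move=> r0 hf.
have M0 : 0 <= M.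
  by have [_ h] := hf t0 (pdisc_center _ (ltW r0)); apply: le_trans (normc_ge0 _) h.
have [/analytic_atP[s [M' [s0 [c [hc hcf]]]]] _] := hf t0 (pdisc_center _ (ltW r0)).
have [p hp] := wiener_graded s0 hc hcf.
have tay (v : 'rV[R[i]]_r) q : (forall j, normc (v 0 j) <= 1) -> normc q <= rho ->
    taylor2 (fun x => f (t0 + x *: v)) q.
  move=> v1 qr; have [/analytic_atP[s1 [M1 [s10 [c1 [hc1 hcf1]]]]] _] := hf _ (pdisc_line t0 qr v1).
  have [p1 /(_ v v1)[_ /(wiener1_taylor2 s10)]] := wiener_graded s10 hc1 hcf1.
  move=> [b1 [b2 [C [e [e0 C0 h]]]]]; exists b1, b2, C, e; split=> // x /h.
  by rewrite add0r scale0r addr0 scalerDl addrA.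
have cau (v : 'rV[R[i]]_r) : (forall j, normc (v 0 j) <= 1) -> forall D, normc (p D v) <= M * (2 / rho) ^+ D /\
    forall x, normc x <= rho -> normc (f (t0 + x *: v) - \sum_(d < D) p d v * x ^+ d) <=
       M * (2 / rho * normc x) ^+ D.
  move=> v1 D; have [_ hw] := hp v v1.
  apply: (cauchy1 (a := fun d => p d v) D r0 s0 _ _ hw).
    by move=> q qr; exact: tay.
  by move=> q qr; have [_] := hf _ (pdisc_line t0 qr v1).
have ck k : normc (c k) <= M * (2 / rho) ^+ mdeg k.
  apply: (@coef_bound_torus _ _ c (mdeg k) _ (p (mdeg k))) => //.
    by rewrite mulr_ge0 // exprn_ge0 // divr_ge0 // ltW.
  by move=> v v1; split; [have [] := hp v v1 | have [] := cau v v1 (mdeg k)].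
have r4 : 0 < rho / 4 by rewrite divr_gt0.
have hc4 : asum (fun k => ((rho / 4) ^+ mdeg k)%:C * c k) (M * 2 ^+ r).
  have := asumZ M%:C (@asum_geo_multi R r); rewrite normc_ler0 //.
  apply: asum_le => k; rewrite !normcM !normc_ler0 ?exprn_ge0 ?invr_ge0 ?(ltW r4) //.
  apply: le_trans (ler_wpM2l _ (ck k)) _; first by rewrite exprn_ge0 // ltW.
  rewrite mulrCA -exprMn (_ : rho / 4 * (2 / rho) = 2^-1) //.
  by field; rewrite gt_eqF.
exists c; split=> // t ht.
(* So far the series at [t0] represents [f] only near [t0]. On the line through [t] its partial sums
   are within $M2^{-D}$ of $f(t)$, so it represents [f] on the whole smaller polydisc. *)
pose v : 'rV[R[i]]_r := (rho / 4)%:C^-1 *: (t - t0).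
have r4' : (rho / 4)%:C != 0 :> R[i] by rewrite -normc_eq0 normc_ler0 ?gt_eqF // ltW.
have v1 j : normc (v 0 j) <= 1.
  rewrite !mxE normcM normcV normc_ler0 ?(ltW r4) // mulrC ler_pdivrMr // mul1r.
  exact: ht.
have tE : t = t0 + (rho / 4)%:C *: v.
  by rewrite scalerA divff // scale1r addrC subrK.
clearbody v.
have [s1 hs1] := asum_hsum (wiener_asum (ltW r4) hc4 ht).
suff -> : f t = s1 by [].
have [hpd _] := hp v v1.
have : hsum (fun d => p d v * (rho / 4)%:C ^+ d) s1.
  apply: (hsum_group (pi := @mdeg r) (wiener_asum (ltW r4) hc4 ht) _ hs1) => d.
  have := hsumZ ((rho / 4)%:C ^+ d) (hpd d); rewrite [p d v * _]mulrC; apply: hsum_ext => k /=.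
  case: eqP => [<-|]; rewrite ?mulr0 //.
  rewrite mulrCA; congr (_ * _); rewrite {1}tE /mono /mdeg expr_sum -big_split /=.
  by apply: eq_bigr => j _; rewrite !mxE [t0 0 j + _]addrC addrK exprMn.
move/hsum_series; apply: cvg_unique => //; apply/cvgn_normcP => e e0.
have [N hN] := geo_half_lt M e0; exists N => D ND.
rewrite normcB; apply: le_lt_trans (hN D ND).
have := (cau v v1 D).2 (rho / 4)%:C; rewrite -tE normc_ler0 ?(ltW r4) //.
rewrite (_ : 2 / rho * (rho / 4) = 2^-1); last by field; rewrite gt_eqF.
rewrite /series /= big_mkord; apply.
by rewrite ler_pdivrMr // ler_pMr // ler1n.
Qed.

(** * Partial derivatives *)

(** The left-hand side consists of the binomial terms of degree $j\ge2$ in $s$, where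
    $|s|^j\le(|s|/\sigma)^2\sigma^j$; the same terms at $|x|$ and $\sigma$ make up the right-hand
    side. The identity [e1] carries this through the induction. *)
Lemma pow_taylor2 (R : realType) (x s : R[i]) (sig : R) k :
  0 < sig -> normc s <= sig ->
  normc ((x + s) ^+ k - x ^+ k - k%:R * s * x ^+ k.-1) <=
  (normc s / sig) ^+ 2 *
    ((normc x + sig) ^+ k - normc x ^+ k - k%:R * sig * normc x ^+ k.-1).
Proof.
move=> s0 ss; elim: k => [|k IH].
  by rewrite !expr0 !mul0r !subr0 !subrr mulr0 normc0.
have x0 := normc_ge0 x.
have e1 (A : comNzRingType) (a b : A) : (a + b) ^+ k.+1 - a ^+ k.+1 - k.+1%:R * b * a ^+ k =
   (a + b) * ((a + b) ^+ k - a ^+ k - k%:R * b * a ^+ k.-1) + k%:R * b ^+ 2 * a ^+ k.-1.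
  case: (k) => [|j] /=; rewrite ?expr0 ?exprS; first by ring.
  by rewrite -[j.+2%:R]natr1; ring.
rewrite /= !e1; apply: le_trans (normcD _ _) _; rewrite [leRHS]mulrDr; apply: lerD.
  rewrite normcM mulrCA; apply: ler_pM => //; rewrite ?normc_ge0 //.
  by apply: le_trans (normcD _ _) _; rewrite lerD2l.
rewrite !normcM -expr2 normc_nat normcX [leRHS]mulrA.
rewrite le_eqVlt; apply/orP; left; apply/eqP; congr (_ * _).
by field; rewrite gt_eqF.
Qed.

Lemma natr_le_pow2 (R : realType) d : d%:R <= 2 ^+ d :> R.
Proof. by rewrite -natrX ler_nat ltnW // ltn_expl. Qed.

(** Termwise differentiation: halving the radius absorbs the factor $k_j\le2^{|k|}$. The quadratic
    remainder, uniform in [t], makes the difference quotients converge. *)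
Lemma wiener_deriv (R : realType) r (t0 : 'rV[R[i]]_r) rho M f (j : 'I_r) :
  0 < rho -> wiener t0 rho M f ->
  exists g, wiener t0 (rho / 2) (2 / rho * M) g /\
  forall t, pdisc t0 (rho / 2) t -> forall s, normc s <= rho / 4 ->
  normc (f (t + s *: delta_mx 0 j) - f t - s * g t) <= (4 * normc s / rho) ^+ 2 * M.
Proof.
move=> r0 [c [hc hf]].
have r2 : 0 < rho / 2 by rewrite divr_gt0.
have r2r : rho / 2 <= rho by rewrite ler_pdivrMr // ler_pMr // ler1n.
(* For [k j = 0] the predecessor is not the exponent of a derivative, which is harmless because
   [b k] is then 0. *)
pose kap (k : {ffun 'I_r -> nat}) : {ffun 'I_r -> nat} := [ffun i => if i == j then (k i).-1 else k i].
pose b (k : {ffun 'I_r -> nat}) := (k j)%:R * c k.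
have hb : asum (fun k => ((rho / 2) ^+ mdeg (kap k))%:C * b k) (2 / rho * M).
  have := asumZ (2 / rho)%:C hc; rewrite normc_ler0 ?divr_ge0 ?(ltW r0) //.
  apply: asum_le => k; rewrite /b mulrA [leRHS]normcM [X in _ <= _ * X]normcM.
  rewrite normcM mulrA; apply: ler_wpM2r; first exact: normc_ge0.
  rewrite normcM normc_nat !normc_ler0 ?exprn_ge0 ?divr_ge0 ?(ltW r0) //.
  case kj : (k j) => [|d]; first by rewrite mulr0 mulr_ge0 ?divr_ge0 ?exprn_ge0 ?(ltW r0).
  have -> : mdeg k = (mdeg (kap k)).+1.
    rewrite /mdeg (bigD1 j) //= [in RHS](bigD1 j) //= ffunE eqxx kj /= addSn; congr (_ + _).+1.
    by apply: eq_bigr => i ij; rewrite ffunE (negbTE ij).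
  rewrite exprS mulrA divfK ?gt_eqF // expr_div_n mulrAC ler_pdivrMr ?exprn_gt0 //.
  rewrite (_ : 2 * _ * _ = rho ^+ mdeg (kap k) * (2 * 2 ^+ mdeg (kap k))); last by ring.
  apply: ler_wpM2l; first by rewrite exprn_ge0 // ltW.
  rewrite -exprS; apply: le_trans (natr_le_pow2 R _) _.
  rewrite ler_eXn2l ?ltr1n // ltnS /mdeg (bigD1 j) //= ffunE eqxx kj /=.
  exact: leq_addr.
have /choice[g hg] t : exists y, pdisc t0 (rho / 2) t ->
    hsum (fun k => b k * mono t0 t (kap k)) y.
  have [ht|nt] := pselect (pdisc t0 (rho / 2) t); last by exists 0.
  have hbt : asum (fun k => b k * mono t0 t (kap k)) (2 / rho * M).
    apply: asum_le hb => k; rewrite normcM [leRHS]normcM mulrC.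
    apply: ler_wpM2r; first exact: normc_ge0.
    by rewrite [leRHS]normc_ler0 ?exprn_ge0 ?(ltW r2) // normc_mono // ltW.
  by have [y hy] := asum_hsum hbt; exists y.
exists g; split; first exact: (wiener_intro r2 hb hg).
move=> t ht s hs.
pose t' := t + s *: delta_mx 0 j.
have ht' : pdisc t0 rho t'.
  move=> i; rewrite !mxE eqxx /= addrAC; apply: le_trans (normcD _ _) _.
  have : normc (s * (i == j)%:R) <= rho / 4.
    by rewrite normcM normc_nat; case: eqP => _; rewrite ?mulr1 ?mulr0 // divr_ge0 // ltW.
  have := ht i; lra.
have h1 := hf t' ht'; have h2 := hf t (pdisc_le r2r ht).
have h3 := hsumD (hsumD h1 (hsumZ (-1) h2)) (hsumZ (- s) (hg t ht)).
rewrite mulN1r mulNr in h3; apply: hsum_norm h3.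
have r4 : 0 < rho / 4 by rewrite divr_gt0.
have := asumZ ((4 * normc s / rho) ^+ 2)%:C hc; rewrite normc_ler0 ?exprn_ge0 ?divr_ge0 ?mulr_ge0 ?normc_ge0 ?(ltW r0) //.
apply: asum_le => k.
pose rest := \prod_(i < r | i != j) (t 0 i - t0 0 i) ^+ k i.
have e1 : mono t0 t' k = (t 0 j - t0 0 j + s) ^+ k j * rest.
  rewrite /mono (bigD1 j) //= !mxE !eqxx mulr1 addrAC; congr (_ * _).
  by apply: eq_bigr => i ij; rewrite !mxE eqxx (negbTE ij) mulr0 addr0.
have e2 : mono t0 t k = (t 0 j - t0 0 j) ^+ k j * rest by rewrite /mono (bigD1 j).
have e3 : mono t0 t (kap k) = (t 0 j - t0 0 j) ^+ (k j).-1 * rest.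
  rewrite /mono (bigD1 j) //= ffunE eqxx; congr (_ * _).
  by apply: eq_bigr => i ij; rewrite ffunE (negbTE ij).
rewrite e1 e2 e3 /b; set x := t 0 j - t0 0 j.
rewrite (_ : _ + _ + _ = c k * rest * ((x + s) ^+ k j - x ^+ k j - (k j)%:R * s * x ^+ (k j).-1)); last by ring.
have hx : normc x <= rho / 2 := ht j.
have key : normc ((x + s) ^+ k j - x ^+ k j - (k j)%:R * s * x ^+ (k j).-1) <=
   (4 * normc s / rho) ^+ 2 * rho ^+ k j.
  apply: le_trans (pow_taylor2 _ _ r4 hs) _.
  have -> : normc s / (rho / 4) = 4 * normc s / rho by field; rewrite gt_eqF.
  apply: ler_wpM2l; first by rewrite exprn_ge0 // divr_ge0 ?mulr_ge0 ?normc_ge0 // ltW.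
  apply: (@le_trans _ _ ((normc x + rho / 4) ^+ k j)).
    rewrite -addrA gerDl -opprD oppr_le0 addr_ge0 ?mulr_ge0 ?exprn_ge0 ?normc_ge0 //.
    exact: ltW.
  by rewrite lerXn2r ?nnegrE ?addr_ge0 ?normc_ge0 ?(ltW r0) ?(ltW r4) //; lra.
have hrest : normc rest <= \prod_(i < r | i != j) rho ^+ k i.
  rewrite normc_prod; apply: ler_prod => i _; rewrite normc_ge0 normcX lerXn2r ?nnegrE ?normc_ge0 ?(ltW r0) //.
  exact: le_trans (ht i) r2r.
have -> : (rho ^+ mdeg k) = rho ^+ k j * \prod_(i < r | i != j) rho ^+ k i.
  by rewrite /mdeg expr_sum (bigD1 j).
have p0 : 0 <= \prod_(i < r | i != j) rho ^+ k i.
  by apply: prodr_ge0 => i _; rewrite exprn_ge0 // ltW.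
have s20 : 0 <= (4 * normc s / rho) ^+ 2.
  by rewrite exprn_ge0 // divr_ge0 ?mulr_ge0 ?normc_ge0 // ltW.
have rk0 : 0 <= rho ^+ k j by rewrite exprn_ge0 // ltW.
rewrite [leRHS]normcM [X in _ <= _ * X]normcM [normc (_ ^+ 2)%:C]normc_ler0 //.
rewrite [normc (_ * _)%:C]normc_ler0 ?mulr_ge0 // normcM [normc (c k * rest)]normcM.
apply: le_trans (ler_pM _ _ (ler_wpM2l (normc_ge0 (c k)) hrest) key) _; rewrite ?mulr_ge0 ?normc_ge0 //.
by rewrite le_eqVlt; apply/orP; left; apply/eqP; ring.
Qed.

Definition mxwiener (R : realType) r n (t0 : 'rV[R[i]]_r) (rho M : R)
    (F : 'rV[R[i]]_r -> 'M[R[i]]_n) :=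
  forall i j, wiener t0 rho M (fun t => F t i j).

(** ['D_v F] is a [lim], so the convergence of the matrix difference quotients is shown first; only
    then is it identified with the termwise derivative. *)
Lemma mxwiener_derive (R : realType) r n (t0 : 'rV[R[i]]_r) rho M
    (F : 'rV[R[i]]_r -> 'M[R[i]]_n) (j : 'I_r) :
  0 < rho -> mxwiener t0 rho M F ->
  mxwiener t0 (rho / 2) (2 / rho * M) (fun t => 'D_(delta_mx 0 j) F t).
Proof.
move=> r0 hF.
have /choice[g hg] (ab : 'I_n * 'I_n) := wiener_deriv j r0 (hF ab.1 ab.2).
have M0 i i' : 0 <= M := wiener_ge0 (hF i i').
have key t : pdisc t0 (rho / 2) t -> 'D_(delta_mx 0 j) F t = \matrix_(a, b) g (a, b) t.
  move=> ht; apply: cvg_lim => //; apply/cvg_mxcP => a b; rewrite mxE.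
  apply/cvgcP => e e0; have [_ /(_ t ht) h] := hg (a, b).
  have r40 : 0 < rho / 4 by rewrite divr_gt0.
  pose B := 16 * M / rho ^+ 2.
  have B0 : 0 <= B by rewrite divr_ge0 ?mulr_ge0 ?exprn_ge0 ?(M0 a b) // ltW.
  have B1 : 0 < B + 1 by rewrite ltr_wpDl.
  apply/nbhs_normP; exists (Num.min (rho / 4) (e / (B + 1)))%:C.
    by rewrite /= ltcR lt_min r40 divr_gt0.
  move=> s; rewrite /ball_ /= sub0r normrN normc_ltC lt_min => /andP[s4 sB] s0.
  have := h s (ltW s4).
  have -> : (s^-1 *: (F (s *: delta_mx 0 j + t) - F t)) a b - g (a, b) t =
    s^-1 * (F (t + s *: delta_mx 0 j) a b - F t a b - s * g (a, b) t).
    by rewrite !mxE [_ + t]addrC [RHS]mulrBr mulKf.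
  rewrite normcM normcV => hh.
  have ns : 0 < normc s by rewrite normc_gt0.
  rewrite mulrC ltr_pdivrMr //; apply: le_lt_trans hh _.
  have -> : (4 * normc s / rho) ^+ 2 * M = B * normc s * normc s.
    by rewrite /B; field; rewrite gt_eqF.
  rewrite ltr_pM2r //; rewrite ltr_pdivlMr // in sB; apply: le_lt_trans sB.
  by rewrite mulrC; apply: ler_wpM2l; rewrite ?lerDl // ltW.
move=> a b; have [h _] := hg (a, b); apply: wiener_ext h => t ht.
by rewrite key // mxE.
Qed.

Lemma mxwiener_ext (R : realType) r n (t0 : 'rV[R[i]]_r) rho M
    (F G : 'rV[R[i]]_r -> 'M[R[i]]_n) :
  (forall t, pdisc t0 rho t -> F t = G t) -> mxwiener t0 rho M F -> mxwiener t0 rho M G.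
Proof. by move=> h hF i j; apply: wiener_ext (hF i j) => t ht; rewrite h. Qed.

(** The shape of the bound after [N] differentiations, each of which halves the radius. What matters
    later is the power $\rho^{-N}$, for $\rho$ proportional to $|x-\alpha(t)|$; $(2^N)^N$ is a crude
    constant independent of $\rho$. *)
Definition bderiv (R : realType) r n (t0 : 'rV[R[i]]_r) (rho M : R) (N : nat)
    (F : 'rV[R[i]]_r -> 'M[R[i]]_n) :=
  mxwiener t0 (rho / 2 ^+ N) ((2 ^+ N) ^+ N * (M / rho ^+ N)) F.

Lemma bderiv_derive (R : realType) r n (t0 : 'rV[R[i]]_r) rho M N
    (F : 'rV[R[i]]_r -> 'M[R[i]]_n) (j : 'I_r) :
  0 < rho -> bderiv t0 rho M N F ->
  bderiv t0 rho M N.+1 (fun t => 'D_(delta_mx 0 j) F t).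
Proof.
move=> r0 h; have rN : 0 < rho / 2 ^+ N by rewrite divr_gt0 // exprn_gt0.
have := mxwiener_derive j rN h; rewrite /bderiv.
have -> : rho / 2 ^+ N / 2 = rho / 2 ^+ N.+1 by rewrite exprS; field; rewrite expf_neq0.
move=> hh a b; apply: wiener_le (hh a b).
have M0 : 0 <= M / rho ^+ N.
  by have := wiener_ge0 (h a b); rewrite pmulr_rge0 // exprn_gt0 // exprn_gt0.
rewrite (_ : 2 / _ * _ = 2 ^+ N.+1 * (2 ^+ N) ^+ N * (M / rho ^+ N) / rho); last first.
  by rewrite exprS; field; rewrite !expf_neq0 ?gt_eqF.
rewrite (_ : (2 ^+ N.+1) ^+ N.+1 * _ = 2 ^+ N.+1 * (2 ^+ N.+1) ^+ N * (M / rho ^+ N) / rho); last first.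
  by rewrite [rho ^+ N.+1]exprS [(2 ^+ N.+1) ^+ N.+1]exprS; field; rewrite !expf_neq0 ?gt_eqF.
rewrite ler_pM2r ?invr_gt0 //; apply: ler_wpM2r => //.
apply: ler_wpM2l; first by rewrite exprn_ge0.
by rewrite lerXn2r ?nnegrE ?exprn_ge0 // ler_eXn2l ?ltr1n.
Qed.

Lemma pderiv_bound (R : realType) r n (t0 : 'rV[R[i]]_r) rho M
    (F : 'rV[R[i]]_r -> 'M[R[i]]_n) (m : 'I_r -> nat) :
  0 < rho -> mxwiener t0 rho M F ->
  let N := (\sum_j m j)%N in
  forall i j, normc (pderiv m F t0 i j) <= (2 ^+ N) ^+ N * (M / rho ^+ N).
Proof.
move=> r0 hF N.
have key (l : seq 'I_r) : bderiv t0 rho M (\sum_(j <- l) m j)%N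
   (foldr (fun j G => iter (m j) (fun H t => 'D_(delta_mx 0 j) H t) G) F l).
  elim: l => [|j l IH] /=.
    by rewrite big_nil /bderiv !expr0 !divr1 mul1r.
  rewrite big_cons; elim: (m j) => [|k IHk] //.
  by rewrite addSn /=; exact: bderiv_derive.
move=> i j; have := key (enum 'I_r) i j; rewrite big_enum /= -/N => h.
have rN : 0 < rho / 2 ^+ N by rewrite divr_gt0 // exprn_gt0.
exact: (wiener_bound (ltW rN) h (pdisc_center _ (ltW rN))).
Qed.

(** Equality near a point survives differentiation because it holds near every neighbouring point
    too. This lets [Ysol] be replaced by a function that agrees with it only near [t0]. *)
Lemma near_eq_pderiv (R : realType) r n (t0 : 'rV[R[i]]_r)
    (F G : 'rV[R[i]]_r -> 'M[R[i]]_n) (m : 'I_r -> nat) :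
  (\forall t \near t0, F t = G t) -> \forall t \near t0, pderiv m F t = pderiv m G t.
Proof.
move=> h; rewrite /pderiv; elim: (enum 'I_r) => [|j l IH] //=.
elim: (m j) => [|k IHk] //=.
move: IHk => /nbhs_interior; apply: filterS => t ht.
exact: near_eq_derive.
Qed.

Lemma pdisc_sub (R : realType) r (t0 t1 : 'rV[R[i]]_r) rho rho' a :
  pdisc t0 a t1 -> a + rho' <= rho -> pdisc t1 rho' `<=` pdisc t0 rho.
Proof.
move=> h1 ha t ht j; rewrite (_ : _ - _ = (t 0 j - t1 0 j) + (t1 0 j - t0 0 j)); last by ring.
apply: le_trans (normcD _ _) _; have := h1 j; have := ht j; lra.
Qed.

(** * Uniform bounds from pointwise bounds *)

(** Provides the common point of nested polydiscs, one coordinate at a time: the increments are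
    dominated by a geometric series. *)
Lemma cauchy_limit (R : realType) (u : nat -> R[i]) (d : nat -> R) d0 : 0 <= d0 ->
  (forall k, d k <= d0 * 2^-1 ^+ k) ->
  (forall m k, (k <= m)%N -> normc (u m - u k) <= d k) ->
  exists l, forall k, normc (l - u k) <= d k.
Proof.
move=> d00 hd hu; pose a i := u i.+1 - u i.
have ha : asum a (d0 * 2).
  apply: asum_nat => N; apply: le_trans (ler_wpM2l d00 (geo_half_le2 R N)).
  rewrite big_mkord mulr_sumr; apply: ler_sum => i _; apply: le_trans (hd i).
  exact: hu.
have [l0 /hsum_series hl] := asum_hsum ha.
have sE k : series a k = u k - u 0%N.
  by rewrite /series /= telescope_sumr.
exists (l0 + u 0%N) => k; apply/ler_addgt0Pr => e e0.
have [N hN] := (cvgn_normcP _ _).1 hl e e0.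
have := hN (maxn N k) (leq_maxl _ _); have := hu (maxn N k) k (leq_maxr _ _).
rewrite sE; set v := u (maxn N k) => h1 h2.
rewrite (_ : _ - u k = (v - u k) - (v - u 0%N - l0)); last by ring.
by apply: le_trans (normcD _ _) _; rewrite normcN lerD // ltW.
Qed.

(* Baire's argument: a failure of uniformity on every polydisc produces nested
   polydiscs shrinking to a point where the pointwise bound fails. *)
Lemma uniform_geometric_bound (R : realType) r (U : set 'rV[R[i]]_r)
    (b : nat -> 'rV[R[i]]_r -> R) (t1 : 'rV[R[i]]_r) (rho1 : R) :
  0 < rho1 -> pdisc t1 rho1 `<=` U ->
  (forall k t K, U t -> K < b k t -> exists2 d, 0 < d & forall s, pdisc t d s -> K < b k s) ->
  (forall t, U t -> exists2 K, 0 <= K & forall k, b k t <= K ^+ k.+1) ->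
  exists t0 rho K, [/\ 0 < rho, 0 <= K, pdisc t0 rho `<=` U &
    forall t, pdisc t0 rho t -> forall k, b k t <= K ^+ k.+1].
Proof.
move=> r1 sub1 sc pw; apply: contrapT => hN.
pose valid (x : 'rV[R[i]]_r * R) := 0 < x.2 /\ pdisc x.1 x.2 `<=` U.
(* Inside a valid polydisc some [b k] exceeds [m ^+ k.+1] on a whole smaller polydisc: otherwise the
   bound with [K = m] would hold on the polydisc of half the radius, against [hN]. *)
have step (xm : ('rV[R[i]]_r * R) * nat) : exists y : 'rV[R[i]]_r * R, valid xm.1 ->
   [/\ valid y, y.2 <= xm.1.2 / 2, pdisc y.1 y.2 `<=` pdisc xm.1.1 xm.1.2 &
     exists k, forall s, pdisc y.1 y.2 s -> xm.2%:R ^+ k.+1 < b k s].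
  case: xm => [[t d] m] /=; have [[/= d0 sub]|nv] := pselect (valid (t, d)); last by exists (t, d).
  have d2 : 0 < d / 2 by rewrite divr_gt0.
  have [s [hs [k hk]]] : exists s, pdisc t (d / 2) s /\ exists k, m%:R ^+ k.+1 < b k s.
    apply: contrapT => h; apply: hN; exists t, (d / 2), m%:R; split=> //.
      by apply: subset_trans sub; apply: pdisc_le; lra.
    move=> s hs k; rewrite leNgt; apply/negP => hk; apply: h; exists s; split=> //.
    by exists k.
  have sU : U s by apply: sub; move: hs; apply: pdisc_le; lra.
  have [d' d'0 hd'] := sc k s _ sU hk.
  exists (s, Num.min (d / 2) d') => _ /=.
  have hsub : pdisc s (Num.min (d / 2) d') `<=` pdisc t d.
    apply: (pdisc_sub hs); have : Num.min (d / 2) d' <= d / 2 by rewrite ge_min lexx.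
    lra.
  split.
  - by split=> /=; [rewrite lt_min d2|exact: subset_trans sub].
  - by rewrite ge_min lexx.
  - exact: hsub.
  - exists k => s' hs'; apply: hd'; move: hs'; apply: pdisc_le.
    by rewrite ge_min lexx orbT.
have [f hf] := choice step.
pose fix x m := if m is m'.+1 then f (x m', m') else (t1, rho1).
have vx m : valid (x m) by elim: m => [|m IH] //; have [] := hf (x m, m) IH.
have x2 m : (x m).2 <= rho1 * 2^-1 ^+ m.
  elim: m => [|m IH]; first by rewrite expr0 mulr1.
  have [_ h _ _] := hf (x m, m) (vx m); apply: le_trans h _.
  by rewrite exprS [2^-1 * _]mulrC mulrA ler_wpM2r // invr_ge0.
have nest m k : (k <= m)%N -> pdisc (x m).1 (x m).2 `<=` pdisc (x k).1 (x k).2.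
  elim: m => [|m IH]; first by rewrite leqn0 => /eqP ->.
  rewrite leq_eqVlt => /orP[/eqP -> //|]; rewrite ltnS => /IH; apply: subset_trans.
  by have [] := hf (x m, m) (vx m).
have /choice[l hl] j : exists l, forall k, normc (l - (x k).1 0 j) <= (x k).2.
  apply: (@cauchy_limit _ (fun k => (x k).1 0 j) (fun k => (x k).2) rho1 (ltW r1) x2).
  move=> m k km; apply: (nest _ _ km); apply: pdisc_center; apply: ltW.
  by have [] := vx m.
pose p : 'rV[R[i]]_r := \row_j l j.
have hp m : pdisc (x m).1 (x m).2 p by move=> j; rewrite mxE.
have [K K0 hK] := pw p (sub1 p (hp 0%N)).
(* At a stage [m >= K] the common point lies in a polydisc on which some [b k] exceeds
   [m ^+ k.+1]. *)
have [m hm] : exists m : nat, K <= m%:R.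
  by exists (Num.bound K); apply: ltW; exact: archi_boundP.
have [_ _ _ [k hk]] := hf (x m, m) (vx m).
have := hk p (hp m.+1); rewrite ltNge => /negP; apply.
by apply: le_trans (hK k) _; rewrite lerXn2r ?nnegrE.
Qed.

(** * The normal form *)

Lemma cauchy_sum_le (R : realType) (a b : nat -> R) N :
  (forall i, 0 <= a i) -> (forall i, 0 <= b i) ->
  \sum_(0 <= k < N) \sum_(i < k.+1) a i * b (k - i)%N <=
  (\sum_(0 <= i < N) a i) * (\sum_(0 <= i < N) b i).
Proof.
move=> a0 b0; rewrite !big_mkord.
have e1 (k : 'I_N) : \sum_(i < k.+1) a i * b (k - i)%N =
    \sum_(i < N) if (i <= k)%N then a i * b (k - i)%N else 0.
  rewrite -big_mkcond /= (big_ord_widen N (fun i => a i * b (k - i)%N)) //.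
rewrite (eq_bigr _ (fun k _ => e1 k)) exchange_big /= mulr_suml.
apply: ler_sum => i _.
have e2 M : \sum_(k < M) (if (i <= k)%N then a i * b (k - i)%N else 0) =
    a i * \sum_(j < M - i) b j.
  elim: M => [|M IH]; first by rewrite big_ord0 sub0n big_ord0 mulr0.
  rewrite big_ord_recr /= IH; case: leqP => [iM|iM].
    by rewrite subSn // big_ord_recr /= mulrDr.
  have /eqP -> : (M - i == 0)%N by rewrite subn_eq0 ltnW.
  have /eqP -> : (M.+1 - i == 0)%N by rewrite subn_eq0.
  by rewrite addr0.
rewrite e2; apply: ler_wpM2l => //.
rewrite (big_ord_widen N b (leq_subr i N)) big_mkcond; apply: ler_sum => j _.
by case: ifP.
Qed.

Lemma mxwiener_const (R : realType) r n (t0 : 'rV[R[i]]_r) rho M (A : 'M[R[i]]_n) :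
  0 < rho -> (forall i j, normc (A i j) <= M) -> mxwiener t0 rho M (fun _ => A).
Proof. by move=> r0 h i j; apply: wiener_le (h i j) _; exact: wiener_const. Qed.

Lemma mxwiener_add (R : realType) r n (t0 : 'rV[R[i]]_r) rho M N
    (F G : 'rV[R[i]]_r -> 'M[R[i]]_n) :
  mxwiener t0 rho M F -> mxwiener t0 rho N G -> mxwiener t0 rho (M + N) (fun t => F t + G t).
Proof.
by move=> hF hG i j; apply: wiener_ext (wiener_add (hF i j) (hG i j)) => t _; rewrite mxE.
Qed.

Lemma mxwiener_opp (R : realType) r n (t0 : 'rV[R[i]]_r) rho M
    (F : 'rV[R[i]]_r -> 'M[R[i]]_n) :
  mxwiener t0 rho M F -> mxwiener t0 rho M (fun t => - F t).
Proof. by move=> hF i j; apply: wiener_ext (wiener_opp (hF i j)) => t _; rewrite mxE. Qed.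

Lemma mxwiener_sub (R : realType) r n (t0 : 'rV[R[i]]_r) rho M N
    (F G : 'rV[R[i]]_r -> 'M[R[i]]_n) :
  mxwiener t0 rho M F -> mxwiener t0 rho N G -> mxwiener t0 rho (M + N) (fun t => F t - G t).
Proof. by move=> hF /mxwiener_opp; exact: mxwiener_add. Qed.

Lemma mxwiener_mul (R : realType) r n (t0 : 'rV[R[i]]_r) rho M N
    (F G : 'rV[R[i]]_r -> 'M[R[i]]_n) : 0 < rho ->
  mxwiener t0 rho M F -> mxwiener t0 rho N G ->
  mxwiener t0 rho (n%:R * (M * N)) (fun t => F t *m G t).
Proof.
move=> r0 hF hG i j.
have -> : n%:R * (M * N) = \sum_(l < n) M * N by rewrite sumr_const card_ord mulr_natl.
apply: wiener_ext (wiener_sum (F := fun l t => F t i l * G t l j) (M := fun => M * N) (index_enum 'I_n) r0 _) => [t _|l _].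
  by rewrite mxE.
exact: wiener_mul.
Qed.

Lemma mxwiener_sum (R : realType) r n (t0 : 'rV[R[i]]_r) rho (I : Type) (l : seq I)
    (M : I -> R) (F : I -> 'rV[R[i]]_r -> 'M[R[i]]_n) : 0 < rho ->
  (forall i, mxwiener t0 rho (M i) (F i)) ->
  mxwiener t0 rho (\sum_(i <- l) M i) (fun t => \sum_(i <- l) F i t).
Proof.
move=> r0 h i j; apply: wiener_ext (wiener_sum (F := fun x t => F x t i j) (M := M) l r0 _) => [t _|x _].
  by rewrite summxE.
exact: h.
Qed.

Lemma mxwiener_le (R : realType) r n (t0 : 'rV[R[i]]_r) rho M M'
    (F : 'rV[R[i]]_r -> 'M[R[i]]_n) :
  M <= M' -> mxwiener t0 rho M F -> mxwiener t0 rho M' F.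
Proof. by move=> MM h i j; apply: wiener_le (h i j). Qed.

Definition mxmask (R : nzRingType) n (B : 'I_n -> 'I_n -> bool) (M : 'M[R]_n) : 'M[R]_n :=
  \matrix_(i, j) if B i j then M i j else 0.

Lemma mxwiener_mask (R : realType) r n (t0 : 'rV[R[i]]_r) rho M B
    (F : 'rV[R[i]]_r -> 'M[R[i]]_n) : 0 < rho ->
  mxwiener t0 rho M F -> mxwiener t0 rho M (fun t => mxmask B (F t)).
Proof.
move=> r0 h i j; have M0 := wiener_ge0 (h i j).
apply: (@wiener_ext _ _ _ _ _ (fun t => if B i j then F t i j else 0)).
  by move=> t _; rewrite mxE.
case: (B i j); first exact: h.
by apply: wiener_le (wiener_const _ _ r0); rewrite normc0.
Qed.

(* Solves dl_k * X_k = F_k + \sum_(a <= k) F_a q_(k-a) - \sum_(a <= k) q_a n_(k-a)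
   by iteration, q and n being complementary entries of X; the scalar sequence
   nf_maj majorizes the iterates and their increments. *)
Definition nf_rhs (R : realType) r n (B : nat -> 'I_n -> 'I_n -> bool)
    (F X : nat -> 'rV[R[i]]_r -> 'M[R[i]]_n) (k : nat) (t : 'rV[R[i]]_r) : 'M[R[i]]_n :=
  F k t + \sum_(a < k.+1) F a t *m mxmask (B (k - a)%N) (X (k - a)%N t)
   - \sum_(a < k.+1) mxmask (B a) (X a t) *m mxmask (fun i j => ~~ B (k - a)%N i j) (X (k - a)%N t).

Fixpoint nf_iter (R : realType) r n (dl : nat -> 'I_n -> 'I_n -> R[i])
    (B : nat -> 'I_n -> 'I_n -> bool) (F : nat -> 'rV[R[i]]_r -> 'M[R[i]]_n) (m : nat)
    : nat -> 'rV[R[i]]_r -> 'M[R[i]]_n :=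
  if m is m'.+1 then
    fun k t => \matrix_(i, j) ((dl k i j)^-1 * nf_rhs B F (nf_iter dl B F m') k t i j)
  else fun _ _ => 0.

Fixpoint nf_maj (R : realType) (n : nat) (kap : R) (phi : nat -> R) (m : nat) : nat -> R :=
  if m is m'.+1 then
    fun k => kap * (phi k + \sum_(a < k.+1) n%:R * (phi a * nf_maj n kap phi m' (k - a)%N)
      + \sum_(a < k.+1) n%:R * (nf_maj n kap phi m' a * nf_maj n kap phi m' (k - a)%N))
  else fun _ => 0.

(** Convolution is submultiplicative for the weighted norm $\sum_k\sigma^kx_k$, so the last
    hypothesis says that the recursion maps the ball of radius [s] into itself. *)
Lemma nf_maj_bound (R : realType) n (kap sig Phi s : R) (phi : nat -> R) m :
  0 <= kap -> 0 < sig -> 0 <= s -> (forall k, 0 <= phi k) ->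
  (forall N, \sum_(0 <= k < N) sig ^+ k * phi k <= Phi) ->
  kap * (Phi + n%:R * (Phi * s) + n%:R * (s * s)) <= s ->
  (forall k, 0 <= nf_maj n kap phi m k) /\
  (forall N, \sum_(0 <= k < N) sig ^+ k * nf_maj n kap phi m k <= s).
Proof.
move=> k0 s0 ss0 p0 hPhi hs; elim: m => [|m [IH0 IH]] /=.
  by split=> // N; rewrite big1 // => k _; rewrite mulr0.
split=> [k|N].
  by rewrite mulr_ge0 // !addr_ge0 //; apply: sumr_ge0 => a _; rewrite !mulr_ge0.
apply: le_trans hs.
have conv (a b : nat -> R) A B' : (forall i, 0 <= a i) -> (forall i, 0 <= b i) ->
    (forall N, \sum_(0 <= k < N) sig ^+ k * a k <= A) ->
    (forall N, \sum_(0 <= k < N) sig ^+ k * b k <= B') ->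
    \sum_(0 <= k < N) sig ^+ k * (\sum_(x < k.+1) n%:R * (a x * b (k - x)%N)) <= n%:R * (A * B').
  move=> a0 b0 hA hB.
  have sa i : 0 <= sig ^+ i * a i by rewrite mulr_ge0 // exprn_ge0 // ltW.
  have sb i : 0 <= sig ^+ i * b i by rewrite mulr_ge0 // exprn_ge0 // ltW.
  rewrite (_ : \sum_(0 <= k < N) _ = n%:R * \sum_(0 <= k < N) \sum_(x < k.+1)
      (sig ^+ x * a x) * (sig ^+ (k - x) * b (k - x)%N)).
    apply: ler_wpM2l => //; apply: le_trans (cauchy_sum_le _ sa sb) _.
    by apply: ler_pM => //; rewrite sumr_ge0.
  rewrite mulr_sumr; apply: eq_bigr => k _; rewrite mulr_sumr mulr_sumr.
  apply: eq_bigr => x _; have xk : (x <= k)%N by rewrite -ltnS.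
  have -> : sig ^+ k = sig ^+ x * sig ^+ (k - x) by rewrite -exprD subnKC.
  ring.
rewrite (eq_bigr (fun k => kap * (sig ^+ k * phi k
   + sig ^+ k * (\sum_(a < k.+1) n%:R * (phi a * nf_maj n kap phi m (k - a)%N))
   + sig ^+ k * (\sum_(a < k.+1) n%:R * (nf_maj n kap phi m a * nf_maj n kap phi m (k - a)%N))))); last first.
  by move=> k _; ring.
rewrite -mulr_sumr; apply: ler_wpM2l => //; rewrite !big_split /=.
by apply: lerD; [apply: lerD => //|]; exact: conv.
Qed.

Lemma nf_maj_term (R : realType) (sig s : R) (x : nat -> R) k : 0 < sig ->
  (forall k, 0 <= x k) -> (forall N, \sum_(0 <= k < N) sig ^+ k * x k <= s) ->
  x k <= s / sig ^+ k.
Proof.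
move=> s0 x0 h; rewrite ler_pdivlMr ?exprn_gt0 // mulrC; apply: le_trans (h k.+1).
rewrite big_nat_recr //= lerDr sumr_ge0 // => i _.
by rewrite mulr_ge0 // exprn_ge0 // ltW.
Qed.

Lemma mxwiener_dl (R : realType) r n (t0 : 'rV[R[i]]_r) rho M kap (dl : 'I_n -> 'I_n -> R[i])
    (G : 'rV[R[i]]_r -> 'M[R[i]]_n) :
  (forall i j, normc (dl i j)^-1 <= kap) ->
  mxwiener t0 rho M G -> mxwiener t0 rho (kap * M) (fun t => \matrix_(i, j) ((dl i j)^-1 * G t i j)).
Proof.
move=> hd hG i j; have M0 := wiener_ge0 (hG i j).
apply: (wiener_le (ler_wpM2r M0 (hd i j))).
by apply: wiener_ext (wiener_scale _ (hG i j)) => t _; rewrite mxE.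
Qed.

Lemma mxmaskB (R : nzRingType) n (B : 'I_n -> 'I_n -> bool) (M N : 'M[R]_n) :
  mxmask B (M - N) = mxmask B M - mxmask B N.
Proof. by apply/matrixP => i j; rewrite !mxE; case: (B i j); rewrite ?subr0. Qed.

Lemma addr_cancel5 (V : zmodType) (p b1 c1 b2 c2 : V) :
  p + b1 + c1 - (p + b2 + c2) = (b1 - b2) + (c1 - c2).
Proof. by rewrite -[p + b1 + c1]addrA -[p + b2 + c2]addrA opprD addrACA subrr add0r opprD addrACA. Qed.

Lemma nf_iterSE (R : realType) r n dl B F p k t i j :
  @nf_iter R r n dl B F p.+1 k t i j = (dl k i j)^-1 * nf_rhs B F (nf_iter dl B F p) k t i j.
Proof. by rewrite mxE. Qed.

Lemma mxBE (V : zmodType) m n (A B : 'M[V]_(m, n)) i j : (A - B) i j = A i j - B i j.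
Proof. by rewrite !mxE. Qed.

(** [nf_maj] is the same quadratic recursion with all signs made positive, and
    $x'x'-xx=(x'-x)x'+x(x'-x)$; hence the differences of successive iterates are dominated by the
    differences of the majorants. *)
Lemma nf_iter_spec (R : realType) r n (t0 : 'rV[R[i]]_r) rho kap
    (dl : nat -> 'I_n -> 'I_n -> R[i]) (B : nat -> 'I_n -> 'I_n -> bool)
    (F : nat -> 'rV[R[i]]_r -> 'M[R[i]]_n) (phi : nat -> R) m :
  0 < rho -> 0 <= kap -> (forall k i j, normc (dl k i j)^-1 <= kap) ->
  (forall k, mxwiener t0 rho (phi k) (F k)) ->
  (forall k, mxwiener t0 rho (nf_maj n kap phi m k) (nf_iter dl B F m k)) /\
  (forall k, mxwiener t0 rho (nf_maj n kap phi m.+1 k - nf_maj n kap phi m k)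
     (fun t => nf_iter dl B F m.+1 k t - nf_iter dl B F m k t)).
Proof.
move=> r0 k0 hdl hF.
have ha m' : (forall k, mxwiener t0 rho (nf_maj n kap phi m' k) (nf_iter dl B F m' k)) ->
    forall k, mxwiener t0 rho (nf_maj n kap phi m'.+1 k) (nf_iter dl B F m'.+1 k).
  move=> IH k; apply: (mxwiener_dl (hdl k)).
  apply: mxwiener_sub; first apply: mxwiener_add => //.
    by apply: mxwiener_sum => // a; apply: mxwiener_mul => //; exact: mxwiener_mask.
  by apply: mxwiener_sum => // a; apply: mxwiener_mul => //; exact: mxwiener_mask.
have {}ha m' k : mxwiener t0 rho (nf_maj n kap phi m' k) (nf_iter dl B F m' k).
  elim: m' k => [|m' IH] k; last exact: ha.
  by apply: mxwiener_const => // i j; rewrite mxE normc0.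
split=> //; elim: m => [|m IH] k.
  rewrite subr0; apply: mxwiener_ext (ha 1%N k) => t _.
  by rewrite [X in _ - X]/= subr0.
set x := nf_maj n kap phi m; set x' := nf_maj n kap phi m.+1.
set X := nf_iter dl B F m; set X' := nf_iter dl B F m.+1.
have -> : nf_maj n kap phi m.+2 k - x' k =
   kap * (\sum_(a < k.+1) n%:R * (phi a * (x' (k - a)%N - x (k - a)%N)) +
     \sum_(a < k.+1) (n%:R * ((x' a - x a) * x' (k - a)%N) + n%:R * (x a * (x' (k - a)%N - x (k - a)%N)))).
  rewrite -[nf_maj n kap phi m.+2 k]/(kap * (phi k + \sum_(a < k.+1) n%:R * (phi a * x' (k - a)%N)
      + \sum_(a < k.+1) n%:R * (x' a * x' (k - a)%N))).
  rewrite -[x' k in X in X = _]/(kap * (phi k + \sum_(a < k.+1) n%:R * (phi a * x (k - a)%N)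
      + \sum_(a < k.+1) n%:R * (x a * x (k - a)%N))).
  rewrite -mulrBr; congr (_ * _).
  rewrite addr_cancel5 -!sumrB.
  by congr (_ + _); apply: eq_bigr => a _; ring.
pose D t := \sum_(a < k.+1) F a t *m mxmask (B (k - a)%N) (X' (k - a)%N t - X (k - a)%N t) -
    \sum_(a < k.+1) (mxmask (B a) (X' a t - X a t) *m mxmask (fun i j => ~~ B (k - a)%N i j) (X' (k - a)%N t)
      + mxmask (B a) (X a t) *m mxmask (fun i j => ~~ B (k - a)%N i j) (X' (k - a)%N t - X (k - a)%N t)).
have e t : nf_rhs B F X' k t - nf_rhs B F X k t = D t.
  rewrite /nf_rhs addr_cancel5 opprK; congr (_ + _).
    by rewrite -sumrB; apply: eq_bigr => a _; rewrite mxmaskB mulmxBr.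
  rewrite addrC -opprB -sumrB; congr (- _); apply: eq_bigr => a _.
  by rewrite !mxmaskB mulmxBl mulmxBr addrA subrK.
apply: (mxwiener_ext (F := fun t => \matrix_(i, j) ((dl k i j)^-1 * D t i j))).
  move=> t _; apply/matrixP => i j.
  by rewrite mxE -e mxBE [RHS]mxBE !nf_iterSE mulrBr.
apply: mxwiener_dl => //; apply: mxwiener_sub; apply: mxwiener_sum => // a.
  by apply: mxwiener_mul => //; apply: mxwiener_mask.
by apply: mxwiener_add; apply: mxwiener_mul => //; apply: mxwiener_mask => //; solve [exact: IH|exact: ha].
Qed.

Lemma cvg_sumc (R : realType) (I : Type) (l : seq I) (f : I -> nat -> R[i]) (g : I -> R[i]) :
  (forall i, f i @ \oo --> g i) ->
  (fun m => \sum_(i <- l) f i m) @ \oo --> \sum_(i <- l) g i.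
Proof.
move=> h; elim: l => [|i l IH].
  by under eq_fun do rewrite big_nil; rewrite big_nil; exact: cvg_cst.
under eq_fun do rewrite big_cons; rewrite big_cons; exact: (cvgD (h i) IH).
Qed.

Lemma cvg_mulmxc (R : realType) n (f g : nat -> 'M[R[i]]_n) (F G : 'M[R[i]]_n) :
  (forall i j, (fun m => f m i j) @ \oo --> F i j) ->
  (forall i j, (fun m => g m i j) @ \oo --> G i j) ->
  forall i j, (fun m => (f m *m g m) i j) @ \oo --> (F *m G) i j.
Proof.
move=> hf hg i j; under eq_fun do rewrite mxE; rewrite mxE.
by apply: cvg_sumc => l; exact: (cvgM (hf i l) (hg l j)).
Qed.

Lemma cvg_maskc (R : realType) n (B : 'I_n -> 'I_n -> bool) (f : nat -> 'M[R[i]]_n) (F : 'M[R[i]]_n) :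
  (forall i j, (fun m => f m i j) @ \oo --> F i j) ->
  forall i j, (fun m => mxmask B (f m) i j) @ \oo --> mxmask B F i j.
Proof.
move=> hf i j; under eq_fun do rewrite mxE; rewrite mxE.
by case: (B i j); [exact: hf|exact: cvg_cst].
Qed.

(** The increments of the majorants telescope to at most $s/\sigma^k$, so the iterates converge in
    Wiener norm without an explicit contraction factor, and the equation passes to the limit. *)
Lemma nf_solution (R : realType) r n (t0 : 'rV[R[i]]_r) rho kap sig Phi s
    (dl : nat -> 'I_n -> 'I_n -> R[i]) (B : nat -> 'I_n -> 'I_n -> bool)
    (F : nat -> 'rV[R[i]]_r -> 'M[R[i]]_n) (phi : nat -> R) :
  0 < rho -> 0 <= kap -> 0 < sig -> 0 <= s ->
  (forall k i j, dl k i j != 0) -> (forall k i j, normc (dl k i j)^-1 <= kap) ->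
  (forall k, 0 <= phi k) -> (forall k, mxwiener t0 rho (phi k) (F k)) ->
  (forall N, \sum_(0 <= k < N) sig ^+ k * phi k <= Phi) ->
  kap * (Phi + n%:R * (Phi * s) + n%:R * (s * s)) <= s ->
  exists X : nat -> 'rV[R[i]]_r -> 'M[R[i]]_n,
    (forall k, mxwiener t0 rho (s / sig ^+ k) (X k)) /\
    forall k t, pdisc t0 rho t -> forall i j,
      dl k i j * X k t i j = nf_rhs B F X k t i j.
Proof.
move=> r0 k0 s0 ss0 dl0 hdl p0 hF hPhi hs.
pose Xs := nf_iter dl B F.
pose X k t : 'M[R[i]]_n := \matrix_(i, j) limn (fun m => Xs m k t i j).
have maj m := nf_maj_bound m k0 s0 ss0 p0 hPhi hs.
have majs m k : nf_maj n kap phi m k <= s / sig ^+ k.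
  by have [h0 h1] := maj m; exact: nf_maj_term.
have inc m := (nf_iter_spec B m r0 k0 hdl hF).2.
have sE k t i j N : series (fun m => Xs m.+1 k t i j - Xs m k t i j) N = Xs N k t i j.
  by rewrite /series /= telescope_sumr // {2}/Xs /= mxE subr0.
have bd k N : \sum_(0 <= m < N) (nf_maj n kap phi m.+1 k - nf_maj n kap phi m k) <= s / sig ^+ k.
  by rewrite telescope_sumr // subr0 majs.
have cv k t i j : pdisc t0 rho t -> (fun m => Xs m k t i j) @ \oo --> X k t i j.
  move=> ht; have ha : asum (fun m => Xs m.+1 k t i j - Xs m k t i j) (s / sig ^+ k).
    apply: asum_nat => N; apply: le_trans (bd k N); apply: ler_sum => m _.
    have := wiener_bound (ltW r0) (inc m k i j) ht; rewrite /= !mxE //.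
  have [l /hsum_series hl] := asum_hsum ha.
  have {}hl : (fun m => Xs m k t i j) @ \oo --> l.
    by rewrite (_ : series _ = (fun m => Xs m k t i j)) in hl => //; apply/funext => N; rewrite sE.
  by rewrite mxE (cvg_lim _ hl).
exists X; split=> [k i j|k t ht i j].
  apply: (wiener_series (F := fun m t => Xs m.+1 k t i j - Xs m k t i j) r0 _ (bd k)).
    by move=> m; apply: wiener_ext (inc m k i j) => t _; rewrite [LHS]mxE [X in _ + X]mxE.
  move=> t ht; rewrite (_ : series _ = (fun m => Xs m k t i j)); first exact: cv.
  by apply/funext => N; rewrite sE.
have h1 : (fun m => dl k i j * Xs m.+1 k t i j) @ \oo --> dl k i j * X k t i j.
  apply: cvgM; first exact: cvg_cst.
  by rewrite (cvg_shiftS (fun m => Xs m k t i j)); exact: cv.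
have h2 : (fun m => nf_rhs B F (Xs m) k t i j) @ \oo --> nf_rhs B F X k t i j.
  rewrite /nf_rhs; under eq_fun do rewrite 2!mxE [X in _ + X]mxE !summxE.
  rewrite 2!mxE [X in _ + X]mxE !summxE; apply: cvgB; first apply: cvgD.
  - exact: cvg_cst.
  - apply: cvg_sumc => a; apply: cvg_mulmxc => i' j'; first exact: cvg_cst.
    by apply: cvg_maskc => ? ?; exact: cv.
  - by apply: cvg_sumc => a; apply: cvg_mulmxc => i' j'; apply: cvg_maskc => ? ?; exact: cv.
rewrite (_ : (fun m => nf_rhs _ _ _ _ _ _ _) = (fun m => dl k i j * Xs m.+1 k t i j)) in h2.
  exact: (cvg_unique _ h1 h2).
by apply/funext => m; rewrite {2}/Xs /= mxE mulVKf.
Qed.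

(** * Gauge equation, resonances and choice of constants *)

Lemma invmxM (F : fieldType) n (A B : 'M[F]_n) : A \in unitmx -> B \in unitmx ->
  invmx (A *m B) = invmx B *m invmx A.
Proof.
move=> uA uB; have u : A *m B \in unitmx by rewrite unitmx_mul uA.
by apply: (can_inj (mulKmx u)); rewrite mulmxV // mulmxA mulmxK // mulmxV.
Qed.

(** Schur's theorem gives a lower triangular [L] similar to [M]; conjugation by
    $\mathrm{diag}(\nu^i)$ multiplies the entry $(i,j)$ by $\nu^{j-i}$, small below the diagonal. As
    [lam] is fixed before [eps], the size of the perturbation can be chosen in terms of [lam]. *)
Lemma trig_small (R : realType) n (M : 'M[R[i]]_n) :
  exists lam : 'rV[R[i]]_n, forall eps : R, 0 < eps ->
  exists T : 'M[R[i]]_n, T \in unitmx /\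
    forall i j, normc ((invmx T *m M *m T - diag_mx lam) i j) <= eps.
Proof.
case: n M => [|n] M.
  by exists 0 => eps _; exists 1%:M; split=> [|[]//]; exact: unitmx1.
have [P /unitarymx_unit uP tP] := Schur M (ltn0Sn n).
pose L := P *m M *m invmx P.
have tL (i j : 'I_n.+1) : (i < j)%N -> L i j = 0.
  by move: tP; rewrite /similar_to conjumx // => /is_trig_mxP; apply.
exists (\row_i L i i) => eps e0.
pose S : R := \sum_i \sum_j normc (L i j).
have S0 : 0 <= S by do 2 (apply: sumr_ge0 => ? _); exact: normc_ge0.
have LS i j : normc (L i j) <= S.
  rewrite /S (bigD1 i) //= (bigD1 j) //= -addrA lerDl addr_ge0 //.
    by apply: sumr_ge0 => ? _; exact: normc_ge0.
  by do 2 (apply: sumr_ge0 => ? _); exact: normc_ge0.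
(* Ensures both $S/\nu\le\varepsilon$ and $\nu\ge1$, where [S] bounds every entry of [L]. *)
pose nu := 1 + S / eps.
have nu1 : 1 <= nu by rewrite lerDl divr_ge0 // ltW.
have nu0 : 0 < nu by apply: lt_le_trans nu1.
have nuC k : (nu ^+ k)%:C != 0 :> R[i].
  by rewrite -normc_eq0 normc_ler0 ?expf_neq0 ?exprn_ge0 ?gt_eqF // ltW.
pose D : 'M[R[i]]_n.+1 := diag_mx (\row_i (nu ^+ i)%:C).
pose D' : 'M[R[i]]_n.+1 := diag_mx (\row_i (nu ^+ i)%:C^-1).
have DD : D *m D' = 1%:M.
  rewrite mulmx_diag; apply/matrixP => i j; rewrite !mxE; case: eqP => //= _.
  by rewrite divff.
have uD : D \in unitmx by case: (mulmx1_unit DD).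
have iD : invmx D = D' by rewrite -[D']mul1mx -(mulVmx uD) -mulmxA DD mulmx1.
exists (invmx P *m D); split.
  by rewrite unitmx_mul unitmx_inv uP uD.
have -> : invmx (invmx P *m D) *m M *m (invmx P *m D) = D' *m L *m D.
  by rewrite invmxM ?unitmx_inv // invmxK iD /L !mulmxA.
move=> i j.
have -> : (D' *m L *m D - diag_mx (\row_i L i i)) i j =
   (if i == j then 0 else (nu ^+ i)%:C^-1 * L i j * (nu ^+ j)%:C).
  rewrite mul_diag_mx mul_mx_diag !mxE; case: eqP => [->|_] /=.
    by rewrite mulr1n mulrAC mulVf // mul1r subrr.
  by rewrite mulr0n subr0.
case: ifP => [|/eqP ij]; first by rewrite normc0 ltW.
have [ltij|ltji|/val_inj //] := ltngtP i j.
  by rewrite tL // mulr0 mul0r normc0 ltW.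
have -> : (i : nat) = (j + (i - j).-1.+1)%N by rewrite prednK ?subn_gt0 // subnKC // ltnW.
rewrite !normcM normcV !normc_ler0 ?exprn_ge0 ?(ltW nu0) // exprD exprS.
set q := (i - j).-1.
have nj : nu ^+ j != 0 by rewrite expf_neq0 // gt_eqF.
have -> : (nu ^+ j * (nu * nu ^+ q))^-1 * normc (L i j) * nu ^+ j = normc (L i j) / nu / nu ^+ q.
  by field; rewrite nj expf_neq0 gt_eqF.
rewrite ler_pdivrMr ?exprn_gt0 // ler_pdivrMr //.
apply: le_trans (LS i j) _; rewrite -mulrA.
apply: (@le_trans _ _ (eps * (1 * nu))).
  by rewrite mul1r /nu mulrDr mulr1 mulrCA divff ?gt_eqF // mulr1 lerDr ltW.
rewrite ler_pM2l //; apply: ler_pM => //; rewrite ?ler01 ?(ltW nu0) //.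
exact: exprn_ege1.
Qed.

(** For large [k] the inverse is at most 1, and finitely many [k] remain. If [w] is itself one of
    the integers, the convention $0^{-1}=0$ covers that term. *)
Lemma natr_sub_inv_bound (R : realType) (w : R[i]) :
  exists2 kap : R, 0 <= kap & forall k, normc (k%:R - w)^-1 <= kap.
Proof.
pose N := Num.bound (normc w + 1).
have hN : normc w + 1 < N%:R by apply: archi_boundP; rewrite addr_ge0 ?normc_ge0.
have S0 : 0 <= \sum_(k < N) normc (k%:R - w)^-1.
  by apply: sumr_ge0 => i _; exact: normc_ge0.
exists (1 + \sum_(k < N) normc (k%:R - w)^-1) => [|k]; first by rewrite addr_ge0.
have [kN|Nk] := ltnP k N.
  rewrite (bigD1 (Ordinal kN)) //= addrCA lerDl addr_ge0 //.
  by apply: sumr_ge0 => i _; exact: normc_ge0.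
apply: (@le_trans _ _ 1); last by rewrite lerDl.
have h : 1 <= normc (k%:R - w).
  have := normcD (k%:R - w) w; rewrite subrK normc_nat.
  have : N%:R <= k%:R :> R by rewrite ler_nat.
  lra.
by rewrite normcV invf_le1 // (lt_le_trans ltr01).
Qed.

Lemma matrix_bound (R : realType) m n (A : 'M[R[i]]_(m, n)) :
  exists2 b : R, 0 <= b & forall i j, normc (A i j) <= b.
Proof.
have S0 : 0 <= \sum_i \sum_j normc (A i j).
  by do 2 (apply: sumr_ge0 => ? _); exact: normc_ge0.
exists (\sum_i \sum_j normc (A i j)) => // i j.
rewrite (bigD1 i) //= (bigD1 j) //= -addrA lerDl addr_ge0 //.
  by apply: sumr_ge0 => ? _; exact: normc_ge0.
by do 2 (apply: sumr_ge0 => ? _); exact: normc_ge0.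
Qed.

Lemma mxwiener_conj (R : realType) r n (t0 : 'rV[R[i]]_r) rho M b
    (T T' : 'M[R[i]]_n) (G : 'rV[R[i]]_r -> 'M[R[i]]_n) : 0 < rho ->
  (forall i j, normc (T i j) <= b) -> (forall i j, normc (T' i j) <= b) ->
  mxwiener t0 rho M G ->
  mxwiener t0 rho (n%:R * (n%:R * (b * M) * b)) (fun t => T' *m G t *m T).
Proof.
move=> r0 hT hT' hG; apply: mxwiener_mul => //; last exact: mxwiener_const.
by apply: mxwiener_mul => //; exact: mxwiener_const.
Qed.

Lemma mxwiener_schwarz (R : realType) r n (t0 : 'rV[R[i]]_r) rho rho' M
    (G : 'rV[R[i]]_r -> 'M[R[i]]_n) : 0 < rho' -> rho' <= rho ->
  mxwiener t0 rho M G -> mxwiener t0 rho' (M * (rho' / rho)) (fun t => G t - G t0).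
Proof.
move=> r0 rr hG i j; apply: wiener_ext (wiener_schwarz r0 rr (hG i j)) => t _.
by rewrite mxBE.
Qed.

Lemma mxwiener_shrink (R : realType) r n (t0 : 'rV[R[i]]_r) rho rho' M
    (G : 'rV[R[i]]_r -> 'M[R[i]]_n) : 0 <= rho' -> rho' <= rho ->
  mxwiener t0 rho M G -> mxwiener t0 rho' M G.
Proof. by move=> r0 rr hG i j; apply: wiener_shrink (hG i j). Qed.

(** With $C=F+L$, $Q=1+q$, $N=L+p$, where $1$ and $L$ sit in degree 0 only, the gauge equation
    splits into the part left to the iteration and the linear part $Lq_k-q_kL-p_k$. *)
Lemma nf_expand (A : pzRingType) n k (L : 'M[A]_n) (F q p : nat -> 'M[A]_n) :
  \sum_(a < k.+1) (F a + if (a : nat) == 0%N then L else 0) *m (q (k - a)%N + if (k - a == 0)%N then 1%:M else 0)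
  - \sum_(a < k.+1) (q a + if (a : nat) == 0%N then 1%:M else 0) *m (p (k - a)%N + if (k - a == 0)%N then L else 0)
  = (F k + \sum_(a < k.+1) F a *m q (k - a)%N - \sum_(a < k.+1) q a *m p (k - a)%N)
   + (L *m q k - q k *m L - p k).
Proof.
have dl (M : 'M[A]_n) (G : nat -> 'M[A]_n) :
    \sum_(a < k.+1) (if (a : nat) == 0%N then M else 0) *m G (k - a)%N = M *m G k.
  rewrite big_ord_recl /= subn0 big1 ?addr0 // => a _.
  by rewrite mul0mx.
have dr (M : 'M[A]_n) (G : nat -> 'M[A]_n) :
    \sum_(a < k.+1) G a *m (if (k - a == 0)%N then M else 0) = G k *m M.
  rewrite big_ord_recr /= subnn eqxx big1 ?add0r // => a _.
  by rewrite subn_eq0 leqNgt ltn_ord /= mulmx0.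
have e (F1 q1 : nat -> 'M[A]_n) L1 M1 :
   \sum_(a < k.+1) (F1 a + if (a : nat) == 0%N then L1 else 0) *m (q1 (k - a)%N + if (k - a == 0)%N then M1 else 0)
   = \sum_(a < k.+1) F1 a *m q1 (k - a)%N + F1 k *m M1 + L1 *m q1 k
     + L1 *m (if k == 0%N then M1 else 0).
  rewrite -(dr M1 F1) -(dl L1 q1) -(dl L1 (fun b => if b == 0%N then M1 else 0)) -!big_split /=.
  by apply: eq_bigr => a _; rewrite mulmxDl !mulmxDr !addrA.
rewrite !e mulmx1 mul1mx.
have -> : L *m (if k == 0%N then 1%:M else 0) = 1%:M *m (if k == 0%N then L else 0).
  by case: ifP => _; rewrite ?mulmx1 ?mul1mx ?mulmx0.
have zz (V : zmodType) (S1 F1 l1 c S2 q1 p1 : V) :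
    S1 + F1 + l1 + c - (S2 + q1 + p1 + c) = F1 + S1 - S2 + (l1 - q1 - p1).
  rewrite opprD addrACA subrr addr0 !opprD !addrA [S1 + F1]addrC.
  by congr (_ - _ - _); rewrite addrAC.
exact: zz.
Qed.

Definition nonres (R : realType) n (lam : 'rV[R[i]]_n) (k : nat) (i j : 'I_n) :=
  k%:R - (lam 0 i - lam 0 j) != 0.

(** At a resonant entry the unknown is the entry of the normal form, which occurs with coefficient
    1; both kinds of unknown can thus be stored in a single [X]. *)
Definition nf_den (R : realType) n (lam : 'rV[R[i]]_n) (k : nat) (i j : 'I_n) :=
  if nonres lam k i j then k%:R - (lam 0 i - lam 0 j) else 1.

(** At a nonresonant entry [p k] vanishes and $k-(\lambda_i-\lambda_j)$ is the coefficient of [q k];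
    at a resonant entry [q k] vanishes and [p k] takes up the whole of [nf_rhs]. *)
Lemma nf_gauge (R : realType) r n (lam : 'rV[R[i]]_n)
    (F X : nat -> 'rV[R[i]]_r -> 'M[R[i]]_n) k t :
  (forall i j, nf_den lam k i j * X k t i j = nf_rhs (nonres lam) F X k t i j) ->
  let q a := mxmask (nonres lam a) (X a t) in
  let p a := mxmask (fun i j => ~~ nonres lam a i j) (X a t) in
  k%:R *: (q k + if k == 0%N then 1%:M else 0) =
  \sum_(a < k.+1) (F a t + if (a : nat) == 0%N then diag_mx lam else 0) *m
     (q (k - a)%N + if (k - a == 0)%N then 1%:M else 0)
  - \sum_(a < k.+1) (q a + if (a : nat) == 0%N then 1%:M else 0) *m
     (p (k - a)%N + if (k - a == 0)%N then diag_mx lam else 0).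
Proof.
move=> eX q p; rewrite (nf_expand k (diag_mx lam) (fun a => F a t) q p).
rewrite -[X in _ = X + _]/(nf_rhs (nonres lam) F X k t).
have -> : k%:R *: (q k + if k == 0%N then 1%:M else 0) = k%:R *: q k.
  by case: eqP => [->|_]; rewrite ?scale0r ?addr0.
apply/matrixP => i j; rewrite [RHS]mxE -eX !mxBE mul_diag_mx mul_mx_diag !mxE /nf_den.
case: ifP => Bk /=; first by rewrite subr0; ring.
by move/negbT: Bk; rewrite negbK => /eqP; rewrite !mulr0 mul1r mul0r subrr sub0r subrr.
Qed.

(* Normal form of z dY/dz = C(z) Y, C = \sum_k C_k z^k: a gauge transformation Q
   leading to N = \sum_k N_k z^k with N_k carried by the entries (i, j) such that
   lam_i - lam_j = k, lam being the spectrum of C_0(t0). *)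
Lemma normal_form (R : realType) r n (t0 : 'rV[R[i]]_r) rho K
    (C : nat -> 'rV[R[i]]_r -> 'M[R[i]]_n) :
  0 < rho -> 0 <= K -> (forall k, mxwiener t0 rho (K ^+ k.+1) (C k)) ->
  exists (T : 'M[R[i]]_n) (lam : 'rV[R[i]]_n) (rho' K' s sig : R)
    (Q N : nat -> 'rV[R[i]]_r -> 'M[R[i]]_n),
  [/\ T \in unitmx, 0 < rho' /\ rho' <= rho, 0 <= K',
    (forall k, mxwiener t0 rho' (K' ^+ k.+1) (Q k)) &
    (forall k, mxwiener t0 rho' (K' ^+ k.+1) (N k))] /\
  [/\ (forall k t, pdisc t0 rho' t -> k%:R *: Q k t =
        \sum_(a < k.+1) (invmx T *m C a t *m T) *m Q (k - a)%N t
        - \sum_(a < k.+1) Q a t *m N (k - a)%N t),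
    (forall k t i j, N k t i j != 0 -> lam 0 i - lam 0 j = k%:R),
    0 < sig, n%:R * s <= 4^-1 &
    forall k t, pdisc t0 rho' t -> forall i j,
      normc ((Q k t - if k == 0%N then 1%:M else 0) i j) <= s / sig ^+ k].
Proof.
move=> r0 K0 hC.
have [lam hlam] := trig_small (C 0%N t0).
have /choice[kf hkf] (ij : 'I_n * 'I_n) : exists b : R, 0 <= b /\
   forall k, normc (k%:R - (lam 0 ij.1 - lam 0 ij.2))^-1 <= b.
  by have [b b0 hb] := natr_sub_inv_bound (lam 0 ij.1 - lam 0 ij.2); exists b.
(* One bound for all the inverse denominators; the 1 covers the resonant entries. *)
pose kap : R := 1 + \sum_ij kf ij.
have kf0 ij : 0 <= kf ij by have [] := hkf ij.
have kap1 : 1 <= kap by rewrite lerDl sumr_ge0.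
have kap0 : 0 < kap by apply: lt_le_trans kap1.
pose B := nonres lam; pose dl := nf_den lam.
have dl0 k i j : dl k i j != 0 by rewrite /dl /nf_den; case: ifP => // _; exact: oner_neq0.
have hdl k i j : normc (dl k i j)^-1 <= kap.
  rewrite /dl /nf_den; case: ifP => _; last by rewrite invr1 normc1.
  have [_ h] := hkf (i, j); apply: le_trans (h k) _.
  by rewrite /kap (bigD1 (i, j)) //= addrCA lerDl addr_ge0 // sumr_ge0.
have n1 : 1 <= n.+1%:R :> R by rewrite ler1n.
have n0 : 0 < n.+1%:R :> R by rewrite ltr0n.
have nn : n%:R <= n.+1%:R :> R by rewrite ler_nat.
(* [s] and [Phi] are chosen so that $\kappa\Phi(1+ns)\le s/2$ and $\kappa ns^2\le s/2$, which makes
   the ball of radius [s] stable; [n.+1] avoids a division by 0 when [n = 0]. *)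
pose s : R := (4 * kap * n.+1%:R)^-1.
have s0 : 0 < s by rewrite invr_gt0 !mulr_gt0.
have sE : 4 * kap * n.+1%:R * s = 1 by rewrite divff // !mulf_neq0 // gt_eqF.
pose Phi := s / (2 * kap * n.+1%:R).
have Phi0 : 0 < Phi by rewrite divr_gt0 // !mulr_gt0.
have PhiE : 2 * kap * n.+1%:R * Phi = s by rewrite mulrC divfK // !mulf_neq0 // gt_eqF.
have ns : n%:R * s <= 4^-1.
  apply: (@le_trans _ _ (n.+1%:R * s)); first by rewrite ler_wpM2r // ltW.
  have : 1 * (n.+1%:R * s) <= kap * (n.+1%:R * s) by rewrite ler_wpM2r // mulr_ge0 // ltW.
  have : 4 * (kap * (n.+1%:R * s)) = 1 by rewrite !mulrA.
  lra.
have s1 : s <= 1.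
  have : 1 * s <= kap * n.+1%:R * s.
    rewrite ler_wpM2r ?(ltW s0) //; apply: (@le_trans _ _ (1 * 1)); first by rewrite mulr1.
    by apply: ler_pM.
  have : 4 * (kap * n.+1%:R * s) = 1 by rewrite !mulrA.
  lra.
have hs : kap * (Phi + n%:R * (Phi * s) + n%:R * (s * s)) <= s.
  have h1 : kap * (Phi + n%:R * (Phi * s)) <= s / 2.
    have -> : s / 2 = kap * (n.+1%:R * Phi) by rewrite -PhiE; field.
    rewrite ler_wpM2l ?(ltW kap0) // -natr1 mulrDl mul1r addrC lerD2r mulrCA.
    rewrite [leRHS]mulrC; apply: ler_wpM2l; first exact: ltW.
    by rewrite ler_piMr.
  have h2 : kap * (n%:R * (s * s)) <= s / 2.
    have -> : kap * (n%:R * (s * s)) = (kap * n%:R * s) * s by ring.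
    have : kap * n%:R * s <= kap * n.+1%:R * s.
      by rewrite ler_wpM2r ?(ltW s0) // ler_wpM2l // ltW.
    have : 4 * (kap * n.+1%:R * s) = 1 by rewrite !mulrA.
    move=> h3 h4; rewrite mulrC ler_wpM2l ?(ltW s0) //; lra.
  by rewrite mulrDr; lra.
(* The budget [Phi] is spent as follows: a quarter on $T^{-1}C_0(t_0)T-\mathrm{diag}(\lambda)$, a
   quarter on the variation of $C_0$ over the polydisc of radius [rho'], and a half on the terms of
   positive degree, through the weight [sig]. *)
have [T [uT hT]] := hlam (Phi / 4) (divr_gt0 Phi0 (ltr0Sn _ 3)).
have [b1 b10 hb1] := matrix_bound T; have [b2 b20 hb2] := matrix_bound (invmx T).
pose b := 1 + b1 + b2.
have hbT i j : normc (T i j) <= b by apply: le_trans (hb1 i j) _; rewrite /b; lra.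
have hbT' i j : normc (invmx T i j) <= b by apply: le_trans (hb2 i j) _; rewrite /b; lra.
pose G := n%:R * (n%:R * b * b).
have G0 : 0 <= G by rewrite /G !mulr_ge0 // /b; lra.
pose rho' := Num.min rho (rho * (Phi / 4) / (G * K + 1)).
have GK : 0 <= G * K by rewrite mulr_ge0.
have GK1 : 0 < G * K + 1 by rewrite ltr_wpDl.
have r'0 : 0 < rho' by rewrite lt_min r0 divr_gt0 // mulr_gt0 // divr_gt0.
have r'r : rho' <= rho by rewrite ge_min lexx.
have hr' : G * (K * (rho' / rho)) <= Phi / 4.
  have : rho' <= rho * (Phi / 4) / (G * K + 1) by rewrite ge_min lexx orbT.
  rewrite ler_pdivlMr // => h.
  rewrite (_ : G * (K * (rho' / rho)) = (G * K * rho') / rho); last by ring.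
  rewrite ler_pdivrMr // mulrC [Phi / 4 * rho]mulrC; apply: le_trans h.
  by rewrite ler_wpM2l ?(ltW r'0) // lerDl.
pose F k t := invmx T *m C k t *m T - if k == 0%N then diag_mx lam else 0.
pose phi k := if k is 0 then Phi / 2 else G * K ^+ k.+1.
have phi0 k : 0 <= phi k.
  case: k => [|k]; rewrite /phi; first by rewrite divr_ge0 // ltW.
  by rewrite mulr_ge0 // exprn_ge0.
have hF k : mxwiener t0 rho' (phi k) (F k).
  case: k => [|k]; last first.
    have := mxwiener_conj r'0 hbT hbT' (mxwiener_shrink (ltW r'0) r'r (hC k.+1)).
    have -> : n%:R * (n%:R * (b * K ^+ k.+2) * b) = G * K ^+ k.+2 by rewrite /G; ring.
    by apply: mxwiener_ext => t _; rewrite /F subr0.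
  have := mxwiener_conj r'0 hbT hbT' (mxwiener_schwarz r'0 r'r (hC 0%N)).
  have -> : n%:R * (n%:R * (b * (K ^+ 1 * (rho' / rho))) * b) = G * (K * (rho' / rho)).
    by rewrite /G expr1; ring.
  move=> h; have h2 := mxwiener_const t0 r'0 hT.
  have h3 : Phi / 4 + G * (K * (rho' / rho)) <= phi 0%N by rewrite /phi; lra.
  apply: (mxwiener_le h3); apply: mxwiener_ext (mxwiener_add h2 h) => t _.
  by rewrite /F /= mulmxBr mulmxBl addrC addrA subrK.
(* The first bound gives the positive degrees a geometric decay of ratio 1/2, the second makes their
   first term at most $\Phi/4$. *)
pose sig := Num.min (2 * K + 1)^-1 (Phi / 4 / (G * K * K + 1)).
have K21 : 0 < 2 * K + 1 by rewrite ltr_wpDl // mulr_ge0.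
have GKK : 0 <= G * K * K by rewrite mulr_ge0.
have GKK1 : 0 < G * K * K + 1 by rewrite ltr_wpDl.
have sig0 : 0 < sig.
  by rewrite lt_min invr_gt0 K21 /=; apply: divr_gt0 => //; apply: divr_gt0.
have sK : sig * K <= 2^-1.
  have : sig <= (2 * K + 1)^-1 by rewrite ge_min lexx.
  rewrite -[_^-1]mul1r ler_pdivlMr // => h; lra.
have hPhi N : \sum_(0 <= k < N) sig ^+ k * phi k <= Phi.
  case: N => [|N]; first by rewrite big_geq // ltW.
  rewrite big_nat_recl // expr0 mul1r /= big_mkord.
  have hk (k : 'I_N) : sig ^+ k.+1 * (G * K ^+ k.+2) <= (sig * (G * K * K)) * 2^-1 ^+ k.
    have -> : sig ^+ k.+1 * (G * K ^+ k.+2) = (sig * (G * K * K)) * (sig * K) ^+ k.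
      by rewrite exprMn !exprS; ring.
    apply: ler_wpM2l; first by rewrite mulr_ge0 // ltW.
    by rewrite lerXn2r ?nnegrE ?mulr_ge0 ?invr_ge0 // ltW.
  apply: (@le_trans _ _ (Phi / 2 + \sum_(k < N) (sig * (G * K * K)) * 2^-1 ^+ k)).
    by rewrite lerD2l; apply: ler_sum => k _; exact: hk.
  rewrite -mulr_sumr.
  have h1 : sig * (G * K * K) <= Phi / 4.
    have : sig <= Phi / 4 / (G * K * K + 1) by rewrite ge_min lexx orbT.
    rewrite ler_pdivlMr // => h; apply: le_trans h; rewrite ler_wpM2l ?lerDl //.
    exact: ltW.
  have : (sig * (G * K * K)) * (\sum_(k < N) 2^-1 ^+ k) <= Phi / 4 * 2.
    apply: ler_pM => //; first by rewrite mulr_ge0 // ltW.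
      by apply: sumr_ge0 => k _; rewrite exprn_ge0 // invr_ge0.
    exact: geo_half_le2.
  lra.
have [X [hX eX]] := nf_solution B r'0 (ltW kap0) sig0 (ltW s0) dl0 hdl phi0 hF hPhi hs.
pose q k t := mxmask (B k) (X k t).
pose p k t := mxmask (fun i j => ~~ B k i j) (X k t).
pose I0 k : 'M[R[i]]_n := if k == 0%N then 1%:M else 0.
pose L0 k : 'M[R[i]]_n := if k == 0%N then diag_mx lam else 0.
have [bl bl0 hbl] := matrix_bound (diag_mx lam).
pose K' := 2 + sig^-1 + bl.
have sgi0 : 0 < sig^-1 by rewrite invr_gt0.
have K'1 : 1 <= K' by rewrite /K'; lra.
have K'k k : s / sig ^+ k + (if k == 0%N then 1 + bl else 0) <= K' ^+ k.+1.
  case: k => [|k] /=; first by rewrite expr0 divr1 expr1 /K'; lra.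
  rewrite addr0; apply: (@le_trans _ _ (sig^-1 ^+ k.+1)).
    by rewrite exprVn ler_piMl // invr_ge0 exprn_ge0 // ltW.
  apply: (@le_trans _ _ (K' ^+ k.+1)).
    by rewrite lerXn2r ?nnegrE ?(ltW sgi0) //; rewrite /K'; lra.
  by rewrite ler_weXn2l.
exists T, lam, rho', K', s, sig, (fun k t => q k t + I0 k), (fun k t => p k t + L0 k).
split; split=> //.
- lra.
- move=> k; apply: mxwiener_le (K'k k) _; apply: mxwiener_add.
    exact: mxwiener_mask.
  apply: mxwiener_const => // i j; rewrite /I0; case: ifP => _; last by rewrite mxE normc0.
  rewrite mxE; case: (i == j); rewrite ?normc0 ?normc1; lra.
- move=> k; apply: mxwiener_le (K'k k) _; apply: mxwiener_add.
    exact: mxwiener_mask.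
  apply: mxwiener_const => // i j; rewrite /L0; case: ifP => _; last by rewrite mxE normc0.
  by have := hbl i j; lra.
- move=> k t ht.
  have FE a : invmx T *m C a t *m T = F a t + if a == 0%N then diag_mx lam else 0.
    by rewrite /F subrK.
  under eq_bigr do rewrite FE.
  exact: (nf_gauge (eX k t ht)).
- move=> k t i j; rewrite mxE mxE.
  case: ifP => [hB _|hB].
    by move: hB; rewrite /B /nonres negbK subr_eq0 => /eqP ->.
  rewrite add0r /L0; have [->|_] := eqVneq k 0%N; last by rewrite mxE eqxx.
  rewrite mxE; have [->|_] := eqVneq i j; first by rewrite subrr.
  by rewrite mulr0n eqxx.
- move=> k t ht i j; rewrite /I0 addrK mxE.
  case: ifP => _; first exact: (wiener_bound (ltW r'0) (hX k i j) ht).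
  by rewrite normc0 divr_ge0 ?exprn_ge0 // ltW.
Qed.

(** * Matrix power series in one variable *)

(** Where $|z|K\le1/2$ such a series is dominated by a geometric one of ratio 1/2; this is the usual
    smallness condition on [z] below. *)
Definition geo_bound (R : realType) n (c K : R) (a : nat -> 'M[R[i]]_n) :=
  [/\ 0 <= c, 0 < K & forall k i j, normc (a k i j) <= c * K ^+ k].

(* psum, lv and lc are, at a fixed t, the counterparts of the series of a Laurent
   series, of leval and of lcoef, in terms of z = x - alpha t. *)
Definition psum (R : realType) n (a : nat -> 'M[R[i]]_n) (z : R[i]) : 'M[R[i]]_n :=
  \matrix_(i, j) limn (series (fun k => a k i j * z ^+ k)).

Lemma geo_asum (R : realType) n c K (a : nat -> 'M[R[i]]_n) z i j :
  geo_bound c K a -> normc z * K <= 2^-1 ->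
  asum (fun k => a k i j * z ^+ k) (2 * c).
Proof.
move=> [c0 K0 ha] zK; apply: asum_nat => N.
rewrite mulrC; apply: le_trans (ler_wpM2l c0 (geo_half_le2 R N)).
rewrite big_mkord mulr_sumr; apply: ler_sum => k _; rewrite normcM normcX.
apply: le_trans (ler_wpM2r _ (ha k i j)) _; first by rewrite exprn_ge0 ?normc_ge0.
rewrite -mulrA -exprMn; apply: ler_wpM2l => //.
by rewrite lerXn2r ?nnegrE ?mulr_ge0 ?normc_ge0 ?invr_ge0 ?(ltW K0) // mulrC.
Qed.

Lemma psumP (R : realType) n c K (a : nat -> 'M[R[i]]_n) z i j :
  geo_bound c K a -> normc z * K <= 2^-1 ->
  hsum (fun k => a k i j * z ^+ k) (psum a z i j).
Proof.
move=> ha zK; have [s hs] := asum_hsum (geo_asum i j ha zK).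
by rewrite mxE (cvg_lim _ (hsum_series hs)).
Qed.

Lemma psum_bound (R : realType) n c K (a : nat -> 'M[R[i]]_n) z i j :
  geo_bound c K a -> normc z * K <= 2^-1 -> normc (psum a z i j) <= 2 * c.
Proof. by move=> ha zK; apply: hsum_norm (geo_asum i j ha zK) (psumP i j ha zK). Qed.

Lemma geo_bound_le (R : realType) n c c' K K' (a : nat -> 'M[R[i]]_n) :
  c <= c' -> K <= K' -> geo_bound c K a -> geo_bound c' K' a.
Proof.
move=> cc KK [c0 K0 ha]; split; [exact: le_trans cc|exact: lt_le_trans KK|].
move=> k i j; apply: le_trans (ha k i j) _; apply: ler_pM => //.
  by rewrite exprn_ge0 // ltW.
by rewrite lerXn2r ?nnegrE ?(ltW K0) // (le_trans (ltW K0)).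
Qed.

Definition mconv (R : realType) n (a b : nat -> 'M[R[i]]_n) k :=
  \sum_(j < k.+1) a j *m b (k - j)%N.

(** The $k+1$ products in degree $k$ cost a factor $k+1\le2^k$, which doubles the rate; nested
    products therefore require a smaller [z]. *)
Lemma geo_bound_conv (R : realType) n c c' K (a b : nat -> 'M[R[i]]_n) :
  geo_bound c K a -> geo_bound c' K b ->
  geo_bound (n%:R * (c * c')) (2 * K) (mconv a b).
Proof.
move=> [c0 K0 ha] [c'0 _ hb]; split; [by rewrite !mulr_ge0|by rewrite mulr_gt0|].
move=> k i j; rewrite /mconv summxE.
have hk (l : 'I_k.+1) : normc ((a l *m b (k - l)%N) i j) <= n%:R * (c * c') * K ^+ k.
  rewrite mxE; apply: le_trans (normc_sum _ _ _) _.
  apply: (@le_trans _ _ (\sum_(x < n) c * c' * K ^+ k)); last first.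
    by rewrite sumr_const card_ord -[leRHS]mulrA mulr_natl.
  apply: ler_sum => x _; rewrite normcM.
  have lk : (l <= k)%N by rewrite -ltnS.
  have -> : K ^+ k = K ^+ l * K ^+ (k - l) by rewrite -exprD subnKC.
  by rewrite mulrACA; apply: ler_pM; rewrite ?normc_ge0.
apply: le_trans (normc_sum _ _ _) _; apply: le_trans (ler_sum _ (fun l _ => hk l)) _.
rewrite sumr_const card_ord -[leLHS]mulr_natl exprMn [leRHS]mulrCA; apply: ler_wpM2r.
  by rewrite !mulr_ge0 // exprn_ge0 // ltW.
by rewrite -natrX ler_nat ltn_expl.
Qed.

(** The family of products over pairs is grouped along the antidiagonals, which are finite. *)
Lemma hsum_conv (R : realType) (a b : nat -> R[i]) M N s t :
  asum a M -> asum b N -> hsum a s -> hsum b t ->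
  hsum (fun k => \sum_(j < k.+1) a j * b (k - j)%N) (s * t).
Proof.
move=> ha hb hs ht; have [hab hst] := hsum_mul ha hb hs ht.
apply: (hsum_group (pi := fun p : nat * nat => (p.1 + p.2)%N) hab _ hst) => k.
pose l := [seq (j, (k - j)%N) | j <- iota 0 k.+1].
have ul : uniq l by rewrite map_inj_uniq ?iota_uniq // => ? ? [].
have := @hsum_fin _ _ (fun p : nat * nat => if (p.1 + p.2 == k)%N then a p.1 * b p.2 else 0) [fset p | p in l]%fset.
have -> : \sum_(j < k.+1) a j * b (k - j)%N = \sum_(p <- [fset p | p in l]%fset)
   (if (p.1 + p.2 == k)%N then a p.1 * b p.2 else 0).
  rewrite big_fset_seq // big_map -[iota 0 k.+1]/(index_iota 0 k.+1) big_mkord.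
  apply: eq_bigr => j _ /=; rewrite subnKC ?eqxx //.
  by rewrite -ltnS.
apply=> -[p q] pq; case: eqP => //= e; case/negP: pq.
have h : (p, q) \in l.
  by apply/mapP; exists p; [rewrite mem_iota add0n ltnS -e leq_addr|rewrite -e addKn].
by apply/imfsetP; exists (p, q).
Qed.

Lemma psum_conv (R : realType) n c c' K (a b : nat -> 'M[R[i]]_n) z :
  geo_bound c K a -> geo_bound c' K b -> normc z * (2 * K) <= 2^-1 ->
  psum (mconv a b) z = psum a z *m psum b z.
Proof.
move=> ha hb zK.
have zK' : normc z * K <= 2^-1.
  apply: le_trans zK; apply: ler_wpM2l; first exact: normc_ge0.
  by case: ha => _ K0 _; rewrite ler_pMl // ler1n.
apply/matrixP => i j; apply: hsum_unique (psumP i j (geo_bound_conv ha hb) zK) _.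
rewrite mxE.
have := hsum_big (index_enum 'I_n) (fun l => hsum_conv (geo_asum i l ha zK') (geo_asum l j hb zK')
  (psumP i l ha zK') (psumP l j hb zK')).
apply: hsum_ext => k; rewrite /mconv summxE exchange_big mulr_suml /=; apply: eq_bigr => l _.
have lk : (l <= k)%N by rewrite -ltnS.
rewrite mxE mulr_suml; apply: eq_bigr => x _.
have -> : z ^+ k = z ^+ l * z ^+ (k - l) by rewrite -exprD subnKC.
ring.
Qed.

Lemma psumD (R : realType) n c c' K (a b : nat -> 'M[R[i]]_n) z :
  geo_bound c K a -> geo_bound c' K b -> normc z * K <= 2^-1 ->
  psum (fun k => a k + b k) z = psum a z + psum b z.
Proof.
move=> ha hb zK; apply/matrixP => i j; rewrite mxE [RHS]mxE.
have h := hsumD (psumP i j ha zK) (psumP i j hb zK).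
apply: cvg_lim => //; apply: hsum_series; apply: hsum_ext h => k.
by rewrite mxE mulrDl.
Qed.

Lemma psumZ (R : realType) n c K (a : nat -> 'M[R[i]]_n) w z :
  geo_bound c K a -> normc z * K <= 2^-1 ->
  psum (fun k => w *: a k) z = w *: psum a z.
Proof.
move=> ha zK; apply/matrixP => i j; rewrite mxE [RHS]mxE.
have h := hsumZ w (psumP i j ha zK).
apply: cvg_lim => //; apply: hsum_series; apply: hsum_ext h => k.
by rewrite mxE mulrA.
Qed.

Lemma psum_mulmx (R : realType) n c K (a : nat -> 'M[R[i]]_n) M z :
  geo_bound c K a -> normc z * K <= 2^-1 ->
  psum (fun k => M *m a k) z = M *m psum a z.
Proof.
move=> ha zK; apply/matrixP => i j; rewrite mxE [RHS]mxE.
have h := hsum_big (index_enum 'I_n) (fun l => hsumZ (M i l) (psumP l j ha zK)).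
apply: cvg_lim => //; apply: hsum_series; apply: hsum_ext h => k.
by rewrite mxE mulr_suml; apply: eq_bigr => l _; rewrite mulrA.
Qed.

Lemma psum_const (R : realType) n (A : 'M[R[i]]_n) z :
  psum (fun k => if k == 0%N then A else 0) z = A.
Proof.
apply/matrixP => i j; rewrite mxE; apply: cvg_lim => //; apply: hsum_series.
have := @hsum_fin _ _ (fun k => (if k == 0%N then A else 0) i j * z ^+ k) [fset 0%N]%fset.
rewrite big_seq_fset1 expr0 mulr1; apply => k; rewrite inE => /negbTE ->.
by rewrite mxE mul0r.
Qed.

Lemma geo_bound_shift (R : realType) n c K (a : nat -> 'M[R[i]]_n) :
  geo_bound c K a -> geo_bound (c * K) K (fun k => a k.+1).
Proof.
move=> [c0 K0 ha]; split=> // [|k i j]; first by rewrite mulr_ge0 // ltW.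
by rewrite -mulrA -exprS.
Qed.

Lemma geo_bound_nat (R : realType) n c K (a : nat -> 'M[R[i]]_n) :
  geo_bound c K a -> geo_bound c (2 * K) (fun k => k%:R *: a k).
Proof.
move=> [c0 K0 ha]; split=> // [|k i j]; first by rewrite mulr_gt0.
rewrite mxE normcM normc_nat exprMn mulrCA; apply: ler_pM => //; rewrite ?normc_ge0 //.
exact: natr_le_pow2.
Qed.

Lemma psum_shift (R : realType) n c K (a : nat -> 'M[R[i]]_n) z :
  geo_bound c K a -> normc z * K <= 2^-1 ->
  psum a z = a 0%N + z *: psum (fun k => a k.+1) z.
Proof.
move=> ha zK; apply/matrixP => i j; rewrite [RHS]mxE [X in _ + X]mxE.
have h1 := hsum_shift (geo_asum i j ha zK) (psumP i j ha zK).
have h2 := hsumZ z (psumP i j (geo_bound_shift ha) zK).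
have : z * psum (fun k => a k.+1) z i j = psum a z i j - a 0%N i j * z ^+ 0.
  apply: hsum_unique h2 _; apply: hsum_ext h1 => k.
  by rewrite exprS; ring.
by move=> ->; rewrite expr0 mulr1 addrC subrK.
Qed.

Definition dcoef (R : realType) n (a : nat -> 'M[R[i]]_n) k := k.+1%:R *: a k.+1.

Lemma geo_bound_dcoef (R : realType) n c K (a : nat -> 'M[R[i]]_n) :
  geo_bound c K a -> geo_bound (c * (2 * K)) (2 * K) (dcoef a).
Proof. by move=> /geo_bound_nat/geo_bound_shift. Qed.

(** [pow_taylor2] is applied to each term with $\sigma=1/(4K)$: then $|z|+\sigma\le1/(2K)$, and the
    majorants form a geometric series of ratio 1/2. *)
Lemma psum_taylor (R : realType) n c K (a : nat -> 'M[R[i]]_n) z s i j :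
  geo_bound c K a -> normc z * (4 * K) <= 1 -> normc s * (4 * K) <= 1 ->
  normc (psum a (z + s) i j - psum a z i j - s * psum (dcoef a) z i j) <=
  (4 * K * normc s) ^+ 2 * (2 * c).
Proof.
move=> ha zK sK; have [c0 K0 hab] := ha.
have zK2 : normc z * (2 * K) <= 2^-1 by lra.
have zK1 : normc z * K <= 2^-1.
  by have := normc_ge0 z => z0; have := mulr_ge0 z0 (ltW K0); lra.
have zsK : normc (z + s) * K <= 2^-1.
  apply: le_trans (ler_wpM2r (ltW K0) (normcD _ _)) _; lra.
have h1 := psumP i j ha zsK; have h2 := psumP i j ha zK1.
have h3 := psumP i j (geo_bound_dcoef ha) zK2.
(* The series of [dcoef a] without the shift of index, so that it can be combined with [h1] and
   [h2]; the additional term [k = 0] is 0. *)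
have h4 : hsum (fun k => s * (k%:R * a k i j * z ^+ k.-1)) (s * psum (dcoef a) z i j).
  have ha1 : asum (fun k => k%:R * a k i j * z ^+ k.-1) (2 * (c * (2 * K))).
    apply: asum_nat => -[|N]; first by rewrite big_geq // !mulr_ge0 // ltW.
    rewrite big_nat_recl // !mul0r normc0 add0r.
    have := geo_asum i j (geo_bound_dcoef ha) zK2 [fset k | k in iota 0 N]%fset.
    rewrite big_fset_seq ?iota_uniq // /index_iota subn0; apply: le_trans; apply: ler_sum => k _.
    by rewrite /dcoef mxE.
  have [s1 hs1] := asum_hsum ha1.
  apply: hsumZ; suff -> : psum (dcoef a) z i j = s1 by [].
  apply: hsum_unique h3 _; have := hsum_shift ha1 hs1.
  rewrite !mul0r subr0; apply: hsum_ext => k.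
  by rewrite /dcoef mxE.
have h := hsumD (hsumD h1 (hsumZ (-1) h2)) (hsumZ (-1) h4).
rewrite !mulN1r in h; apply: hsum_norm h.
apply: asum_nat => N; rewrite mulrA mulrC mulrA.
apply: (@le_trans _ _ (\sum_(0 <= k < N) (c * (4 * K * normc s) ^+ 2) * 2^-1 ^+ k)); last first.
  rewrite big_mkord -mulr_sumr; apply: ler_wpM2l (geo_half_le2 _ _).
  by rewrite mulr_ge0 // exprn_ge0 // !mulr_ge0 ?normc_ge0 // ltW.
apply: ler_sum => k _.
have K40 : 0 < (4 * K)^-1 by rewrite invr_gt0 mulr_gt0.
have sK' : normc s <= (4 * K)^-1 by rewrite -[_^-1]mul1r ler_pdivlMr ?mulr_gt0.
have zK' : normc z <= (4 * K)^-1 by rewrite -[_^-1]mul1r ler_pdivlMr ?mulr_gt0.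
rewrite (_ : _ + _ + _ = a k i j * ((z + s) ^+ k - z ^+ k - k%:R * s * z ^+ k.-1)); last by ring.
rewrite normcM; apply: le_trans (ler_pM _ _ (hab k i j) (pow_taylor2 z k K40 sK')) _; rewrite ?normc_ge0 //.
rewrite (_ : normc s / (4 * K)^-1 = 4 * K * normc s); last by rewrite invrK mulrC.
rewrite mulrACA; apply: ler_wpM2l.
  by rewrite mulr_ge0 // exprn_ge0 // !mulr_ge0 ?normc_ge0 // ltW.
apply: (@le_trans _ _ (K ^+ k * ((2 * K)^-1) ^+ k)); last first.
  by rewrite -exprMn invfM mulrCA mulfV ?gt_eqF // mulr1.
apply: ler_wpM2l; first by rewrite exprn_ge0 // ltW.
apply: (@le_trans _ _ ((normc z + (4 * K)^-1) ^+ k)).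
  rewrite -addrA gerDl -opprD oppr_le0 addr_ge0 ?mulr_ge0 ?exprn_ge0 ?normc_ge0 //.
  exact: ltW.
rewrite lerXn2r ?nnegrE ?addr_ge0 ?normc_ge0 ?invr_ge0 ?mulr_ge0 ?(ltW K0) ?(ltW K40) //.
rewrite (_ : (2 * K)^-1 = (4 * K)^-1 + (4 * K)^-1); last by field; rewrite gt_eqF.
by rewrite lerD2r.
Qed.

(** * Complex differentiation *)

Definition cnear (R : realType) (x : R[i]) (P : R[i] -> Prop) :=
  exists2 d : R, 0 < d & forall y, normc (y - x) < d -> P y.

(** [cnear] does not exclude the point [x], so this also forces [phi x = l]: it is continuity at
    [x]. *)
Definition clim (R : realType) (phi : R[i] -> R[i]) (x l : R[i]) :=
  forall e : R, 0 < e -> cnear x (fun y => normc (phi y - l) < e).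

Lemma cnearW (R : realType) (x : R[i]) (P Q : R[i] -> Prop) :
  (forall y, P y -> Q y) -> cnear x P -> cnear x Q.
Proof. by move=> PQ [d d0 h]; exists d => // y /h/PQ. Qed.

Lemma cnearT (R : realType) (x : R[i]) (P : R[i] -> Prop) : (forall y, P y) -> cnear x P.
Proof. by move=> h; exists 1. Qed.

Lemma cnearI (R : realType) (x : R[i]) (P Q : R[i] -> Prop) :
  cnear x P -> cnear x Q -> cnear x (fun y => P y /\ Q y).
Proof.
move=> [d d0 h] [e e0 k]; exists (Num.min d e) => [|y]; first by rewrite lt_min d0.
by rewrite lt_min => /andP[/h ? /k].
Qed.

Lemma cnear_pt (R : realType) (x : R[i]) (P : R[i] -> Prop) : cnear x P -> P x.
Proof. by move=> [d d0]; apply; rewrite subrr normc0. Qed.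

Lemma cnear_ne (R : realType) (x : R[i]) : x != 0 -> cnear x (fun y => y != 0).
Proof.
move=> x0; exists (normc x) => [|y]; first by rewrite normc_gt0.
by apply: contraTneq => ->; rewrite sub0r normcN ltxx.
Qed.

Lemma climP (R : realType) (phi : R[i] -> R[i]) (x l : R[i]) :
  clim phi x l <-> phi @ x --> l.
Proof.
split=> h.
  apply/(@cvgcP R _ (nbhs x)) => e e0; apply/nbhscP; exact: h.
by move=> e e0; apply/nbhscP; exact: ((@cvgcP R _ (nbhs x) _ phi l).1 h).
Qed.

Lemma clim_cst (R : realType) (x c : R[i]) : clim (fun=> c) x c.
Proof. by move=> e e0; apply: cnearT => y; rewrite subrr normc0. Qed.

Lemma clim_id (R : realType) (x : R[i]) : clim id x x.
Proof. by move=> e e0; exists e. Qed.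

Lemma climD (R : realType) (f g : R[i] -> R[i]) (x a b : R[i]) :
  clim f x a -> clim g x b -> clim (fun y => f y + g y) x (a + b).
Proof.
move=> /climP hf /climP hg; apply/climP.
exact: (@cvgD _ _ _ (nbhs x) _ _ _ _ _ hf hg).
Qed.

Lemma climM (R : realType) (f g : R[i] -> R[i]) (x a b : R[i]) :
  clim f x a -> clim g x b -> clim (fun y => f y * g y) x (a * b).
Proof.
move=> /climP hf /climP hg; apply/climP.
exact: (@cvgM _ _ (nbhs x) _ _ _ _ _ hf hg).
Qed.

Lemma climV (R : realType) (f : R[i] -> R[i]) (x a : R[i]) : a != 0 ->
  clim f x a -> clim (fun y => (f y)^-1) x a^-1.
Proof.
move=> a0 /climP hf; apply/climP; exact: (@cvgV _ _ (nbhs x) _ f a a0 hf).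
Qed.

Lemma clim_comp (R : realType) (f g : R[i] -> R[i]) x a b :
  clim g x a -> clim f a b -> clim (fun y => f (g y)) x b.
Proof.
by move=> hg hf e e0; have [d d0 h] := hf e e0; apply: cnearW (hg d d0) => y /h.
Qed.

Lemma clim_near (R : realType) (f g : R[i] -> R[i]) x a :
  cnear x (fun y => f y = g y) -> clim g x a -> clim f x a.
Proof. by move=> fg hg e e0; apply: cnearW (cnearI fg (hg e e0)) => y [->]. Qed.

(** Carathéodory's form of the derivative: [phi] is the difference quotient completed by [d] at [x].
    Product and chain rules become algebra, without any division by $y-x$. *)
Definition cderiv (R : realType) (g : R[i] -> R[i]) (x d : R[i]) :=
  exists2 phi : R[i] -> R[i], clim phi x d & cnear x (fun y => g y = g x + (y - x) * phi y).

Lemma cderiv_cont (R : realType) (g : R[i] -> R[i]) x d : cderiv g x d -> clim g x (g x).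
Proof.
move=> [phi hphi hg]; apply: clim_near hg _.
have := climD (clim_cst x (g x)) (climM (climD (clim_id x) (clim_cst x (- x))) hphi).
by rewrite subrr mul0r addr0.
Qed.

Lemma cderiv_near (R : realType) (f g : R[i] -> R[i]) x d :
  cnear x (fun y => f y = g y) -> cderiv g x d -> cderiv f x d.
Proof.
move=> fg [phi hphi hg]; exists phi => //; have fgx := cnear_pt fg.
by apply: cnearW (cnearI fg hg) => y [-> ->]; rewrite fgx.
Qed.

Lemma cderiv_ext (R : realType) (f g : R[i] -> R[i]) x d :
  f =1 g -> cderiv g x d -> cderiv f x d.
Proof. by move=> fg; apply: cderiv_near; apply: cnearT. Qed.

Lemma cderiv_cst (R : realType) (c x : R[i]) : cderiv (fun=> c) x 0.
Proof. by exists (fun=> 0); [exact: clim_cst|apply: cnearT => y; rewrite mulr0 addr0]. Qed.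

Lemma cderiv_id (R : realType) (x : R[i]) : cderiv id x 1.
Proof.
by exists (fun=> 1); [exact: clim_cst|apply: cnearT => y; rewrite mulr1 addrC subrK].
Qed.

Lemma cderivD (R : realType) (f g : R[i] -> R[i]) x d e :
  cderiv f x d -> cderiv g x e -> cderiv (fun y => f y + g y) x (d + e).
Proof.
move=> [phi hphi hf] [psi hpsi hg]; exists (fun y => phi y + psi y); first exact: climD.
by apply: cnearW (cnearI hf hg) => y [-> ->]; ring.
Qed.

Lemma cderivM (R : realType) (f g : R[i] -> R[i]) x d e :
  cderiv f x d -> cderiv g x e -> cderiv (fun y => f y * g y) x (d * g x + f x * e).
Proof.
move=> [phi hphi hf] hg0; have [psi hpsi hg] := hg0.
exists (fun y => phi y * g y + f x * psi y).
  exact: climD (climM hphi (cderiv_cont hg0)) (climM (clim_cst _ _) hpsi).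
by apply: cnearW (cnearI hf hg) => y [-> ->]; ring.
Qed.

Lemma cderivZ (R : realType) (g : R[i] -> R[i]) c x d :
  cderiv g x d -> cderiv (fun y => c * g y) x (c * d).
Proof. by move=> h; have := cderivM (cderiv_cst c x) h; rewrite mul0r add0r. Qed.

Lemma cderivB (R : realType) (f g : R[i] -> R[i]) x d e :
  cderiv f x d -> cderiv g x e -> cderiv (fun y => f y - g y) x (d - e).
Proof.
move=> hf hg; have := cderivD hf (cderivZ (-1) hg); rewrite mulN1r.
by apply: cderiv_ext => y; rewrite mulN1r.
Qed.

Lemma cderiv_sum (R : realType) (I : Type) (l : seq I) (f : I -> R[i] -> R[i]) x (d : I -> R[i]) :
  (forall k, cderiv (f k) x (d k)) ->
  cderiv (fun y => \sum_(k <- l) f k y) x (\sum_(k <- l) d k).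
Proof.
move=> h; elim: l => [|k l IH].
  by rewrite big_nil; apply: cderiv_ext (cderiv_cst 0 x) => y; rewrite big_nil.
by rewrite big_cons; apply: cderiv_ext (cderivD (h k) IH) => y; rewrite big_cons.
Qed.

Lemma cderiv_comp (R : realType) (f g : R[i] -> R[i]) x d e :
  cderiv g x d -> cderiv f (g x) e -> cderiv (fun y => f (g y)) x (d * e).
Proof.
move=> hg0 [phi hphi [r r0 hf]]; have gc := cderiv_cont hg0; have [psi hpsi hg] := hg0.
exists (fun y => psi y * phi (g y)); first exact: climM hpsi (clim_comp gc hphi).
apply: cnearW (cnearI hg (gc r r0)) => y [e1 /hf ->].
by congr (_ + _); rewrite {1}e1; ring.
Qed.

Lemma cderiv_unique (R : realType) (g : R[i] -> R[i]) x d e :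
  cderiv g x d -> cderiv g x e -> d = e.
Proof.
move=> [phi hphi hg] [psi hpsi hg'].
apply/eqP; rewrite -subr_eq0 -normc_eq0; apply/negP => /negP de.
have de0 : 0 < normc (d - e) / 2 by rewrite divr_gt0 // lt_neqAle eq_sym de normc_ge0.
have [r r0 hr] := cnearI (cnearI hg hg') (cnearI (hphi _ de0) (hpsi _ de0)).
have n2 : normc (x + (r / 2)%:C - x) = r / 2.
  by rewrite addrC addKr normc_ler0 // ltW // divr_gt0.
have [|[e1 e2] [h1 h2]] := hr (x + (r / 2)%:C); first by rewrite n2; lra.
have e3 : phi (x + (r / 2)%:C) = psi (x + (r / 2)%:C).
  have := e2; rewrite e1 => /addrI; apply: mulfI.
  by rewrite -normc_eq0 n2 gt_eqF // divr_gt0.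
rewrite -e3 in h2.
have := normcD (d - phi (x + (r / 2)%:C)) (phi (x + (r / 2)%:C) - e).
rewrite addrA subrK [X in _ <= X + _]normcB; lra.
Qed.

Lemma cderiv_inv (R : realType) (x : R[i]) : x != 0 -> cderiv (fun y => y^-1) x (- (x ^- 2)).
Proof.
move=> x0; exists (fun y => - x^-1 * y^-1).
  have -> : - x ^- 2 = - x^-1 * x^-1 by field.
  exact: climM (clim_cst _ _) (climV x0 (clim_id x)).
by apply: cnearW (cnear_ne x0) => y y0; field; rewrite x0 y0.
Qed.

Lemma cderiv_exp (R : realType) (x : R[i]) k : cderiv (fun y => y ^+ k) x (k%:R * x ^+ k.-1).
Proof.
elim: k => [|k IH]; first by rewrite mul0r; exact: cderiv_cst.
have := cderivM (cderiv_id x) IH.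
have -> : 1 * x ^+ k + id x * (k%:R * x ^+ k.-1) = k.+1%:R * x ^+ k.+1.-1.
  case: k {IH} => [|k] /=; first by rewrite expr0; ring.
  by rewrite -natr1 exprS; ring.
by apply: cderiv_ext => y; rewrite exprS.
Qed.

Lemma cderiv_expz (R : realType) (x : R[i]) (m : int) : x != 0 ->
  cderiv (fun y => y ^ m) x (m%:~R * x ^ (m - 1)).
Proof.
move=> x0; case: m => k.
  have := cderiv_exp x k; case: k => [|k]; first by rewrite !mul0r.
  by rewrite (_ : Posz k.+1 - 1 = k) // -addn1 PoszD addrK.
have := cderiv_comp (cderiv_inv x0) (cderiv_exp x^-1 k.+1).
have -> : - x ^- 2 * (k.+1%:R * x^-1 ^+ k.+1.-1) = (Negz k)%:~R * x ^ (Negz k - 1).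
  rewrite NegzE -opprD -PoszD addn1 -!exprnN mulrNz mulNr mulNr; congr (- _).
  by rewrite /= exprVn mulrCA -invfM -exprD add2n.
by apply: cderiv_ext => y; rewrite /= exprVn.
Qed.

Lemma cderiv_taylor (R : realType) (g : R[i] -> R[i]) (x d : R[i]) (rho C : R) : 0 < rho -> 0 <= C ->
  (forall s, normc s <= rho -> normc (g (x + s) - g x - s * d) <= C * normc s ^+ 2) ->
  cderiv g x d.
Proof.
move=> rho0 C0 h.
exists (fun y => if y == x then d else (g y - g x) / (y - x)); last first.
  apply: cnearT => y; have [->|yx] := eqVneq y x; first by rewrite subrr mul0r addr0.
  by rewrite mulrCA mulfV ?mulr1 ?subr_eq0 // addrC subrK.
move=> e e0; have C1 : 0 < C + 1 by rewrite ltr_wpDl.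
exists (Num.min rho (e / (C + 1))) => [|y]; first by rewrite lt_min rho0 divr_gt0.
rewrite lt_min ltr_pdivlMr // => /andP[/ltW yr ye].
case: (eqVneq y x) => [_|yx]; first by rewrite subrr normc0.
have yx0 : 0 < normc (y - x) by rewrite normc_gt0 subr_eq0.
have := h _ yr; rewrite [x + _]addrC subrK => h1.
rewrite (_ : _ - d = (g y - g x - (y - x) * d) / (y - x)); last first.
  by field; rewrite subr_eq0.
rewrite normcM normcV ltr_pdivrMr //; apply: le_lt_trans h1 _.
rewrite expr2 mulrA ltr_pM2r //; apply: le_lt_trans ye.
by rewrite mulrC; apply: ler_wpM2l; [exact: ltW|rewrite lerDl].
Qed.

Lemma psum_cderiv (R : realType) n c K (a : nat -> 'M[R[i]]_n) z i j :
  geo_bound c K a -> normc z * (4 * K) <= 1 ->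
  cderiv (fun y => psum a y i j) z (psum (dcoef a) z i j).
Proof.
move=> ha zK; have [c0 K0 _] := ha.
apply: (@cderiv_taylor _ _ _ _ (4 * K)^-1 ((4 * K) ^+ 2 * (2 * c))).
- by rewrite invr_gt0 mulr_gt0.
- by apply: mulr_ge0; [apply: exprn_ge0; rewrite mulr_ge0 // ltW|rewrite mulr_ge0].
move=> s hs; rewrite mulrAC -exprMn; apply: psum_taylor => //.
by rewrite -ler_pdivlMr ?mulr_gt0 // mul1r.
Qed.

Lemma is_derive_real (R : realType) (f : R -> R) (x d : R) :
  (forall e : R, 0 < e -> exists2 r : R, 0 < r &
    forall h, h != 0 -> `|h| < r -> `|f (h + x) - f x - h * d| <= e * `|h|) ->
  is_derive x 1 f d.
Proof.
move=> H.
have L : (fun h : R => h^-1 *: (f (h *: 1 + x) - f x)) @ 0^' --> d.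
  apply/cvgrPdist_le => e e0; have [r r0 hr] := H e e0.
  near=> h.
  have h0 : h != 0 by near: h; exact: nbhs_dnbhs_neq.
  have hlt : `|h| < r.
    near: h; apply: nbhs_dnbhs; near=> h; rewrite -[h]subr0; near: h.
    exact: cvgr_distC_lt.
  have := hr h h0 hlt; rewrite -ler_pdivrMr ?normr_gt0 // => h1.
  apply: le_trans h1; rewrite -normfV -normrM distrC.
  by rewrite -[h *: 1]/(h * 1) mulr1 -[_ *: _]/(_ * _) le_eqVlt; apply/orP; left; apply/eqP; congr `|_|; field.
by apply: DeriveDef; [apply/cvg_ex; exists d|apply: cvg_lim].
Unshelve. all: by end_near. Qed.

Lemma normc_conj (R : realType) (z : R[i]) : normc z^*%C = normc z.
Proof. by case: z => a b; rewrite /normc /= sqrrN. Qed.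

(** The mean value theorem is applied on $[0,1]$ to the real part of $\bar D\,g(x+s(y-x))$ with
    $D=g(y)-g(x)$: its derivative is 0 and its increment is $|D|^2$. *)
Lemma cderiv0_const (R : realType) (g : R[i] -> R[i]) (x y : R[i]) (r : R) :
  (forall w, normc (w - x) < r -> cderiv g w 0) -> normc (y - x) < r -> g y = g x.
Proof.
move=> H yr; apply/eqP; rewrite -subr_eq0; pose D := g y - g x; rewrite -/D.
pose f (s : R) := complex.Re (conjc D * g (x + s%:C * (y - x))).
have seg (s : R) : 0 <= s <= 1 -> normc (x + s%:C * (y - x) - x) < r.
  move=> /andP[s0 s1]; rewrite addrC addKr normcM normc_ler0 //.
  by apply: le_lt_trans yr; rewrite ler_piMl ?normc_ge0.
have df (s : R) : 0 <= s <= 1 -> is_derive s 1 f 0.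
  move=> hs; have [phi hphi [d d0 hg]] := H _ (seg s hs).
  apply: is_derive_real => e e0.
  pose B := normc D * normc (y - x) + 1.
  have B0 : 0 < B by rewrite ltr_wpDl // mulr_ge0 ?normc_ge0.
  have [d' d'0 hd'] := hphi (e / B) (divr_gt0 e0 B0).
  have Y0 : 0 < normc (y - x) + 1 by rewrite ltr_wpDl ?normc_ge0.
  exists (Num.min d d' / (normc (y - x) + 1)) => [|h h0 hh].
    by rewrite divr_gt0 // lt_min d0.
  have hw : normc (x + (h + s)%:C * (y - x) - (x + s%:C * (y - x))) < Num.min d d'.
    rewrite (_ : _ - _ = h%:C * (y - x)); last by rewrite rmorphD /=; ring.
    rewrite normcM normc_real; move: hh; rewrite ltr_pdivlMr //; apply: le_lt_trans.
    by rewrite ler_wpM2l // lerDl.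
  move: hw; rewrite lt_min => /andP[/hg e1 /hd' /ltW h1]; rewrite subr0 in h1.
  rewrite mulr0 subr0 /f -raddfB /= -mulrBr e1 addrC addKr.
  rewrite (_ : _ - _ = h%:C * (y - x)); last by rewrite rmorphD /=; ring.
  apply: le_trans (normc_Re _) _; rewrite !normcM normc_conj normc_real.
  move: h1 (normc_ge0 (phi (x + (h + s)%:C * (y - x)))); set P := normc (phi _) => h1 P0.
  have -> : normc D * (`|h| * normc (y - x) * P) = normc D * normc (y - x) * P * `|h| by ring.
  apply: ler_wpM2r => //; rewrite ler_pdivlMr // /B in h1; lra.
have [] := @MVT R f (fun=> 0) 0 1 ltr01.
- by move=> s /itvP hs; apply: df; rewrite !hs.
- by apply: derivable_within_continuous => s /itvP hs; apply: @ex_derive; apply: df; rewrite !hs.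
move=> s _; rewrite mul0r /f -raddfB /= mul1r mul0r addr0 [x + _]addrC subrK -mulrBr -/D.
rewrite -normc_eq0 -sqrf_eq0 normc_sqr; move: {f df} D => [a b] /= /eqP.
by rewrite mulNr opprK -!expr2.
Qed.

(** * Laurent series at a fixed parameter *)

Definition lv (R : realType) n (m : int) (a : nat -> 'M[R[i]]_n) (z : R[i]) :=
  z ^ m *: psum a z.

Lemma leval_cvg (R : realType) r n (alpha : 'rV[R[i]]_r -> R[i]) (f : laurent R r n) c K x t :
  geo_bound c K (fun k => lseq f k t) -> x != alpha t -> normc (x - alpha t) * K <= 2^-1 ->
  series (lterm alpha f x t) @ \oo --> lv (lord f) (fun k => lseq f k t) (x - alpha t).
Proof.
move=> ha xa zK; apply/cvg_mxcP => i j.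
have h := hsum_series (hsumZ ((x - alpha t) ^ lord f) (psumP i j ha zK)).
rewrite mxE; have -> // : (fun N => series (lterm alpha f x t) N i j) =
  series (fun k => (x - alpha t) ^ lord f * (lseq f k t i j * (x - alpha t) ^+ k)).
apply/funext => N; rewrite /series /= summxE; apply: eq_bigr => k _.
by rewrite mxE expfzDr ?subr_eq0 // -mulrA [lseq f k t i j * _]mulrC.
Qed.

Lemma leval_lv (R : realType) r n (alpha : 'rV[R[i]]_r -> R[i]) (f : laurent R r n) c K x t :
  geo_bound c K (fun k => lseq f k t) -> x != alpha t -> normc (x - alpha t) * K <= 2^-1 ->
  leval alpha f x t = lv (lord f) (fun k => lseq f k t) (x - alpha t).
Proof. by move=> h1 h2 h3; apply: cvg_lim => //; exact: leval_cvg h1 h2 h3. Qed.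

Lemma cvg_series_bounded (R : realType) (b : nat -> R[i]) (l : R[i]) :
  series b @ \oo --> l -> exists2 B, 0 <= B & forall k, normc (b k) <= B.
Proof.
move=> /cvgn_normcP/(_ 1 ltr01)[N hN].
have S0 : 0 <= \sum_(k < N) normc (b k) by apply: sumr_ge0 => k _; exact: normc_ge0.
exists (2 + \sum_(k < N) normc (b k)) => [|k]; first exact: addr_ge0.
have [kN|Nk] := ltnP k N.
  rewrite (bigD1 (Ordinal kN)) //= addrCA lerDl addr_ge0 //.
  by apply: sumr_ge0 => ? _; exact: normc_ge0.
have -> : b k = (series b k.+1 - l) - (series b k - l).
  by rewrite /series /= big_nat_recr //=; ring.
have h1 := hN k Nk; have h2 := hN k.+1 (leqW Nk).
have := normcD (series b k.+1 - l) (- (series b k - l)); rewrite normcN; lra.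
Qed.

(** Convergence at one point with $|x-\alpha(t)|=e/2$ bounds the terms there, hence bounds the
    coefficients geometrically. The constants depend on [t]. *)
Lemma in_gl_geo (R : realType) r n U (alpha : 'rV[R[i]]_r -> R[i]) (f : laurent R r n) t :
  in_gl U alpha f -> U t ->
  exists c K, geo_bound c K (fun k => lseq f k t).
Proof.
move=> [_ h] /h [_ /ltc_real_exists[e e0 ->]] {}h.
pose z : R[i] := (e / 2)%:C; have e20 : 0 < e / 2 by rewrite divr_gt0.
have nz : normc z = e / 2 by rewrite normc_ler0 // ltW.
have z0 : z != 0 by rewrite -normc_eq0 nz gt_eqF.
have /h/cvg_ex[l /cvg_mxcP hl] : 0 < `|alpha t + z - alpha t| < e%:C.
  rewrite addrC addKr normcE_norm nz ltcR e20 ltcR; lra.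
have hij ij : exists2 B, 0 <= B & forall k, normc (lterm alpha f (alpha t + z) t k ij.1 ij.2) <= B.
  apply: (@cvg_series_bounded _ _ (l ij.1 ij.2)); have := hl ij.1 ij.2.
  rewrite (_ : (fun _ => _) = series (fun k => lterm alpha f (alpha t + z) t k ij.1 ij.2)) //.
  by apply/funext => N; rewrite /series /= summxE.
have [B hB] := @choice _ _ (fun ij (B : R) => 0 <= B /\ forall k, normc (lterm alpha f (alpha t + z) t k ij.1 ij.2) <= B)
  (fun ij => let: ex_intro2 B h1 h2 := hij ij in ex_intro _ B (conj h1 h2)).
have S0 : 0 <= \sum_ij B ij by apply: sumr_ge0 => ij _; exact: (hB ij).1.
have nm0 : 0 < normc (z ^ lord f) by rewrite normc_gt0 expfz_neq0.
exists ((\sum_ij B ij) / normc (z ^ lord f)), (e / 2)^-1; split.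
- by rewrite divr_ge0 // ltW.
- by rewrite invr_gt0.
move=> k i j; have := (hB (i, j)).2 k.
rewrite mxE /= addrC addKr expfzDr // !normcM normcX nz => h1.
rewrite mulrAC ler_pdivlMr // exprVn ler_pdivlMr ?exprn_gt0 //.
rewrite [normc (lseq _ _ _ _ _) * _]mulrC mulrAC; apply: le_trans h1 _.
rewrite (bigD1 (i, j)) //= lerDl; apply: sumr_ge0 => ij _; exact: (hB ij).1.
Qed.

Definition lc (R : realType) n (m : int) (a : nat -> 'M[R[i]]_n) (i : int) :=
  if m <= i then a `|i - m|%N else 0.

Lemma psum_shiftn (R : realType) n c K (a : nat -> 'M[R[i]]_n) z d :
  geo_bound c K a -> normc z * K <= 2^-1 -> (forall k, (k < d)%N -> a k = 0) ->
  psum a z = z ^+ d *: psum (fun k => a (d + k)%N) z.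
Proof.
elim: d c a => [|d IH] c a ha zK h; first by rewrite scale1r.
rewrite (psum_shift ha zK) (h 0%N) // add0r (IH _ _ (geo_bound_shift ha)) //.
  by rewrite scalerA -exprS.
by move=> k kd; apply: h.
Qed.

Lemma psum_ext (R : realType) n (a b : nat -> 'M[R[i]]_n) z : a =1 b -> psum a z = psum b z.
Proof. by move=> ab; congr psum; apply/funext. Qed.

(** Representations with the same coefficients differ by leading zeros; $m'-m=d$ of them let a
    factor $z^d$ out of the series of lower order. *)
Lemma lv_lc (R : realType) n c c' K (a b : nat -> 'M[R[i]]_n) (m m' : int) z :
  geo_bound c K a -> geo_bound c' K b -> normc z * K <= 2^-1 -> z != 0 ->
  (forall i, lc m a i = lc m' b i) -> lv m a z = lv m' b z.
Proof.
wlog mm : m m' a b c c' / m <= m'.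
  move=> H ha hb zK z0 e; have [mm|/ltW mm] := leP m m'; first exact: H mm ha hb zK z0 e.
  by apply/esym; apply: (H m' m b a c' c mm hb ha zK z0) => i; rewrite e.
move=> ha hb zK z0 e.
have {}mm : m' = m + `|m' - m|%N by rewrite gez0_abs ?subr_ge0 // [RHS]addrC subrK.
move: `|m' - m|%N mm e => d -> e.
have a0 k : (k < d)%N -> a k = 0.
  move=> kd; have := e (m + k); rewrite /lc lerDl lerD2l !lez_nat leq0n (leqNgt d) kd /=.
  by rewrite addrC addKr.
rewrite /lv (psum_shiftn ha zK a0) expfzDr // -scalerA; congr (_ *: (_ *: _)).
apply: psum_ext => k; have := e (m + (d + k)%N).
rewrite /lc lerDl lerD2l !lez_nat leq0n leq_addr /= => h; rewrite -[LHS]/(a `|(d + k)%N : int|%N).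
by rewrite -[(d + k)%N : int](addKr m) addrC h opprD addrACA subrr add0r PoszD addrC addKr.
Qed.

Lemma lv_conv (R : realType) n c c' K (a b : nat -> 'M[R[i]]_n) (m m' : int) z :
  geo_bound c K a -> geo_bound c' K b -> normc z * (2 * K) <= 2^-1 -> z != 0 ->
  lv (m + m') (mconv a b) z = lv m a z *m lv m' b z.
Proof.
move=> ha hb zK z0.
by rewrite /lv (psum_conv ha hb zK) expfzDr // -scalemxAl -scalemxAr scalerA.
Qed.

Lemma lv_cderiv (R : realType) n c K (a : nat -> 'M[R[i]]_n) (m : int) z i j :
  geo_bound c K a -> normc z * (4 * K) <= 1 -> z != 0 ->
  cderiv (fun y => lv m a y i j) z
    (lv (m - 1) (fun k => (m + k%:Z)%:~R *: a k) z i j).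
Proof.
move=> ha zK z0; have [c0 K0 _] := ha.
have zK2 : normc z * (2 * K) <= 2^-1 by lra.
have zK1 : normc z * K <= 2^-1.
  by have := normc_ge0 z => z00; have := mulr_ge0 z00 (ltW K0); lra.
suff e : lv (m - 1) (fun k => (m + k%:Z)%:~R *: a k) z i j =
  m%:~R * z ^ (m - 1) * psum a z i j + z ^ m * psum (dcoef a) z i j.
  have h := cderivM (cderiv_expz m z0) (psum_cderiv i j ha zK).
  move: h; rewrite -{}e; apply: cderiv_ext => y; by rewrite mxE.
have e1 : psum (fun k => (m + k%:Z)%:~R *: a k) z = m%:~R *: psum a z + z *: psum (dcoef a) z.
    have -> : z *: psum (dcoef a) z = psum (fun k => k%:R *: a k) z.
      by rewrite (psum_shift (geo_bound_nat ha) zK2) scale0r add0r.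
    have hm : geo_bound (normc (m%:~R : R[i]) * c) (2 * K) (fun k => m%:~R *: a k).
      split=> [||k i' j']; rewrite ?mulr_ge0 ?normc_ge0 ?mulr_gt0 //.
      rewrite mxE normcM -mulrA; apply: ler_wpM2l; first exact: normc_ge0.
      have K2 : K <= 2 * K by rewrite ler_pMl // ler1n.
      by have [_ _] := geo_bound_le (lexx c) K2 ha; apply.
    rewrite -(psumZ _ ha zK1) -(psumD hm (geo_bound_nat ha) zK2).
    by apply: psum_ext => k; rewrite -scalerDl intrD.
rewrite /lv e1 !mxE mulrDr; congr (_ + _); first by ring.
have -> : z ^ m = z ^ (m - 1) * z by rewrite -[X in _ * X]expr1z -expfzDr // subrK.
by rewrite -mulrA.
Qed.

(** * Exponentials *)

Lemma exp_partial (R : realType) (x : R) N : 0 <= x ->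
  \sum_(k < N) k`!%:R^-1 * x ^+ k <= expR x.
Proof.
move=> x0; have -> : \sum_(k < N) k`!%:R^-1 * x ^+ k = series (exp_coeff x) N.
  by rewrite /series /= big_mkord; apply: eq_bigr => k _; rewrite mulrC.
apply: nondecreasing_cvgn_le (is_cvg_series_exp_coeff x) N.
apply/nondecreasing_seqP => k; rewrite /series /= big_nat_recr //= lerDl.
exact: exp_coeff_ge0.
Qed.

Lemma exp_term (R : realType) (x : R) k : 0 <= x -> k`!%:R^-1 * x ^+ k <= expR x.
Proof.
move=> x0; apply: le_trans (exp_partial k.+1 x0); rewrite big_ord_recr /= lerDr.
by apply: sumr_ge0 => i _; rewrite mulr_ge0 ?invr_ge0 ?exprn_ge0.
Qed.

Lemma normc_invfact (R : realType) k : normc (k`!%:R^-1 : R[i]) = k`!%:R^-1.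
Proof. by rewrite normcV normc_nat. Qed.

Lemma factc_neq0 (R : realType) k : (k`!%:R : R[i]) != 0.
Proof. by rewrite pnatr_eq0 -lt0n fact_gt0. Qed.

Lemma binomial_inv (R : realType) k j : (j <= k)%N ->
  k`!%:R^-1 * 'C(k, j)%:R = (j`!%:R^-1 * (k - j)`!%:R^-1 : R[i]).
Proof.
move=> jk; have h := congr1 (fun m : nat => m%:R : R[i]) (bin_fact jk).
rewrite !natrM in h; rewrite -h.
have c0 : ('C(k, j)%:R : R[i]) != 0 by rewrite pnatr_eq0 -lt0n bin_gt0.
by field; rewrite c0 !factc_neq0.
Qed.

Lemma cexp_conv (R : realType) (u v : R[i]) k :
  \sum_(j < k.+1) j`!%:R^-1 * u ^+ j * ((k - j)`!%:R^-1 * v ^+ (k - j)) =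
  k`!%:R^-1 * (u + v) ^+ k.
Proof.
rewrite [u + v]addrC exprDn mulr_sumr; apply: eq_bigr => j _.
have jk : (j <= k)%N by rewrite -ltnS.
rewrite -[X in _ = _ * X]mulr_natl [RHS]mulrA (binomial_inv R jk); ring.
Qed.

Lemma asum_exp (R : realType) (z : R[i]) : asum (fun k => k`!%:R^-1 * z ^+ k) (expR (normc z)).
Proof.
apply: asum_nat => N; rewrite big_mkord; apply: le_trans (exp_partial N (normc_ge0 z)).
by apply: ler_sum => k _; rewrite normcM normc_invfact normcX.
Qed.

Lemma cvg_Complex (R : realType) (u v : nat -> R) (p q : R) :
  u @ \oo --> p -> v @ \oo --> q -> (fun k => Complex (u k) (v k)) @ \oo --> Complex p q.
Proof.
move=> hu hv; apply/cvgcP => e e0; have e2 : 0 < e / 2 by rewrite divr_gt0.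
near=> k; apply: le_lt_trans (normc_le_ReIm _) _ => /=.
have h1 : `|u k - p| < e / 2 by near: k; exact: cvgr_distC_lt hu _ e2.
have h2 : `|v k - q| < e / 2 by near: k; exact: cvgr_distC_lt hv _ e2.
by lra.
Unshelve. all: by end_near. Qed.

Lemma cexp_real (R : realType) (a : R) : hsum (fun k => k`!%:R^-1 * a%:C ^+ k) (expR a)%:C.
Proof.
apply: hsum_of_series (asum_exp _) _.
have -> : series (fun k => k`!%:R^-1 * a%:C ^+ k) =
  (fun N => Complex (series (exp_coeff a) N) 0).
  apply/funext => N; rewrite -[RHS]/((series (exp_coeff a) N)%:C) /series /= rmorph_sum.
  by apply: eq_bigr => k _; rewrite rmorphM fmorphV rmorph_nat rmorphXn mulrC.
by apply: cvg_Complex; [exact: is_cvg_series_exp_coeff|exact: cvg_cst].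
Qed.

Lemma expi_double (R : realType) m : Complex 0 1 ^+ m.*2 = ((-1) ^+ m)%:C :> R[i].
Proof. by rewrite -mul2n exprM expr2 rmorphXn /=; congr (_ ^+ _); simpc. Qed.

Lemma expi_doubleS (R : realType) m : Complex 0 1 ^+ m.*2.+1 = Complex 0 ((-1) ^+ m) :> R[i].
Proof. by rewrite exprS expi_double; simpc. Qed.

Lemma cexp_imag (R : realType) (b : R) :
  hsum (fun k => k`!%:R^-1 * (Complex 0 b) ^+ k) (Complex (cos b) (sin b)).
Proof.
apply: hsum_of_series (asum_exp _) _.
have e k : (Complex 0 b) ^+ k = b%:C ^+ k * Complex 0 1 ^+ k.
  by rewrite -exprMn; congr (_ ^+ _); simpc.
have ib k : k`!%:R^-1 * (Complex 0 b) ^+ k = Complex (cos_coeff b k) (sin_coeff b k).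
  rewrite e -rmorphXn -[k`!%:R](rmorph_nat (real_complex R)) -fmorphV.
  rewrite -[k]odd_double_half; case: (odd k); rewrite /cos_coeff /sin_coeff /= ?add1n ?add0n /=.
    rewrite odd_double doubleK expi_doubleS; simpc; congr Complex; rewrite /=; ring.
  rewrite odd_double doubleK expi_double -!exprnP; simpc; congr Complex; rewrite /=; ring.
have -> : series (fun k => k`!%:R^-1 * (Complex 0 b) ^+ k) =
  (fun N => Complex (series (cos_coeff b) N) (series (sin_coeff b) N)).
  apply/funext => N; rewrite /series /=; elim: N => [|N IH]; first by rewrite !big_geq.
  by rewrite !big_nat_recr //= IH ib; simpc.
rewrite cos.unlock sin.unlock; apply: cvg_Complex.
  exact: is_cvg_series_cos_coeff.
exact: is_cvg_series_sin_coeff.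
Qed.

(** Links the definition by real functions with the power series: the series of the exponential at
    $a$ and at $ib$ are multiplied by Cauchy's rule. *)
Lemma cexp_hsum (R : realType) (z : R[i]) : hsum (fun k => k`!%:R^-1 * z ^+ k) (cexp z).
Proof.
case: z => a b /=.
have := hsum_conv (asum_exp _) (asum_exp _) (cexp_real a) (cexp_imag b).
have -> : (expR a)%:C * Complex (cos b) (sin b) = Complex (expR a * cos b) (expR a * sin b).
  by simpc.
by apply: hsum_ext => k; rewrite cexp_conv; congr (_ * _ ^+ _); simpc.
Qed.

(** The series is viewed as one of 1 x 1 matrices, so that [psum_cderiv] applies; its coefficients
    satisfy [geo_bound] at any rate, and [K] is taken small enough for the given [z]. *)
Lemma cderiv_cexp (R : realType) (z : R[i]) : cderiv (@cexp R) z (cexp z).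
Proof.
pose a (k : nat) : 'M[R[i]]_1 := (k`!%:R^-1)%:M.
have ha K : 0 < K -> geo_bound (expR K^-1) K a.
  move=> K0; split; [exact: expR_ge0|exact: K0|move=> k i j].
  rewrite !ord1 mxE eqxx normc_invfact -ler_pdivrMr ?exprn_gt0 // -exprVn.
  by rewrite exp_term // invr_ge0 ltW.
have pe w : psum a w 0 0 = cexp w.
  rewrite mxE; apply: cvg_lim => //; apply: hsum_series; apply: hsum_ext (cexp_hsum w) => k.
  by rewrite mxE eqxx.
pose K := (4 * (normc z + 1))^-1; have nz := normc_ge0 z.
have z1 : 0 < normc z + 1 by rewrite ltr_wpDl.
have K0 : 0 < K by rewrite invr_gt0 mulr_gt0.
have zK : normc z * (4 * K) <= 1.
  have -> : 4 * K = (normc z + 1)^-1 by rewrite /K; field; rewrite gt_eqF.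
  rewrite ler_pdivrMr // mul1r; lra.
have := psum_cderiv 0 0 (ha K K0) zK.
suff e : psum (dcoef a) z 0 0 = cexp z.
  by rewrite e; apply: cderiv_ext => w; rewrite pe.
rewrite -pe; congr (fun_of_matrix _ _ _); apply: psum_ext => k; apply/matrixP => i j.
rewrite !ord1 /dcoef !mxE eqxx /= factS natrM; field.
by rewrite factc_neq0 addrC natr1 pnatr_eq0.
Qed.

Definition exp_seq (R : realType) n (M : 'M[R[i]]_n) (k : nat) : 'M[R[i]]_n :=
  k`!%:R^-1 *: M ^+ k.

Lemma mxpow_bound (R : realType) n (M : 'M[R[i]]_n) (m : R) k i j :
  0 <= m -> (forall i j, normc (M i j) <= m) -> normc ((M ^+ k) i j) <= (n%:R * m) ^+ k.
Proof.
move=> m0 hM; elim: k i j => [|k IH] i j.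
  by rewrite !expr0 mxE; case: (i == j); rewrite ?normc0 // -[1%:R]/(1 : R[i]) normc1.
rewrite exprS mxE; apply: le_trans (normc_sum _ _ _) _.
apply: (@le_trans _ _ (\sum_(l < n) m * (n%:R * m) ^+ k)).
  by apply: ler_sum => l _; rewrite normcM; apply: ler_pM; rewrite ?normc_ge0.
by rewrite sumr_const card_ord -[leLHS]mulr_natl exprS mulrA.
Qed.

Lemma exp_seq_geo (R : realType) n (M : 'M[R[i]]_n) (m K : R) :
  0 <= m -> (forall i j, normc (M i j) <= m) -> 0 < K ->
  geo_bound (expR (n%:R * m / K)) K (exp_seq M).
Proof.
move=> m0 hM K0; split=> [||k i j]; [exact: expR_ge0|exact: K0|].
rewrite mxE normcM normc_invfact -ler_pdivrMr ?exprn_gt0 //.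
have nm0 : 0 <= n%:R * m / K by rewrite divr_ge0 ?mulr_ge0 // ltW.
apply: le_trans (exp_term k nm0); rewrite expr_div_n mulrA.
by rewrite ler_pM2r ?invr_gt0 ?exprn_gt0 // ler_wpM2l ?invr_ge0 // mxpow_bound.
Qed.

Lemma exp_seq_geoW (R : realType) n (M : 'M[R[i]]_n) (K : R) : 0 < K ->
  exists c, geo_bound c K (exp_seq M).
Proof.
move=> K0; have [b b0 hb] := matrix_bound M.
exists (expR (n%:R * b / K)); exact: exp_seq_geo.
Qed.

Lemma small_radius (R : realType) (z : R[i]) : exists2 K : R, 0 < K & normc z * (4 * K) <= 1.
Proof.
have nz := normc_ge0 z; have z1 : 0 < normc z + 1 by rewrite ltr_wpDl.
exists (4 * (normc z + 1))^-1; first by rewrite invr_gt0 mulr_gt0.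
have -> : 4 * (4 * (normc z + 1))^-1 = (normc z + 1)^-1 by field; rewrite gt_eqF.
rewrite ler_pdivrMr // mul1r; lra.
Qed.

Lemma mxpowZ (R : comNzRingType) n (M : 'M[R]_n) w k : (w *: M) ^+ k = w ^+ k *: M ^+ k.
Proof.
elim: k => [|k IH]; first by rewrite !expr0 scale1r.
by rewrite !exprS -!mulmxE IH -scalemxAl -scalemxAr scalerA.
Qed.

(** For fixed [M], the exponential of $wM$ is a power series in the single variable [w], to which
    the calculus of [psum] applies. *)
Lemma expm_psum (R : realType) n (M : 'M[R[i]]_n) w : expm (w *: M) = psum (exp_seq M) w.
Proof.
apply: cvg_lim => //; apply/cvg_mxcP => i j.
have [K K0 wK] := small_radius w; have [c hc] := exp_seq_geoW M K0.
have wK1 : normc w * K <= 2^-1.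
  have := normc_ge0 w => w0; have := mulr_ge0 w0 (ltW K0); lra.
have := hsum_series (psumP i j hc wK1).
have -> // : (fun N => series (fun k => k`!%:R^-1 *: (w *: M) ^+ k) N i j) =
  series (fun k => exp_seq M k i j * w ^+ k).
apply/funext => N; rewrite /series /= summxE; apply: eq_bigr => k _.
by rewrite /exp_seq mxpowZ scalerA !mxE; ring.
Qed.

Lemma expmE (R : realType) n (M : 'M[R[i]]_n) : expm M = psum (exp_seq M) 1.
Proof. by rewrite -expm_psum scale1r. Qed.

Lemma exp_seq_conv (R : realType) n (M N : 'M[R[i]]_n) k : M *m N = N *m M ->
  mconv (exp_seq M) (exp_seq N) k = exp_seq (M + N) k.
Proof.
move=> MN; have cNM : GRing.comm N M by rewrite /GRing.comm -!mulmxE MN.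
rewrite /exp_seq addrC (exprDn_comm _ cNM) scaler_sumr; apply: eq_bigr => j _.
have jk : (j <= k)%N by rewrite -ltnS.
rewrite -scalemxAl -scalemxAr scalerA -(binomial_inv R jk) -scalerA scaler_nat mulmxE.
by congr (_ *: (_ *+ _)); apply: commrX; apply: commr_sym; apply: commrX.
Qed.

Lemma expmD (R : realType) n (M N : 'M[R[i]]_n) : M *m N = N *m M ->
  expm (M + N) = expm M *m expm N.
Proof.
move=> MN; have K0 : 0 < 4^-1 :> R by rewrite invr_gt0.
have [c hc] := exp_seq_geoW M K0; have [c' hc'] := exp_seq_geoW N K0.
rewrite !expmE -(psum_conv hc hc'); last by rewrite normc1; lra.
by apply: psum_ext => k; rewrite exp_seq_conv.
Qed.

Lemma expm0 (R : realType) n : expm (0 : 'M[R[i]]_n) = 1%:M.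
Proof.
rewrite expmE -[RHS](psum_const _ 1); apply: psum_ext => -[|k].
  by rewrite /exp_seq expr0 fact0 invr1 scale1r.
by rewrite /exp_seq expr0n scaler0.
Qed.

Lemma expm_unit (R : realType) n (M : 'M[R[i]]_n) : expm M \in unitmx.
Proof.
have h : expm M *m expm (- M) = 1%:M by rewrite -expmD ?subrr ?expm0 // mulmxN mulNmx.
by case: (mulmx1_unit h) => hu _; exact: hu.
Qed.

Lemma expm_cderiv (R : realType) n (M : 'M[R[i]]_n) w i j :
  cderiv (fun v => expm (v *: M) i j) w ((M *m expm (w *: M)) i j).
Proof.
have [K K0 wK] := small_radius w; have [c hc] := exp_seq_geoW M K0.
have wK1 : normc w * K <= 2^-1.
  have := normc_ge0 w => w0; have := mulr_ge0 w0 (ltW K0); lra.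
have := psum_cderiv i j hc wK.
suff -> : psum (dcoef (exp_seq M)) w = M *m expm (w *: M).
  by apply: cderiv_ext => v; rewrite expm_psum.
rewrite expm_psum -(psum_mulmx M hc wK1); apply: psum_ext => k.
rewrite /dcoef /exp_seq scalerA -scalemxAr exprS mulmxE; congr (_ *: _).
by rewrite factS natrM invfM mulrA mulfV ?mul1r // pnatr_eq0.
Qed.

(** * Logarithms *)

(* ell u = log (1 + u) *)
Definition ell (R : realType) (u : R[i]) : R[i] :=
  psum (fun k => if k is k'.+1 then ((-1) ^+ k' / k%:R)%:M else 0 : 'M[R[i]]_1) u 0 0.

Lemma ell_geo (R : realType) :
  geo_bound 1 1 (fun k => if k is k'.+1 then ((-1) ^+ k' / k%:R)%:M else 0 : 'M[R[i]]_1).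
Proof.
split => // -[|k] i j; rewrite expr1n mul1r; first by rewrite mxE normc0.
rewrite !ord1 mxE eqxx mulr1n normcM normcX normcN normc1 expr1n mul1r normcV normc_nat.
by rewrite invf_le1 ?ltr0n // ler1n.
Qed.

Lemma ell0 (R : realType) : ell (0 : R[i]) = 0.
Proof.
by rewrite /ell (psum_shift (@ell_geo R)) ?normc0 ?mul0r ?invr_ge0 // scale0r addr0 mxE.
Qed.

(** The differentiated series is the alternating geometric one, whose sum satisfies
    $a(u)=1-u\,a(u)$. *)
Lemma cderiv_ell (R : realType) (u : R[i]) : normc u * 4 <= 1 -> cderiv (@ell R) u (1 + u)^-1.
Proof.
move=> hu; have u4 : normc u * (4 * 1) <= 1 by rewrite mulr1.
suff e : psum (dcoef (fun k => if k is k'.+1 then ((-1) ^+ k' / k%:R)%:M else 0 : 'M[R[i]]_1)) u 0 0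
   = (1 + u)^-1 by rewrite -e; exact: psum_cderiv (@ell_geo R) u4.
pose a k : 'M[R[i]]_1 := ((-1) ^+ k)%:M.
have ha : geo_bound 1 1 a.
  split => // k i j; rewrite !ord1 mxE eqxx mulr1n normcX normcN normc1 expr1n mul1r.
  exact: lexx.
have -> : psum (dcoef (fun k => if k is k'.+1 then ((-1) ^+ k' / k%:R)%:M else 0 : 'M[R[i]]_1)) u = psum a u.
  apply: psum_ext => k; apply/matrixP => i j; rewrite !ord1 /dcoef !mxE eqxx !mulr1n.
  by rewrite mulrC divfK // pnatr_eq0.
have u2 : normc u * 1 <= 2^-1 by lra.
have := psum_shift ha u2.
have -> : psum (fun k => a k.+1) u = - psum a u.
  rewrite -scaleN1r -(psumZ (-1) ha u2); apply: psum_ext => k.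
  by rewrite /a exprS -scale_scalar_mx.
move=> /matrixP/(_ 0 0); rewrite [RHS]mxE [X in _ + X]mxE [X in _ * X]mxE.
rewrite [X in X + _]mxE eqxx mulr1n expr0 => h.
have u1 : 1 + u != 0.
  rewrite addr_eq0; apply/negP => /eqP h1; have : normc u = 1 by rewrite -[u]opprK -h1 normcN normc1.
  by move=> h2; move: hu; rewrite h2 mul1r lern1.
apply: (mulIf u1); rewrite mulVf // mulrDr mulr1 {1}h; ring.
Qed.

(** * Polar coordinates, sectors and branches of the logarithm *)

Definition polar (R : realType) (rho th : R) : R[i] := Complex (rho * cos th) (rho * sin th).

Lemma normc_polar (R : realType) (rho th : R) : 0 <= rho -> normc (polar rho th) = rho.
Proof.
move=> r0; apply/eqP; rewrite -(@eqrXn2 _ 2) ?normc_ge0 // normc_sqr /= !exprMn -mulrDr.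
by rewrite cos2Dsin2 mulr1.
Qed.

Lemma polarD (R : realType) (rho rho' th th' : R) :
  polar rho th * polar rho' th' = polar (rho * rho') (th + th').
Proof. by rewrite /polar cosD sinD; simpc; congr Complex; ring. Qed.

(** For small $u$ the point $1+u$ lies in the right half-plane, where an argument is the arctangent
    of the imaginary part over the real part. *)
Lemma near1_polar (R : realType) (e : R) : 0 < e -> exists2 d : R, 0 < d &
  forall u : R[i], normc u < d -> exists rho th : R, [/\ 0 < rho, `|th| < e & 1 + u = polar rho th].
Proof.
move=> e0; have h : @atan R @ (0 : R) --> atan (0 : R) by exact: continuous_atan.
rewrite atan0 in h; move/cvgrPdist_lt: h => /(_ _ e0)/nbhs_normP[d /= d0 hd].
exists (Num.min (d / 2) 2^-1); first by rewrite lt_min divr_gt0 //= invr_gt0 ltr0n.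
move=> -[a b]; rewrite lt_min => /andP[u1 u2].
have ha := le_lt_trans (normc_Re (Complex a b)) u2; have hb := le_lt_trans (normc_Im (Complex a b)) u1.
rewrite /= in ha hb.
have a1 : 2^-1 < 1 + a by move: ha; rewrite ltr_norml => /andP[]; lra.
have a0 : 0 < 1 + a by apply: lt_trans a1; rewrite invr_gt0.
pose q := b / (1 + a).
have c0 : 0 < cos (atan q) by apply: cos_gt0_pihalf; rewrite atan_gtNpi2 atan_ltpi2.
exists ((1 + a) / cos (atan q)), (atan q); split; first exact: divr_gt0.
- rewrite -normrN -sub0r; apply: hd => /=; rewrite sub0r normrN /q normrM normfV (gtr0_norm a0).
  rewrite ltr_pdivrMr //; apply: lt_trans hb _.
  rewrite ltr_pM2l //.
rewrite /polar divfK ?gt_eqF //.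
rewrite -mulrA [_^-1 * _]mulrC -[sin _ / _]/(tan (atan q)) atanK /q mulrC divfK ?gt_eqF //.
by rewrite -[1 in LHS]/(Complex 1 0); simpc.
Qed.

Lemma sector0E (R : realType) (th0 th1 : R) (z : R[i]) :
  sector 0 th0 th1 z <-> exists rho th : R, [/\ 0 < rho, th0 < th, th < th1 & z = polar rho th].
Proof. by split=> -[rho [th [h1 h2 h3 h4]]]; exists rho, th; split; rewrite // h4 add0r. Qed.

Lemma sector_neq0 (R : realType) (th0 th1 : R) (z : R[i]) : sector 0 th0 th1 z -> z != 0.
Proof.
move=> /sector0E[rho [th [r0 _ _ ->]]].
by rewrite -normc_eq0 normc_polar ?gt_eqF // ltW.
Qed.

(** Multiplication by $1+u$ turns the angle only slightly. Openness is stated multiplicatively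
    because the moving point will be written $z(1+u)$. *)
Lemma sector_open (R : realType) (th0 th1 : R) (z : R[i]) : sector 0 th0 th1 z ->
  exists2 d : R, 0 < d & forall u, normc u < d -> sector 0 th0 th1 (z * (1 + u)).
Proof.
move=> /sector0E[rho [th [r0 h0 h1 ->]]].
have e0 : 0 < Num.min (th - th0) (th1 - th) by rewrite lt_min !subr_gt0 h0.
have [d d0 hd] := near1_polar e0; exists d => // u /hd[rho' [th' [r0' ht ->]]].
rewrite polarD; apply/sector0E; exists (rho * rho'), (th + th').
move: ht; rewrite lt_min !ltr_norml => /andP[/andP[? ?] /andP[? ?]].
by split; [exact: mulr_gt0|lra|lra|].
Qed.

Lemma sector_near (R : realType) (th0 th1 : R) (z : R[i]) : sector 0 th0 th1 z ->
  cnear z (sector 0 th0 th1).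
Proof.
move=> hz; have z0 := sector_neq0 hz; have [d d0 hd] := sector_open hz.
have nz : 0 < normc z by rewrite normc_gt0.
exists (d * normc z) => [|y hy]; first exact: mulr_gt0.
have -> : y = z * (1 + (y - z) / z) by field.
by apply: hd; rewrite normcM normcV ltr_pdivrMr.
Qed.

(** Carathéodory's factor [phi] of [cexp] at [L z] tends to $z\ne0$ along the continuous [L], and
    $y-z=(L(y)-L(z))\,\phi(L(y))$ can be divided by it. *)
Lemma log_cderiv (R : realType) (th0 th1 : R) (L : R[i] -> R[i]) z :
  log_branch (sector 0 th0 th1) L -> sector 0 th0 th1 z -> cderiv L z z^-1.
Proof.
move=> [Lc Le] hz; have z0 := sector_neq0 hz.
have cL : clim L z (L z) by apply/climP; exact: Lc.
have [phi hphi [r r0 hr]] := cderiv_cexp (L z); rewrite Le // in hphi hr.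
have hphi' := clim_comp cL hphi.
exists (fun y => (phi (L y))^-1); first exact: climV.
have nz : 0 < normc z by rewrite normc_gt0.
have := cnearI (sector_near hz) (cnearI (cL r r0) (hphi' _ nz)).
apply: cnearW => y [hy [/hr]]; rewrite Le // => e h.
have p0 : phi (L y) != 0.
  by apply: contraTneq h => ->; rewrite sub0r normcN ltxx.
have -> : y - z = (L y - L z) * phi (L y) by rewrite {1}e addrC addKr.
by rewrite mulfK // addrC subrK.
Qed.

(* Both sides have the same derivative in u. *)
Lemma log_local (R : realType) (th0 th1 : R) (L : R[i] -> R[i]) z :
  log_branch (sector 0 th0 th1) L -> sector 0 th0 th1 z ->
  exists2 d : R, 0 < d & forall u, normc u < d -> L (z * (1 + u)) = L z + ell u.
Proof.
move=> hL hz; have z0 := sector_neq0 hz; have [d d0 hd] := sector_open hz.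
exists (Num.min d 4^-1) => [|u hu]; first by rewrite lt_min d0 /= invr_gt0 ltr0n.
pose g u := L (z * (1 + u)) - ell u.
suff : g u = g 0 by rewrite /g addr0 mulr1 ell0 subr0 => /eqP; rewrite subr_eq => /eqP.
apply: (@cderiv0_const _ _ _ _ (Num.min d 4^-1)); last by rewrite subr0.
move=> w; rewrite subr0 lt_min => /andP[wd w4].
have w1 : 1 + w != 0 by have := sector_neq0 (hd w wd); rewrite mulf_eq0 negb_or => /andP[].
have h1 : cderiv (fun y => z * (1 + y)) w z.
  have := cderivZ z (cderivD (cderiv_cst 1 w) (cderiv_id w)).
  by rewrite add0r mulr1.
have h2 := cderiv_comp h1 (log_cderiv hL (hd w wd)).
have h3 : normc w * 4 <= 1 by lra.
have := cderivB h2 (cderiv_ell h3).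
by rewrite (_ : z * _ - _ = 0) //; field; rewrite z0 w1.
Qed.

(** If [f a] and [f b] differed, the intermediate value theorem would give a value $f(a)\pm d$ with
    $0<d\le\pi$, whereas $\cos d=1$ forces $d=0$ on $[0,\pi]$. *)
Lemma cos1_const (R : realType) (f : R -> R) (a b : R) : a <= b ->
  {within `[a, b], continuous f} -> (forall s, a <= s <= b -> cos (f s) = 1) -> f a = f b.
Proof.
move=> ab fc hf; apply/eqP/negP => /negP fab.
pose sg : R := if f a < f b then 1 else -1.
pose d := Num.min (`|f b - f a|) pi.
have d0 : 0 < d by rewrite lt_min normr_gt0 subr_eq0 eq_sym fab pi_gt0.
have [dl dp] : d <= `|f b - f a| /\ d <= pi by split; rewrite ge_min lexx ?orbT.
have [c /itvP hc fcE] : exists2 c, c \in `[a, b] & f c = f a + sg * d.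
  apply: IVT => //; rewrite /sg; case: ltgtP fab => // h _.
    by rewrite mul1r; move: dl; rewrite gtr0_norm ?subr_gt0 //; lra.
  by rewrite mulN1r; move: dl; rewrite ltr0_norm ?subr_lt0 //; lra.
have := hf c; rewrite !hc => /(_ isT); rewrite fcE cosD.
have fa1 : cos (f a) = 1 by apply: hf; rewrite lexx.
have fs0 : sin (f a) = 0.
  by apply/eqP; rewrite -sqrf_eq0 sin2cos2 fa1 expr1n subrr.
rewrite fa1 fs0 mul1r mul0r subr0 => h1.
have cd : cos d = 1 by move: h1; rewrite /sg; case: ifP => _; rewrite ?mul1r ?mulN1r ?cosN.
have : d = 0 by apply: cos_inj; rewrite ?cos0 // in_itv /= ?lexx ?pi_ge0 // (ltW d0).
by move=> e; rewrite e ltxx in d0.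
Qed.

(* Re (L z) = ln |z|, and Im (L z) minus the argument of z is a continuous
   function with values in 2 pi Z, hence constant on the sector. *)
Lemma log_bound (R : realType) (th0 th1 : R) (L : R[i] -> R[i]) :
  th0 < th1 -> log_branch (sector 0 th0 th1) L ->
  exists2 C : R, 0 <= C &
    forall z, sector 0 th0 th1 z -> normc (L z) <= `|ln (normc z)| + C.
Proof.
move=> th01 [Lc Le].
pose tc := (th0 + th1) / 2.
have S r th : 0 < r -> th0 < th < th1 -> sector 0 th0 th1 (polar r th).
  by move=> r0 /andP[h1 h2]; apply/sector0E; exists r, th.
have ReIm r th : 0 < r -> th0 < th < th1 ->
    complex.Re (L (polar r th)) = ln r /\ cos (complex.Im (L (polar r th)) - th) = 1.
  move=> r0 hth; have := Le _ (S r th r0 hth); case: (L _) => p q /= [h1 h2].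
  have er : expR p = r.
    rewrite -(normc_polar q (expR_ge0 p)) -[RHS](normc_polar th (ltW r0)).
    by rewrite /polar h1 h2.
  split; first by rewrite -er expRK.
  move: h1 h2; rewrite er => /(mulfI (lt0r_neq0 r0)) h1 /(mulfI (lt0r_neq0 r0)) h2.
  by rewrite cosB h1 h2 -!expr2 cos2Dsin2.
have key r th : 0 < r -> th0 < th < th1 ->
    complex.Im (L (polar r th)) - th = complex.Im (L (polar 1 tc)) - tc.
  move=> r0 hth; have htc : th0 < tc < th1 by rewrite /tc; apply/andP; split; lra.
  (* A segment in polar coordinates from $(1,t_c)$ to $(r,\theta)$; it stays in the sector because
     the conditions on radius and angle are convex. *)
  pose rs (s : R) := 1 + s * (r - 1); pose ts (s : R) := tc + s * (th - tc).
  pose f s := complex.Im (L (polar (rs s) (ts s))) - ts s.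
  have conv (p q s : R) : 0 < p -> 0 < q -> 0 <= s <= 1 -> 0 < (1 - s) * p + s * q.
    move=> p0 q0 /andP[s0 s1]; have [->|sn] := eqVneq s 0; first by rewrite mul0r subr0 addr0 mul1r.
    by apply: ltr_wpDl; [rewrite mulr_ge0 ?subr_ge0 // ltW|rewrite mulr_gt0 // lt_neqAle eq_sym sn].
  have rs0 s : 0 <= s <= 1 -> 0 < rs s.
    by move=> /(conv _ _ _ ltr01 r0); rewrite /rs; lra.
  have tsb s : 0 <= s <= 1 -> th0 < ts s < th1.
    move: hth htc => /andP[h1 h2] /andP[h3 h4] hs; rewrite /ts.
    have : 0 < (1 - s) * (tc - th0) + s * (th - th0) by apply: conv; rewrite ?subr_gt0.
    have : 0 < (1 - s) * (th1 - tc) + s * (th1 - th) by apply: conv; rewrite ?subr_gt0.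
    by move=> *; apply/andP; split; lra.
  have -> : complex.Im (L (polar r th)) - th = f 1.
    by rewrite /f /rs /ts !mul1r ![_ + (_ - _)]addrC !subrK.
  have -> : complex.Im (L (polar 1 tc)) - tc = f 0 by rewrite /f /rs /ts !mul0r !addr0.
  symmetry; apply: cos1_const => // [|s hs]; last by rewrite (ReIm _ _ (rs0 s hs) (tsb s hs)).2.
  apply: continuous_in_subspaceT => s /set_mem /= /itvP hs.
  have hs' : 0 <= s <= 1 by rewrite !hs.
  have rc : rs @ s --> rs s.
    by apply: cvgD; [exact: cvg_cst|apply: cvgM; [exact: cvg_id|exact: cvg_cst]].
  have tc' : ts @ s --> ts s.
    by apply: cvgD; [exact: cvg_cst|apply: cvgM; [exact: cvg_id|exact: cvg_cst]].
  apply: cvgB => //.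
  have hc : (fun s => rs s * cos (ts s)) @ s --> rs s * cos (ts s).
    by apply: cvgM => //; apply: (cvg_comp _ _ tc'); exact: continuous_cos.
  have hsn : (fun s => rs s * sin (ts s)) @ s --> rs s * sin (ts s).
    by apply: cvgM => //; apply: (cvg_comp _ _ tc'); exact: continuous_sin.
  have := Lc _ (S _ _ (rs0 s hs') (tsb s hs')) => /climP hL.
  apply/cvgrPdist_lt => e e0; have [d d0 hd] := hL e e0.
  have d2 : 0 < d / 2 by rewrite divr_gt0.
  near=> s'.
  have h1 : `|rs s * cos (ts s) - rs s' * cos (ts s')| < d / 2 by near: s'; exact: cvgr_dist_lt hc _ d2.
  have h2 : `|rs s * sin (ts s) - rs s' * sin (ts s')| < d / 2 by near: s'; exact: cvgr_dist_lt hsn _ d2.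
  rewrite distrC -raddfB; apply: le_lt_trans (normc_Im _) _; apply: hd.
  apply: le_lt_trans (normc_le_ReIm _) _; rewrite /= -/(_ - _).
  rewrite distrC in h1; rewrite distrC in h2; lra.
exists (`|complex.Im (L (polar 1 tc)) - tc| + (`|th0| + `|th1|)); first by rewrite !addr_ge0.
move=> z /sector0E[r [th [r0 h0 h1 ->]]]; have hth : th0 < th < th1 by rewrite h0.
rewrite normc_polar ?(ltW r0) //; apply: le_trans (normc_le_ReIm _) _.
rewrite (ReIm _ _ r0 hth).1 lerD2l -[X in `|X|](subrK th) (key _ _ r0 hth).
apply: le_trans (ler_normD _ _) _; rewrite lerD2l.
rewrite ler_norml; have := ler_norm th1; have := ler_norm (- th0); rewrite normrN.
have := normr_ge0 th0; have := normr_ge0 th1; move=> *; apply/andP; split; lra.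
Unshelve. all: by end_near. Qed.

(** * The differential equation at a fixed parameter *)

Definition ev (R : realType) r n (f : laurent R r n) (t : 'rV[R[i]]_r) (z : R[i]) : 'M[R[i]]_n :=
  lv (lord f) (fun k => lseq f k t) z.

(** Only the rate [K] limits the domain on which series may be manipulated, so the constant is
    hidden. *)
Definition gbl (R : realType) r n (K : R) (f : laurent R r n) (t : 'rV[R[i]]_r) :=
  exists c, geo_bound c K (fun k => lseq f k t).

Lemma gbl_le (R : realType) r n (K K' : R) (f : laurent R r n) t :
  K <= K' -> gbl K f t -> gbl K' f t.
Proof. by move=> KK [c hc]; exists c; exact: geo_bound_le (lexx c) KK hc. Qed.

(** Changing the order shifts the index by at most $|m'-m|$, at the cost of a power of [K]; [1 <= K]
    makes the bound monotone in the index. *)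
Lemma geo_bound_lc (R : realType) n c K (a : nat -> 'M[R[i]]_n) (m m' : int) :
  1 <= K -> geo_bound c K a ->
  geo_bound (c * K ^+ `|m' - m|%N) K (fun k => lc m a (m' + k%:Z)).
Proof.
move=> K1 [c0 K0 ha]; split=> [||k i j]; rewrite ?mulr_ge0 ?exprn_ge0 ?(ltW K0) //.
rewrite /lc; case: ifP => _; last first.
  by rewrite mxE normc0 !mulr_ge0 ?exprn_ge0 ?(ltW K0).
apply: le_trans (ha _ i j) _; rewrite -mulrA -exprD; apply: ler_wpM2l => //.
apply: ler_weXn2l => //; rewrite addrAC -lez_nat PoszD !abszE.
by apply: le_trans (ler_normD _ _) _.
Qed.

Lemma lc_shift (R : realType) n (a : nat -> 'M[R[i]]_n) (m m' : int) i :
  m' <= m -> lc m' (fun k => lc m a (m' + k%:Z)) i = lc m a i.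
Proof.
move=> mm; rewrite {1}/lc; have [h|h] := leP m' i.
  by rewrite gez0_abs ?subr_ge0 // [m' + _]addrC subrK.
by rewrite /lc leNgt (lt_le_trans h mm).
Qed.

Lemma ev_leval (R : realType) r n (alpha : 'rV[R[i]]_r -> R[i]) K (f : laurent R r n) x t :
  gbl K f t -> x != alpha t -> normc (x - alpha t) * K <= 2^-1 ->
  leval alpha f x t = ev f t (x - alpha t).
Proof. by move=> [c hc]; exact: leval_lv hc. Qed.

Lemma ev_eq (R : realType) r n K (f g : laurent R r n) t z :
  gbl K f t -> gbl K g t -> normc z * K <= 2^-1 -> z != 0 ->
  (forall i, lcoef f i t = lcoef g i t) -> ev f t z = ev g t z.
Proof. by move=> [c hc] [c' hc'] zK z0 e; apply: lv_lc hc hc' zK z0 e. Qed.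

Lemma gbl_mul (R : realType) r n K (f g : laurent R r n) t :
  gbl K f t -> gbl K g t -> gbl (2 * K) (lmul f g) t.
Proof. by move=> [c hc] [c' hc']; exists (n%:R * (c * c')); exact: geo_bound_conv hc hc'. Qed.

Lemma ev_mul (R : realType) r n K (f g : laurent R r n) t z :
  gbl K f t -> gbl K g t -> normc z * (2 * K) <= 2^-1 -> z != 0 ->
  ev (lmul f g) t z = ev f t z *m ev g t z.
Proof. by move=> [c hc] [c' hc'] zK z0; exact: lv_conv hc hc' zK z0. Qed.

Lemma gbl_add (R : realType) r n K (f g : laurent R r n) t : 1 <= K ->
  gbl K f t -> gbl K g t -> gbl K (ladd f g) t.
Proof.
move=> K1 [c hc] [c' hc'].
have [c1 K0 h1] := geo_bound_lc (lord f) (Num.min (lord f) (lord g)) K1 hc.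
have [c1' _ h1'] := geo_bound_lc (lord g) (Num.min (lord f) (lord g)) K1 hc'.
eexists; split; [exact: addr_ge0 c1 c1'|exact: K0|move=> k i j].
rewrite mulrDl; have := lerD (h1 k i j) (h1' k i j); apply: le_trans.
by rewrite /= mxE; exact: normcD.
Qed.

Lemma ev_add (R : realType) r n K (f g : laurent R r n) t z : 1 <= K ->
  gbl K f t -> gbl K g t -> normc z * K <= 2^-1 -> z != 0 ->
  ev (ladd f g) t z = ev f t z + ev g t z.
Proof.
move=> K1 [c hc] [c' hc'] zK z0; set m := Num.min (lord f) (lord g).
have h1 := geo_bound_lc (lord f) m K1 hc.
have h1' := geo_bound_lc (lord g) m K1 hc'.
rewrite /ev -(lv_lc h1 hc zK z0 (fun i => lc_shift _ i (_ : m <= _))) ?ge_min ?lexx //.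
rewrite -(lv_lc h1' hc' zK z0 (fun i => lc_shift _ i (_ : m <= _))) ?ge_min ?lexx ?orbT //.
by rewrite /lv -scalerDr -(psumD h1 h1' zK).
Qed.

Lemma geo_bound_one (R : realType) n (K : R) : 0 < K ->
  geo_bound 1 K (fun k => if k == 0%N then 1%:M else 0 : 'M[R[i]]_n).
Proof.
move=> K0; split => // k i j /=; case: k => [|k] /=; rewrite mxE.
  by case: (i == j); rewrite ?normc0 ?expr0 ?mulr1 // -[1%:R]/(1 : R[i]) normc1.
by rewrite normc0 mul1r exprn_ge0 // ltW.
Qed.

Lemma gbl_one (R : realType) r n (K : R) t : 0 < K -> gbl K (lone R r n) t.
Proof. by move=> K0; exists 1; exact: geo_bound_one. Qed.

Lemma ev_one (R : realType) r n t (z : R[i]) : ev (lone R r n) t z = 1%:M.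
Proof. by rewrite /ev /lv expr0z scale1r psum_const. Qed.

Definition mxderiv (R : realType) n (F : R[i] -> 'M[R[i]]_n) (z : R[i]) (D : 'M[R[i]]_n) :=
  forall i j, cderiv (fun y => F y i j) z (D i j).

Lemma mxderiv_ev (R : realType) r n K (f : laurent R r n) t z :
  gbl K f t -> normc z * (4 * K) <= 1 -> z != 0 ->
  mxderiv (ev f t) z (ev (lderiv f) t z).
Proof. by move=> [c hc] zK z0 i j; exact: lv_cderiv hc zK z0. Qed.

Lemma gbl_deriv (R : realType) r n K (f : laurent R r n) t :
  gbl K f t -> gbl (2 * K) (lderiv f) t.
Proof.
move=> [c [c0 K0 hc]]; exists ((`|lord f|%N%:R + 1) * c); split.
- by rewrite mulr_ge0 ?addr_ge0.
- by rewrite mulr_gt0.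
move=> k i j; rewrite mxE normcM exprMn mulrACA; apply: ler_pM; rewrite ?normc_ge0 //.
rewrite intrD; apply: le_trans (normcD _ _) _; rewrite mulrDl mul1r; apply: lerD; last first.
  by rewrite normc_nat natr_le_pow2.
have -> : normc ((lord f)%:~R : R[i]) = `|lord f|%N%:R.
  by case: (lord f) => m; rewrite ?NegzE ?mulrNz ?normcN normc_nat.
by rewrite ler_peMr // exprn_ege1 // ler1n.
Qed.

Lemma mxderivM (R : realType) n (F G : R[i] -> 'M[R[i]]_n) z D E :
  mxderiv F z D -> mxderiv G z E ->
  mxderiv (fun y => F y *m G y) z (D *m G z + F z *m E).
Proof.
move=> hF hG i j.
have := cderiv_sum (index_enum 'I_n) (fun l => cderivM (hF i l) (hG l j)).
rewrite big_split /= !mxE; apply: cderiv_ext => y; exact: mxE.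
Qed.

Lemma mxderiv_unique (R : realType) n (F : R[i] -> 'M[R[i]]_n) z D E :
  mxderiv F z D -> mxderiv F z E -> D = E.
Proof. by move=> h1 h2; apply/matrixP => i j; exact: cderiv_unique (h1 i j) (h2 i j). Qed.

Lemma mxderiv_near (R : realType) n (F G : R[i] -> 'M[R[i]]_n) z D :
  cnear z (fun y => F y = G y) -> mxderiv G z D -> mxderiv F z D.
Proof. by move=> FG hG i j; apply: cderiv_near (hG i j); apply: cnearW FG => y ->. Qed.

Lemma mxderiv_cst (R : realType) n (A : 'M[R[i]]_n) z : mxderiv (fun=> A) z 0.
Proof. by move=> i j; rewrite mxE; exact: cderiv_cst. Qed.

Lemma mxderiv_exp (R : realType) n (L : R[i] -> R[i]) (M : 'M[R[i]]_n) z l :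
  cderiv L z l -> mxderiv (fun y => expm (L y *: M)) z (l *: (M *m expm (L z *: M))).
Proof.
move=> hL i j; rewrite mxE.
exact: (cderiv_comp (f := fun v => expm (v *: M) i j) hL (expm_cderiv M (L z) i j)).
Qed.

Lemma mxderiv_is_derive (R : realType) n (F : R[i] -> 'M[R[i]]_n) z D :
  mxderiv F z D -> is_derive z (1 : R[i]) F D.
Proof.
move=> hF.
have L : (fun h : R[i] => h^-1 *: (F (h *: 1 + z) - F z)) @ 0^' --> D.
  apply/cvg_mxcP => i j; have [phi hphi [d d0 hd]] := hF i j.
  apply/cvgcP => e e0; have [d' d'0 hd'] := hphi e e0.
  have : nbhs (0 : R[i]) (fun h => normc h < Num.min d d').
    by apply/nbhscP; exists (Num.min d d') => [|y]; rewrite ?lt_min ?d0 // subr0.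
  rewrite -[nbhs 0 _]/(\forall h \near 0, normc h < Num.min d d') => /nbhs_dnbhs H.
  near=> h.
  have h0 : h != 0 by near: h; exact: nbhs_dnbhs_neq.
  have : normc h < Num.min d d' by near: h.
  rewrite lt_min => /andP[h1 h2].
  have hz : h *: 1 + z - z = h by rewrite addrK -[h *: 1]/(h * 1) mulr1.
  rewrite mxE mxBE hd ?hz // [F z i j + _]addrC addrK mulKf //; apply: hd'; by rewrite hz.
by apply: DeriveDef; [apply/cvg_ex; exists D|apply: cvg_lim].
Unshelve. all: by end_near. Qed.

(** A vector of the left kernel satisfies $v=-vM$, so its $\ell^1$ norm is at most [n%:R * b] times
    itself, hence 0. *)
Lemma unit_near1 (R : realType) n (M : 'M[R[i]]_n) (b : R) :
  (forall i j, normc (M i j) <= b) -> n%:R * b < 1 -> 1%:M + M \in unitmx.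
Proof.
move=> hM nb; rewrite -row_free_unit -kermx_eq0; apply/eqP/row_matrixP => l.
rewrite row0; set v := row l _.
have hv : v *m (1%:M + M) = 0 by rewrite -row_mul mulmx_ker row0.
have e j : v 0 j = - \sum_i v 0 i * M i j.
  have := congr1 (fun w : 'rV_n => w 0 j) hv.
  by rewrite mulmxDr mulmx1 !mxE => /eqP; rewrite addr_eq0 => /eqP.
have S0 : 0 <= \sum_j normc (v 0 j) by apply: sumr_ge0 => j _; exact: normc_ge0.
have S1 : \sum_j normc (v 0 j) <= n%:R * b * \sum_j normc (v 0 j).
  apply: (@le_trans _ _ (\sum_(j < n) b * \sum_i normc (v 0 i))); last first.
    by rewrite sumr_const card_ord -[leLHS]mulr_natl mulrA.
  apply: ler_sum => j _; rewrite e normcN; apply: le_trans (normc_sum _ _ _) _.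
  rewrite mulr_sumr; apply: ler_sum => i _; rewrite normcM mulrC.
  by apply: ler_wpM2r; rewrite ?normc_ge0.
have Sz : \sum_j normc (v 0 j) = 0.
  by apply/eqP; rewrite eq_le S0 andbT leNgt; apply/negP => Sp; move: S1; rewrite -ler_pdivrMr // divff ?gt_eqF // leNgt nb.
apply/rowP => j; rewrite [RHS]mxE; apply/eqP; rewrite -normc_eq0; apply/eqP.
by have /psumr_eq0P := Sz; apply=> // k _; exact: normc_ge0.
Qed.

Definition zdiag (R : realType) n (d : 'I_n -> int) (z : R[i]) : 'M[R[i]]_n :=
  \matrix_(i, j) if i == j then z ^ d j else 0.

Definition ddiag (R : realType) n (d : 'I_n -> int) : 'M[R[i]]_n :=
  \matrix_(i, j) if i == j then (d j)%:~R else 0.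

Lemma zdiag_mul (R : realType) n (d : 'I_n -> int) (z : R[i]) (M : 'M[R[i]]_n) i j :
  (zdiag d z *m M) i j = z ^ d i * M i j.
Proof.
rewrite mxE (bigD1 i) //= mxE eqxx big1 ?addr0 // => l li.
by rewrite mxE eq_sym (negbTE li) mul0r.
Qed.

Lemma mul_zdiag (R : realType) n (d : 'I_n -> int) (z : R[i]) (M : 'M[R[i]]_n) i j :
  (M *m zdiag d z) i j = M i j * z ^ d j.
Proof.
rewrite mxE (bigD1 j) //= mxE eqxx big1 ?addr0 // => l lj.
by rewrite mxE (negbTE lj) mulr0.
Qed.

Lemma zdiag_unit (R : realType) n (d : 'I_n -> int) (z : R[i]) : z != 0 -> zdiag d z \in unitmx.
Proof.
move=> z0; have h : zdiag d z *m zdiag (fun i => - d i) z = 1%:M.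
  apply/matrixP => i j; rewrite zdiag_mul !mxE; case: eqVneq => [->|_]; last by rewrite mulr0.
  by rewrite -expfzDr // subrr.
by case: (mulmx1_unit h) => hu _; exact: hu.
Qed.

Lemma ddiag_zdiag (R : realType) n (d : 'I_n -> int) (z : R[i]) :
  ddiag R d *m zdiag d z = zdiag d z *m ddiag R d.
Proof.
apply/matrixP => i j; rewrite zdiag_mul mul_zdiag !mxE; case: eqVneq => [->|_].
  exact: mulrC.
by rewrite mulr0 mul0r.
Qed.

Lemma mxderiv_zdiag (R : realType) n (d : 'I_n -> int) (z : R[i]) : z != 0 ->
  mxderiv (zdiag d) z (z^-1 *: (ddiag R d *m zdiag d z)).
Proof.
move=> z0 i j; rewrite mxE mul_zdiag mxE; have [->|ij] := eqVneq i j.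
  have := cderiv_expz (d j) z0; rewrite mulrCA expfzDr // mulrC [_ * z ^ -1]mulrC -mulrA.
  have -> : z ^ (-1) = z^-1 by rewrite exprN1.
  rewrite mulrCA [_ * (d j)%:~R]mulrC [_%:~R * _]mulrC.
  by apply: cderiv_ext => y; rewrite mxE eqxx.
rewrite mul0r mulr0; apply: cderiv_ext (cderiv_cst 0 z) => y.
by rewrite mxE (negbTE ij).
Qed.

Lemma add_sub_cancel (V : zmodType) (a b c : V) : a - b + c + (b - c) = a.
Proof. by rewrite -addrA [c + _]addrC !subrK. Qed.

(** The recurrence says $zX'=CX-X\nu$. Differentiating $z^D$ and the exponential adds $XDz^D$ and
    $Xz^D(N_t-D)$ in front of the exponential; as $\nu z^D=z^DN_t$ and $D$ commutes with $z^D$,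
    everything but the term in $C$ cancels. *)
Lemma euler_solution (R : realType) n c c' c'' K (x C nu : nat -> 'M[R[i]]_n)
    (d : 'I_n -> int) (Nt : 'M[R[i]]_n) (L : R[i] -> R[i]) z :
  geo_bound c K x -> geo_bound c' K C -> geo_bound c'' K nu ->
  normc z * (4 * K) <= 1 -> z != 0 ->
  (forall k, k%:R *: x k = mconv C x k - mconv x nu k) ->
  psum nu z *m zdiag d z = zdiag d z *m Nt -> cderiv L z z^-1 ->
  let W := fun y => psum x y *m zdiag d y *m expm (L y *: (Nt - ddiag R d)) in
  mxderiv W z (z^-1 *: (psum C z *m W z)).
Proof.
move=> hx hC hnu zK z0 hrec hNt hL W; have [_ K0 _] := hx.
have zK2 : normc z * (2 * K) <= 2^-1 by lra.
have hX : mxderiv (psum x) z (psum (dcoef x) z) by move=> i j; exact: psum_cderiv hx zK.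
have eX : psum (dcoef x) z = z^-1 *: (psum C z *m psum x z - psum x z *m psum nu z).
  apply: (@scalerI _ _ z) => //; rewrite scalerA mulfV // scale1r.
  have -> : z *: psum (dcoef x) z = psum (fun k => k%:R *: x k) z.
    by rewrite (psum_shift (geo_bound_nat hx) zK2) scale0r add0r.
  rewrite -(psum_conv hC hx zK2) -(psum_conv hx hnu zK2) -scaleN1r.
  have h1 := geo_bound_conv hC hx; have h2 := geo_bound_conv hx hnu.
  rewrite -(psumZ (-1) h2 zK2).
  have h3 : geo_bound (n%:R * (c * c'')) (2 * K) (fun k => -1 *: mconv x nu k).
    have [h30 h3K h3b] := h2; split => // k i j.
    by rewrite mxE mulN1r normcN.
  rewrite -(psumD h1 h3 zK2); apply: psum_ext => k.
  by rewrite hrec scaleN1r.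
have := mxderivM (mxderivM hX (mxderiv_zdiag d z0)) (mxderiv_exp (Nt - ddiag R d) hL).
set E := expm _; set X := psum x z; set Z := zdiag d z.
have -> : (psum (dcoef x) z *m Z + X *m (z^-1 *: (ddiag R d *m Z))) *m E +
   X *m Z *m (z^-1 *: ((Nt - ddiag R d) *m E)) = z^-1 *: (psum C z *m W z).
  rewrite eX -/X -scalemxAr -scalemxAl -!scalerDr -scalemxAl -scalemxAr -scalerDr; congr (_ *: _).
  rewrite /W -/E -/X -/Z mulmxBl -[X *m psum nu z *m Z]mulmxA hNt ddiag_zdiag.
  rewrite [(Nt - _) *m E]mulmxBl mulmxBr !mulmxA mulmxDl mulmxBl.
  exact: add_sub_cancel.
exact.
Qed.

(** The way back from the equivalent equation. Differentiating $pp'=1$ gives $-p'\,p_x\,p'$ as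
    derivative of the inverse [p'], which cancels the contribution of [px] to [b]. *)
Lemma gauge_solution (R : realType) n (p p' W : R[i] -> 'M[R[i]]_n) z (px px' a b : 'M[R[i]]_n) :
  mxderiv p z px -> mxderiv p' z px' -> cnear z (fun y => p y *m p' y = 1%:M) ->
  p' z *m p z = 1%:M -> b = px *m p' z + p z *m a *m p' z ->
  mxderiv W z (b *m W z) ->
  mxderiv (fun y => p' y *m W y) z (a *m (p' z *m W z)).
Proof.
move=> hp hp' pp' p'p -> hW.
have e : px *m p' z + p z *m px' = 0.
  exact: mxderiv_unique (mxderivM hp hp') (mxderiv_near pp' (mxderiv_cst _ _)).
have e' : px' = - (p' z *m px *m p' z).
  have := congr1 (mulmx (p' z)) e; rewrite mulmxDr mulmx0 !mulmxA p'p mul1mx.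
  by move/eqP; rewrite addrC addr_eq0 => /eqP.
have := mxderivM hp' hW.
suff -> : px' *m W z + p' z *m ((px *m p' z + p z *m a *m p' z) *m W z) = a *m (p' z *m W z) by [].
by rewrite e' mulNmx mulmxDl mulmxDr !mulmxA p'p mul1mx addKr.
Qed.

(** * Dependence on the parameter *)

Lemma hsum_geometric (R : realType) (u : R[i]) : normc u <= 2^-1 ->
  hsum (fun k => u ^+ k) (1 - u)^-1.
Proof.
move=> hu; have ha : asum (fun k => u ^+ k) 2.
  apply: asum_nat => N; apply: le_trans (geo_half_le2 R N); rewrite big_mkord.
  by apply: ler_sum => k _; rewrite normcX lerXn2r ?nnegrE ?normc_ge0 ?invr_ge0.
have [s hs] := asum_hsum ha.
have e : u * s = s - u ^+ 0.
  apply: hsum_unique (hsumZ u hs) _; apply: hsum_ext (hsum_shift ha hs) => k.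
  by rewrite exprS.
have u1 : 1 - u != 0.
  rewrite subr_eq0; apply: contraTneq hu => <-; rewrite normc1 -ltNge invf_lt1 ?ltr1n //.
suff <- : s = (1 - u)^-1 by [].
apply: (mulIf u1); rewrite mulVf // mulrBr mulr1 mulrC e expr0; ring.
Qed.

Lemma wiener_geometric (R : realType) r (t : 'rV[R[i]]_r) rho f : 0 < rho ->
  wiener t rho 4^-1 f -> wiener t rho 2 (fun s => (1 - f s)^-1).
Proof.
move=> rho0 hf.
apply: (wiener_series (F := fun k s => f s ^+ k) (M := fun k => 4^-1 ^+ k)) => //.
- by move=> k; exact: wiener_exp.
- move=> N; apply: le_trans (geo_half_le2 R N); rewrite big_mkord.
  by apply: ler_sum => k _; rewrite lerXn2r ?nnegrE ?invr_ge0 // lef_pV2 ?posrE ?ler_nat.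
move=> s hs; apply: hsum_series; apply: hsum_geometric.
apply: le_trans (wiener_bound (ltW rho0) hf hs) _.
by rewrite lef_pV2 ?posrE ?ler_nat.
Qed.

Lemma wiener_ell (R : realType) r (t : 'rV[R[i]]_r) rho f : 0 < rho ->
  wiener t rho 4^-1 f -> wiener t rho 2 (fun s => ell (- f s)).
Proof.
move=> rho0 hf.
pose c k : R[i] := if k is k'.+1 then (-1) ^+ k' / k%:R * (-1) ^+ k else 0.
have c1 k : normc (c k) <= 1.
  case: k => [|k]; first by rewrite normc0.
  rewrite !normcM !normcX normcN normc1 !expr1n mul1r mulr1 normcV normc_nat.
  by rewrite invf_le1 ?ltr0n // ler1n.
apply: (wiener_series (F := fun k s => c k * f s ^+ k) (M := fun k => normc (c k) * 4^-1 ^+ k)) => //.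
- by move=> k; apply: wiener_scale; exact: wiener_exp.
- move=> N; apply: le_trans (geo_half_le2 R N); rewrite big_mkord.
  apply: ler_sum => k _; apply: (@le_trans _ _ (4^-1 ^+ k)).
    by rewrite ler_piMl // exprn_ge0 // invr_ge0.
  by rewrite lerXn2r ?nnegrE ?invr_ge0 // lef_pV2 ?posrE ?ler_nat.
move=> s hs; have hfs := wiener_bound (ltW rho0) hf hs.
have hfs' : normc (- f s) * 1 <= 2^-1 by rewrite normcN; lra.
have := hsum_series (psumP 0 0 (@ell_geo R) hfs').
rewrite -/(ell _); set a := (fun k => _ * _); have -> // : (fun k => c k * f s ^+ k) = a.
apply/funext => -[|k]; rewrite /a /c; first by rewrite mxE.
by rewrite mxE eqxx mulr1n -[- f s]mulN1r exprMn mulrA.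
Qed.

Lemma mxwiener_pow (R : realType) r n (t : 'rV[R[i]]_r) rho M (F : 'rV[R[i]]_r -> 'M[R[i]]_n) k :
  0 < rho -> mxwiener t rho M F -> mxwiener t rho ((n%:R * M) ^+ k) (fun s => F s ^+ k).
Proof.
move=> rho0 hF; elim: k => [|k IH].
  apply: mxwiener_const => // i j; rewrite !expr0 mxE.
  by case: (i == j); rewrite ?normc0 // -[1%:R]/(1 : R[i]) normc1.
rewrite exprS -mulrA; apply: mxwiener_ext (mxwiener_mul rho0 hF IH) => s _.
by rewrite exprS mulmxE.
Qed.

Lemma mxwiener_expm (R : realType) r n (t : 'rV[R[i]]_r) rho M (F : 'rV[R[i]]_r -> 'M[R[i]]_n) :
  0 < rho -> 0 <= M -> mxwiener t rho M F ->
  mxwiener t rho (expR (n%:R * M)) (fun s => expm (F s)).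
Proof.
move=> rho0 M0 hF i j.
apply: (wiener_series (F := fun k s => k`!%:R^-1 * (F s ^+ k) i j)
  (M := fun k => normc (k`!%:R^-1 : R[i]) * (n%:R * M) ^+ k)) => //.
- by move=> k; apply: wiener_scale; exact: mxwiener_pow.
- move=> N; rewrite big_mkord; under eq_bigr do rewrite normc_invfact.
  by apply: exp_partial; rewrite mulr_ge0.
move=> s _; have [K K0 wK] := small_radius (1 : R[i]); have [c hc] := exp_seq_geoW (F s) K0.
have wK1 : normc (1 : R[i]) * K <= 2^-1 by rewrite normc1 in wK *; lra.
have := hsum_series (psumP i j hc wK1); rewrite -expmE.
set a := (fun k => _ * _); have -> // : (fun k => k`!%:R^-1 * (F s ^+ k) i j) = a.
by apply/funext => k; rewrite /a expr1n mulr1 mxE.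
Qed.

Lemma expzR_pos (R : realType) (x : R) (m : int) : 0 < x -> 0 < x ^ m.
Proof. by move=> x0; rewrite exprz_gt0. Qed.

Lemma normc_expz (R : realType) (z : R[i]) (m : int) : normc (z ^ m) = normc z ^ m.
Proof. by case: m => k; rewrite /= ?normcV normcX. Qed.

(** Norm 1/4 for [f] keeps both $1-f$ and its inverse at norm at most 2, so positive and negative
    exponents obey the same bound. *)
Lemma wiener_expz (R : realType) r (t : 'rV[R[i]]_r) rho f (z : R[i]) (m : int) :
  0 < rho -> wiener t rho 4^-1 f -> z != 0 ->
  wiener t rho (normc z ^ m * 2 ^+ `|m|%N) (fun s => (z * (1 - f s)) ^ m).
Proof.
move=> rho0 hf z0.
have q4 : 0 <= 4^-1 :> R by rewrite invr_ge0.
have h1 : wiener t rho 2 (fun s => 1 - f s).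
  apply: wiener_le (wiener_sub (wiener_const t 1 rho0) hf).
  by rewrite normc1; lra.
suff h : wiener t rho (2 ^+ `|m|%N) (fun s => (1 - f s) ^ m).
  by have := wiener_scale (z ^ m) h; rewrite normc_expz; apply: wiener_ext => s _; rewrite expfzMl.
case: m => k /=; first exact: wiener_exp.
by apply: wiener_ext (wiener_exp k.+1 rho0 (wiener_geometric rho0 hf)) => s _; rewrite NegzE -exprnN exprVn.
Qed.

(** While [s] moves, $x-\alpha(s)=z(1-f(s))$ stays comparable to [z]; the size is thus $|z|$ to the
    power [lord Q], up to a factor that does not involve [z]. *)
Lemma leval_wiener (R : realType) r n (alpha : 'rV[R[i]]_r -> R[i]) (Q : laurent R r n)
    (t : 'rV[R[i]]_r) (rho c K : R) f (x z : R[i]) :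
  0 < rho -> 0 <= c -> 0 < K ->
  (forall k, mxwiener t rho (c * K ^+ k) (lseq Q k)) ->
  wiener t rho 4^-1 f -> z != 0 -> (forall s, pdisc t rho s -> x - alpha s = z * (1 - f s)) ->
  normc z * (4 * K) <= 1 ->
  mxwiener t rho (normc z ^ lord Q * 2 ^+ `|lord Q|%N * (2 * c)) (leval alpha Q x).
Proof.
move=> rho0 c0 K0 hQ hf z0 hx zK i j.
have fb s : pdisc t rho s -> normc (f s) <= 4^-1 by exact: wiener_bound (ltW rho0) hf.
have nf s : pdisc t rho s -> 1 - f s != 0.
  move=> /fb; rewrite subr_eq0; apply: contraTneq => <-; rewrite normc1 -ltNge.
  by rewrite invf_lt1 ?ltr1n.
pose y s := z * (1 - f s).
have yb s : pdisc t rho s -> normc (y s) <= 2 * normc z.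
  move=> /fb h; rewrite normcM mulrC ler_wpM2r ?normc_ge0 //.
  by apply: le_trans (normcD _ _) _; rewrite normcN normc1; lra.
have yK s : pdisc t rho s -> normc (y s) * K <= 2^-1.
  by move=> /yb /(ler_wpM2r (ltW K0)) h; lra.
have gb s : pdisc t rho s -> geo_bound c K (fun k => lseq Q k s).
  by move=> hs; split => // k i' j'; exact: wiener_bound (ltW rho0) (hQ k i' j') hs.
have hp : wiener t rho (2 * c) (fun s => psum (fun k => lseq Q k s) (y s) i j).
  have y1 k : wiener t rho ((2 * normc z) ^+ k) (fun s => y s ^+ k).
    by have := @wiener_expz _ _ _ _ _ z k rho0 hf z0; rewrite /= -exprMn mulrC.
  apply: (wiener_series (F := fun k s => lseq Q k s i j * y s ^+ k)
    (M := fun k => c * K ^+ k * (2 * normc z) ^+ k)) => //.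
  - by move=> k; apply: wiener_mul => //; exact: hQ.
  - move=> N; rewrite [2 * c]mulrC; apply: le_trans (ler_wpM2l c0 (geo_half_le2 R N)).
    rewrite big_mkord mulr_sumr; apply: ler_sum => k _; rewrite -mulrA -exprMn.
    apply: ler_wpM2l => //; rewrite lerXn2r ?nnegrE ?mulr_ge0 ?normc_ge0 ?invr_ge0 ?(ltW K0) //.
    lra.
  by move=> s hs; apply: hsum_series; exact: psumP (gb s hs) (yK s hs).
apply: wiener_ext (wiener_mul rho0 (wiener_expz (lord Q) rho0 hf z0) hp) => s hs.
have ey : x - alpha s = y s by rewrite hx.
have xa : x != alpha s by rewrite -subr_eq0 ey mulf_neq0 ?nf.
have yKs : normc (x - alpha s) * K <= 2^-1 by rewrite ey yK.
have el := leval_lv (gb s hs) xa yKs; rewrite ey in el.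
by rewrite el /lv [RHS]mxE.
Qed.

Lemma mxwiener_scale (R : realType) r n (t : 'rV[R[i]]_r) rho M N f
    (F : 'rV[R[i]]_r -> 'M[R[i]]_n) : 0 < rho ->
  wiener t rho M f -> mxwiener t rho N F -> mxwiener t rho (M * N) (fun s => f s *: F s).
Proof.
move=> r0 hf hF i j; apply: wiener_ext (wiener_mul r0 hf (hF i j)) => s _.
by rewrite mxE.
Qed.

Lemma mxwiener_analytic (R : realType) r n (t : 'rV[R[i]]_r) rho M
    (F G : 'rV[R[i]]_r -> 'M[R[i]]_n) : 0 < rho ->
  (\forall s \near t, F s = G s) -> mxwiener t rho M G -> mx_analytic_at F t.
Proof.
move=> r0 /nbhs_mxcP[e e0 he] hG i j; apply/analytic_atP.
have m0 : 0 < Num.min rho (e / 2) by rewrite lt_min r0 divr_gt0.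
exists (Num.min rho (e / 2)), M; split => //.
have mr : Num.min rho (e / 2) <= rho by rewrite ge_min lexx.
apply: wiener_ext (wiener_shrink (ltW m0) mr (hG i j)) => s hs.
rewrite he // => i' j'; rewrite ord1; apply: le_lt_trans (hs j') _.
by rewrite gt_min; apply/orP; right; lra.
Qed.

(** As [s] runs over the polydisc, $x-\alpha(s)$ may leave the sector. So $L(x-\alpha(s))$ is
    replaced by [L z + ell (- f s)], which is analytic on the whole polydisc and agrees with it near
    [t]; derivatives at [t] see no more than that. *)
Lemma Ysol_near (R : realType) r n (alpha : 'rV[R[i]]_r -> R[i]) (Q : laurent R r n)
    (At : 'rV[R[i]]_r -> 'M[R[i]]_n) (t : 'rV[R[i]]_r) (rho c K MA : R) f
    (th0 th1 : R) (L : R[i] -> R[i]) (x : R[i]) :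
  let z := x - alpha t in
  0 < rho -> 0 <= c -> 0 < K -> 0 <= MA ->
  (forall k, mxwiener t rho (c * K ^+ k) (lseq Q k)) -> mxwiener t rho MA At ->
  wiener t rho 4^-1 f -> f t = 0 -> (forall s, pdisc t rho s -> x - alpha s = z * (1 - f s)) ->
  normc z * (4 * K) <= 1 ->
  log_branch (sector 0 th0 th1) L -> sector 0 th0 th1 z ->
  exists2 Yh, \forall s \near t, Ysol alpha Q At L x s = Yh s &
    mxwiener t rho (n%:R * (normc z ^ lord Q * 2 ^+ `|lord Q|%N * (2 * c) *
      expR (n%:R * ((normc (L z) + 2) * MA)))) Yh.
Proof.
move=> z rho0 c0 K0 MA0 hQ hA hf f0 hx zK hL hz; have z0 := sector_neq0 hz.
exists (fun s => leval alpha Q x s *m expm ((L z + ell (- f s)) *: At s)).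
  have [d d0 hd] := log_local hL hz.
  pose rho1 := Num.min rho (rho * d).
  have r1 : 0 < rho1 by rewrite lt_min rho0 mulr_gt0.
  have rr : rho1 <= rho by rewrite ge_min lexx.
  apply/nbhs_mxcP; exists rho1; first exact: r1.
  move=> s hs.
  have hs1 : pdisc t rho1 s by move=> j; exact/ltW/hs.
  have hs0 : pdisc t rho s by exact: pdisc_le hs1.
  have e1 : L (x - alpha s) = L z + ell (- f s).
    rewrite hx //; apply: hd; rewrite normcN.
    have := wiener_bound (ltW r1) (wiener_schwarz r1 rr hf) hs1; rewrite f0 subr0.
    move=> h; apply: le_lt_trans h _.
    have : rho1 / rho <= d by rewrite ler_pdivrMr // mulrC ge_min lexx orbT.
    by lra.
  rewrite /Ysol e1; reflexivity.
apply: (mxwiener_mul rho0 (leval_wiener rho0 c0 K0 hQ hf z0 hx zK)).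
have M0 : 0 <= (normc (L z) + 2) * MA by rewrite mulr_ge0 // addr_ge0 // normc_ge0.
apply: (mxwiener_expm rho0 M0); apply: (mxwiener_scale rho0 _ hA).
apply: wiener_add; first exact: wiener_const.
exact: wiener_ell.
Qed.

(** Lower semicontinuity is the half of continuity that Baire's argument requires: a strict lower
    bound at a point persists nearby. *)
Definition lsc (R : realType) r (g : 'rV[R[i]]_r -> R) (t : 'rV[R[i]]_r) :=
  forall e : R, 0 < e -> exists2 d : R, 0 < d & forall s, pdisc t d s -> g t - e <= g s.

Lemma lsc_normc (R : realType) r (f : 'rV[R[i]]_r -> R[i]) t :
  analytic_at f t -> lsc (fun s => normc (f s)) t.
Proof.
move=> /analytic_atP[rho [M [r0 hf]]] e e0.
have M0 : 0 <= M by exact: wiener_ge0 hf.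
pose d := Num.min rho (rho * (e / (M + 1))).
have M1 : 0 < M + 1 by rewrite ltr_wpDl.
have d0 : 0 < d by rewrite lt_min r0 mulr_gt0 // divr_gt0.
have dr : d <= rho by rewrite ge_min lexx.
exists d => // s hs.
have h := wiener_bound (ltW d0) (wiener_schwarz d0 dr hf) hs.
have dM : M * (d / rho) <= e.
  have : d / rho <= e / (M + 1) by rewrite ler_pdivrMr // mulrC ge_min lexx orbT.
  move=> /(ler_wpM2l M0) /le_trans; apply; rewrite mulrCA ger_pMr // ler_pdivrMr // mul1r; lra.
have := normcD (f s) (f t - f s); rewrite addrC subrK [normc (f t - f s)]normcB; lra.
Qed.

Lemma lscD (R : realType) r (f g : 'rV[R[i]]_r -> R) t :
  lsc f t -> lsc g t -> lsc (fun s => f s + g s) t.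
Proof.
move=> hf hg e e0; have e2 : 0 < e / 2 by rewrite divr_gt0.
have [d d0 hd] := hf _ e2; have [d' d'0 hd'] := hg _ e2.
exists (Num.min d d') => [|s hs]; first by rewrite lt_min d0.
have h1 := hd s (pdisc_le _ hs); have h2 := hd' s (pdisc_le _ hs).
by rewrite !ge_min !lexx ?orbT in h1 h2; move: (h1 isT) (h2 isT); lra.
Qed.

Lemma lsc_sum (R : realType) r (I : Type) (l : seq I) (f : I -> 'rV[R[i]]_r -> R) t :
  (forall k, lsc (f k) t) -> lsc (fun s => \sum_(k <- l) f k s) t.
Proof.
move=> h; elim: l => [|k l IH] e e0.
  by exists 1 => // s _; rewrite !big_nil sub0r oppr_le0 ltW.
have [d d0 hd] := lscD (h k) IH e0; exists d => // s hs.
by rewrite !big_cons; exact: hd.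
Qed.

Lemma in_gl_gbl (R : realType) r n U (alpha : 'rV[R[i]]_r -> R[i]) (f : laurent R r n) t :
  in_gl U alpha f -> U t -> exists2 K, 1 <= K & forall K', K <= K' -> gbl K' f t.
Proof.
move=> hf Ut; have [c [K hK]] := in_gl_geo hf Ut; exists (Num.max 1 K) => [|K' KK].
  by rewrite le_max lexx.
exists c; apply: geo_bound_le hK => //.
by apply: le_trans KK; rewrite le_max lexx orbT.
Qed.

(** [b k] adds up all entries of both series, so that one polydisc and one rate serve for both. The
    coefficients of [B] are read from order -1, as those of $zB$. *)
Lemma uniform_coef_bound (R : realType) r n (U : set 'rV[R[i]]_r) (alpha : 'rV[R[i]]_r -> R[i])
    (B P : laurent R r n) (t1 : 'rV[R[i]]_r) :
  open U -> U t1 -> in_gl U alpha B -> in_gl U alpha P -> analytic_on U alpha ->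
  exists t0 rho K, [/\ 0 < rho, 0 <= K & pdisc t0 rho `<=` U] /\
    [/\ forall k, mxwiener t0 rho (K ^+ k.+1) (fun t => lcoef B (k%:Z - 1) t),
        forall k, mxwiener t0 rho (K ^+ k.+1) (lseq P k) & wiener t0 rho K alpha].
Proof.
move=> oU Ut1 hB hP ha.
have [rho1 r10 hr1] : exists2 rho1 : R, 0 < rho1 & pdisc t1 rho1 `<=` U.
  have /nbhs_mxcP[e e0 he] := open_nbhs_nbhs (conj oU Ut1).
  exists (e / 2); first exact: divr_gt0.
  move=> s hs; apply: he => i j; rewrite ord1; apply: le_lt_trans (hs j) _; lra.
pose C k t := lcoef B (k%:Z - 1) t.
have aC k t i j : U t -> analytic_at (fun s => C k s i j) t.
  move=> Ut; rewrite /C /lcoef; case: (lord B <= k%:Z - 1); first exact: hB.1.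
  apply/analytic_atP; exists 1, 0; split => //.
  have := @wiener_const R r t 1 (0 : R[i]) ltr01; rewrite normc0.
  by apply: wiener_ext => s _; rewrite mxE.
have aP k t i j : U t -> analytic_at (fun s => lseq P k s i j) t by move=> Ut; exact: hP.1.
pose b k t := \sum_(ij : 'I_n * 'I_n) (normc (C k t ij.1 ij.2) + normc (lseq P k t ij.1 ij.2)).
have b_lsc k t K : U t -> K < b k t -> exists2 d, 0 < d & forall s, pdisc t d s -> K < b k s.
  move=> Ut Kb; have hl : lsc (b k) t.
    by apply: lsc_sum => ij; apply: lscD; apply: lsc_normc; [exact: aC|exact: aP].
  have e0 : 0 < (b k t - K) / 2 by rewrite divr_gt0 // subr_gt0.
  have [d d0 hd] := hl _ e0; exists d => // s /hd; lra.
have b_geo t : U t -> exists2 K, 0 <= K & forall k, b k t <= K ^+ k.+1.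
  move=> Ut; have [K1 K11 h1] := in_gl_gbl hB Ut; have [K2 K21 h2] := in_gl_gbl hP Ut.
  pose K := Num.max K1 K2.
  have K1' : 1 <= K by rewrite le_max K11.
  have [c hc] := h1 K (ltac:(by rewrite le_max lexx)).
  have [c' [c'0 K0 hc']] := h2 K (ltac:(by rewrite le_max lexx orbT)).
  have [c0 _ {}hc] := geo_bound_lc (lord B) (-1) K1' hc.
  set c1 := c * _ in c0 hc.
  pose S := \sum_(ij : 'I_n * 'I_n) (c1 + c').
  have S0 : 0 <= S by apply: sumr_ge0 => ij _; exact: addr_ge0.
  (* The successor in the exponent lets the rate absorb the constant: $SK^k\le(S+K)^{k+1}$. *)
  exists (S + K) => [|k]; first by rewrite addr_ge0 // ltW.
  have hbk : b k t <= S * K ^+ k.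
    rewrite /S mulr_suml; apply: ler_sum => ij _; rewrite mulrDl; apply: lerD; last exact: hc'.
    by have := hc k ij.1 ij.2; rewrite [-1 + _]addrC.
  apply: le_trans hbk _; rewrite exprS; apply: ler_pM => //.
  - by rewrite exprn_ge0 // ltW.
  - by rewrite lerDl ltW.
  - by rewrite lerXn2r ?nnegrE ?addr_ge0 ?(ltW K0) // lerDr.
have [t0 [rho [K [r0 K0 hU hb]]]] := uniform_geometric_bound r10 hr1 b_lsc b_geo.
have bC k t i j : normc (C k t i j) <= b k t /\ normc (lseq P k t i j) <= b k t.
  have s0 : 0 <= \sum_(ij : 'I_n * 'I_n | ij != (i, j)) (normc (C k t ij.1 ij.2) + normc (lseq P k t ij.1 ij.2)).
    by apply: sumr_ge0 => ij _; rewrite addr_ge0 ?normc_ge0.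
  have := normc_ge0 (C k t i j); have := normc_ge0 (lseq P k t i j).
  by rewrite /b (bigD1 (i, j)) //=; split; lra.
have Ut0 : U t0 by apply: hU; exact: pdisc_center (ltW r0).
have /analytic_atP[ra [Ma [ra0 hMa]]] := ha t0 Ut0.
have Ma0 := wiener_ge0 hMa.
pose rho' := Num.min (rho / 4) ra.
have r'0 : 0 < rho' by rewrite lt_min divr_gt0.
have r'4 : rho' <= rho / 4 by rewrite ge_min lexx.
have tworr : 1 <= 2 ^+ r :> R by rewrite exprn_ege1 // ler1n.
pose K' := K * 2 ^+ r + Ma.
have K'0 : 0 <= K' by rewrite addr_ge0 // mulr_ge0 // (le_trans _ tworr).
have KK' k : K ^+ k.+1 * 2 ^+ r <= K' ^+ k.+1.
  apply: (@le_trans _ _ ((K * 2 ^+ r) ^+ k.+1)).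
    by rewrite exprMn ler_wpM2l ?exprn_ge0 // exprS ler_peMr ?(le_trans _ tworr) // exprn_ege1.
  by rewrite lerXn2r ?nnegrE // ?lerDl // mulr_ge0 // (le_trans _ tworr).
exists t0, rho', K'; split; first split => //.
  by move=> s /(pdisc_le r'4) hs; apply: hU; apply: pdisc_le hs; lra.
split.
- move=> k i j; apply: wiener_le (KK' k) _; apply: wiener_shrink (ltW r'0) r'4 _.
  apply: analytic_bounded_wiener => // t ht; split; first exact: aC (hU _ ht).
  exact: le_trans (bC k t i j).1 (hb t ht k).
- move=> k i j; apply: wiener_le (KK' k) _; apply: wiener_shrink (ltW r'0) r'4 _.
  apply: analytic_bounded_wiener => // t ht; split; first exact: aP (hU _ ht).
  exact: le_trans (bC k t i j).2 (hb t ht k).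
apply: wiener_le (_ : Ma <= K') _; first by rewrite lerDr mulr_ge0 // (le_trans _ tworr).
by apply: wiener_shrink (ltW r'0) _ hMa; rewrite ge_min lexx orbT.
Qed.

Lemma psum_single (R : realType) n (a : nat -> 'M[R[i]]_n) z i j (k0 : nat) :
  (forall k, k != k0 -> a k i j = 0) -> psum a z i j = a k0 i j * z ^+ k0.
Proof.
move=> h; rewrite mxE; apply: cvg_lim => //; apply: hsum_series.
have := @hsum_fin _ _ (fun k => a k i j * z ^+ k) [fset k0]%fset.
by rewrite big_seq_fset1; apply => k; rewrite inE => /h ->; rewrite mul0r.
Qed.

(* z^-D N(z) z^D, when the entry (i, j) of N(z) is carried by z^(d_i - d_j) *)
Definition resonant_part (R : realType) r n (d : 'I_n -> int) (nu : nat -> 'rV[R[i]]_r -> 'M[R[i]]_n)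
    (t : 'rV[R[i]]_r) : 'M[R[i]]_n :=
  \matrix_(i, j) if d j <= d i then nu `|d i - d j|%N t i j else 0.

(** At most one coefficient contributes to the entry $(i,j)$, that of index $d_i-d_j$; none does
    when this difference is negative. *)
Lemma resonant_zdiag (R : realType) r n (d : 'I_n -> int) (nu : nat -> 'rV[R[i]]_r -> 'M[R[i]]_n) t z :
  (forall k i j, nu k t i j != 0 -> d i - d j = k%:Z) -> z != 0 ->
  psum (fun k => nu k t) z *m zdiag d z = zdiag d z *m resonant_part d nu t.
Proof.
move=> h z0; apply/matrixP => i j; rewrite mul_zdiag zdiag_mul [resonant_part _ _ _ i j]mxE.
have nz k : d i - d j != k%:Z -> nu k t i j = 0.
  by apply: contraNeq => /h ->.
case: ifP => dij.
  rewrite (@psum_single _ _ _ _ _ _ `|d i - d j|%N) => [|k kd].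
    have -> : z ^ d i = z ^ d j * z ^+ `|d i - d j|%N.
      by rewrite exprnP gez0_abs ?subr_ge0 // -expfzDr // [d j + _]addrC subrK.
    by ring.
  by apply: nz; apply: contra kd => /eqP ->.
rewrite mulr0 (@psum_single _ _ _ _ _ _ 0%N) ?nz ?mul0r //.
  by apply: contraFN dij; rewrite subr_eq0 => /eqP ->.
move=> k _; apply: nz; apply: contraFN dij => /eqP e.
by rewrite -subr_ge0 e.
Qed.

Lemma regular_data (R : realType) r n (t0 : 'rV[R[i]]_r) rho K (C : nat -> 'rV[R[i]]_r -> 'M[R[i]]_n) :
  0 < rho -> 0 <= K -> (forall k, mxwiener t0 rho (K ^+ k.+1) (C k)) ->
  exists (rho' K' : R) (X nu : nat -> 'rV[R[i]]_r -> 'M[R[i]]_n) (d : 'I_n -> int),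
  [/\ 0 < rho' /\ rho' <= rho, 0 <= K', forall k, mxwiener t0 rho' (K' ^+ k.+1) (X k) &
      forall k, mxwiener t0 rho' (K' ^+ k.+1) (nu k)] /\
  [/\ forall k t, pdisc t0 rho' t -> k%:R *: X k t =
        mconv (fun k => C k t) (fun k => X k t) k - mconv (fun k => X k t) (fun k => nu k t) k,
      forall t z, z != 0 -> psum (fun k => nu k t) z *m zdiag d z = zdiag d z *m resonant_part d nu t &
      forall t, pdisc t0 rho' t -> exists2 e : R, 0 < e & forall z, normc z < e ->
        psum (fun k => X k t) z \in unitmx].
Proof.
move=> r0 K0 hC.
have [T [lam [rho' [K' [s [sig [Q [N [[uT [r'0 rr] K'0 hQ hN] [hrec hres sig0 ns hs]]]]]]]]]] :=
  normal_form r0 K0 hC.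
have [bT bT0 hbT] := matrix_bound T.
have nb0 : 0 <= n%:R * bT by rewrite mulr_ge0.
pose K2 := (n%:R * bT + 1) * K'.
have K20 : 0 <= K2 by rewrite mulr_ge0 // addr_ge0.
have K'2 : K' <= K2 by rewrite /K2 mulrDl mul1r lerDr mulr_ge0.
(* When $\lambda_i-\lambda_j$ is the integer $k$, the real parts differ by $k$ and hence so do their
   floors; this is what [resonant_zdiag] asks of [d]. *)
pose d i := Num.floor (complex.Re (lam 0 i)).
exists rho', K2, (fun k t => T *m Q k t), N, d; split; first split => //.
- move=> k; have := mxwiener_mul r'0 (mxwiener_const t0 r'0 hbT) (hQ k).
  apply: mxwiener_le; rewrite /K2 exprMn mulrA; apply: ler_wpM2r; first exact: exprn_ge0.
  apply: (@le_trans _ _ (n%:R * bT + 1)); first by rewrite lerDl.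
  by rewrite exprS ler_peMr ?addr_ge0 // exprn_ege1 // lerDr.
- by move=> k; apply: mxwiener_le (hN k); rewrite lerXn2r ?nnegrE.
split.
- move=> k t ht; rewrite /mconv scalemxAr hrec // mulmxBr !mulmx_sumr; congr (_ - _).
    by apply: eq_bigr => l _; rewrite !mulmxA mulmxV // mul1mx.
  by apply: eq_bigr => l _; rewrite mulmxA.
- move=> t z z0; apply: resonant_zdiag => // k i j /hres e.
  have : complex.Re (lam 0 i) = complex.Re (lam 0 j) + (k%:Z)%:~R.
    have := congr1 (@complex.Re R) e; rewrite raddfB /= -[k%:R](rmorph_nat (real_complex R)) /=.
    by move=> e'; rewrite -[k%:~R]/(k%:R) -e' addrC subrK.
  rewrite /d => ->; rewrite floorDrz ?intr_int // intrKfloor.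
  by rewrite addrAC subrr add0r.
move=> t ht.
have sig1 : 0 < sig^-1 by rewrite invr_gt0.
(* [normal_form] bounds [s] from above; [s'] supplies the nonnegative constant that [geo_bound]
   requires. *)
pose s' := Num.max 0 s; have s'0 : 0 <= s' by rewrite le_max lexx.
have ns' : n%:R * s' <= 4^-1.
  by rewrite /s'; case: (leP 0 s) => _ //; rewrite mulr0 invr_ge0.
pose q k := Q k t - (if k == 0%N then 1%:M else 0).
have hq : geo_bound s' sig^-1 q.
  split => // k i j; apply: le_trans (hs k t ht i j) _; rewrite exprVn.
  by rewrite ler_wpM2r ?invr_ge0 ?exprn_ge0 ?(ltW sig0) // le_max lexx orbT.
exists (sig / 4) => [|z hz]; first exact: divr_gt0.
have zK : normc z * sig^-1 <= 2^-1.
  rewrite ler_pdivrMr //; have := normc_ge0 z; lra.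
have h1 := geo_bound_one n sig1.
have e1 : psum (fun k => Q k t) z = 1%:M + psum q z.
  rewrite -[1%:M in RHS](psum_const _ z) -(psumD h1 hq zK); apply: psum_ext => k.
  by rewrite /q [RHS]addrC subrK.
have hQt : geo_bound (s' + 1) sig^-1 (fun k => Q k t).
  split=> [||k i j]; [exact: addr_ge0|exact: sig1|].
  have [_ _ hq3] := hq; have [_ _ h13] := h1.
  have -> : Q k t i j = q k i j + (if k == 0%N then 1%:M else 0 : 'M[R[i]]_n) i j.
    by rewrite /q mxBE subrK.
  rewrite mulrDl; apply: le_trans (normcD _ _) _.
  by apply: lerD; [exact: hq3|exact: h13].
(* For small [z] the entries of the series of $Q-1$ are at most $2s'$, and $n\cdot2s'\le1/2$. *)
rewrite (psum_mulmx T hQt zK) unitmx_mul uT e1; apply: (unit_near1 (b := 2 * s')).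
  by move=> i j; exact: psum_bound hq zK.
by lra.
Qed.

(** * Assembling the solution at a fixed parameter *)

Definition dmin n (d : 'I_n -> int) : int := - (\sum_i `|d i|%N)%:Z.

(* z^D = diag(z^(d_j)) as a Laurent series; dmin d is a common lower bound of the d_j. *)
Definition zlaurent (R : realType) r n (d : 'I_n -> int) : laurent R r n :=
  Laurent (dmin d) (fun k _ => \matrix_(i, j)
    if (i == j) && (d j == dmin d + k%:Z) then 1 else 0).

Lemma dmin_le n (d : 'I_n -> int) j : dmin d <= d j.
Proof.
have h : (`|d j| <= \sum_i `|d i|)%N by rewrite (bigD1 j) //= leq_addr.
rewrite /dmin lerNl; apply: le_trans (ler_norm _) _.
by rewrite normrN -abszE lez_nat.
Qed.

Lemma ev_zlaurent (R : realType) r n (d : 'I_n -> int) (t : 'rV[R[i]]_r) (z : R[i]) : z != 0 ->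
  ev (zlaurent R r d) t z = zdiag d z.
Proof.
move=> z0; apply/matrixP => i j; rewrite /ev /lv mxE [RHS]mxE.
have h := dmin_le d j.
have [->|ij] := eqVneq i j; last first.
  rewrite (@psum_single _ _ _ _ _ _ 0%N) ?mxE ?(negbTE ij) /= ?mul0r ?mulr0 // => k _.
  by rewrite mxE (negbTE ij).
have e : d j = dmin d + `|d j - dmin d|%N%:Z.
  by rewrite gez0_abs ?subr_ge0 // [RHS]addrC subrK.
rewrite (@psum_single _ _ _ _ _ _ `|d j - dmin d|%N) => [|k kd].
  by rewrite mxE -e !eqxx mul1r exprnP -expfzDr // -e.
rewrite mxE eqxx /=; case: eqP => // e'; case/eqP: kd.
by move: e; rewrite e' => /addrI [].
Qed.

Lemma zlaurent_bound (R : realType) r n (d : 'I_n -> int) k (t : 'rV[R[i]]_r) i j :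
  normc (lseq (zlaurent R r d) k t i j) <= 1.
Proof. by rewrite mxE; case: ifP; rewrite ?normc0 ?normc1. Qed.

Lemma gbl_zlaurent (R : realType) r n (d : 'I_n -> int) (t : 'rV[R[i]]_r) (K : R) : 1 <= K ->
  gbl K (zlaurent R r d) t.
Proof.
move=> K1; exists 1; split => //; first exact: lt_le_trans K1.
move=> k i j; rewrite mul1r; apply: le_trans (exprn_ege1 k K1); exact: zlaurent_bound.
Qed.

(** The factor in front of the power of $x-\alpha(t)$, gathered into one Laurent series; the inverse
    of the gauge matrix will be put for [P]. *)
Definition Qsol (R : realType) r n (P : laurent R r n) (X : nat -> 'rV[R[i]]_r -> 'M[R[i]]_n)
    (d : 'I_n -> int) : laurent R r n := lmul P (lmul (Laurent 0 X) (zlaurent R r d)).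

Lemma gbl_Qsol (R : realType) r n K (P : laurent R r n) X d t : 1 <= K ->
  gbl K P t -> gbl K (Laurent 0 X) t -> gbl (4 * K) (Qsol P X d) t.
Proof.
move=> K1 hP hX; have K2 : K <= 2 * K by rewrite ler_peMl ?ler1n // (le_trans ler01).
rewrite (_ : 4 * K = 2 * (2 * K)); last by ring.
apply: gbl_mul; first exact: gbl_le K2 hP.
by apply: gbl_mul => //; exact: gbl_zlaurent.
Qed.

Lemma ev_Qsol (R : realType) r n K (P : laurent R r n) X d t z : 1 <= K ->
  gbl K P t -> gbl K (Laurent 0 X) t -> normc z * (8 * K) <= 1 -> z != 0 ->
  ev (Qsol P X d) t z = ev P t z *m (psum (fun k => X k t) z *m zdiag d z).
Proof.
move=> K1 hP hX zK z0; have K2 : K <= 2 * K by rewrite ler_peMl ?ler1n // (le_trans ler01).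
have hZ := gbl_zlaurent d t K1.
have zK1 : normc z * (2 * K) <= 2^-1.
  have := mulr_ge0 (normc_ge0 z) (le_trans ler01 K1); lra.
have zK2 : normc z * (2 * (2 * K)) <= 2^-1 by lra.
rewrite /Qsol (ev_mul (gbl_le K2 hP) (gbl_mul hX hZ) zK2 z0) (ev_mul hX hZ zK1 z0).
by rewrite ev_zlaurent // /ev /lv expr0z scale1r.
Qed.

Lemma ev_simple (R : realType) r n K (B : laurent R r n) t z : 1 <= K -> gbl K B t ->
  (forall i, i < -1 -> lcoef B i t = 0) -> normc z * K <= 2^-1 -> z != 0 ->
  ev B t z = z^-1 *: psum (fun k => lcoef B (k%:Z - 1) t) z.
Proof.
move=> K1 [c hc] h zK z0.
have h1 := geo_bound_lc (lord B) (-1) K1 hc.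
have e i : lc (lord B) (fun k => lseq B k t) i =
    lc (-1) (fun k => lc (lord B) (fun k => lseq B k t) (-1 + k%:Z)) i.
  have [i1|i1] := leP (-1) i; last first.
    by rewrite (h i i1 : lc (lord B) (fun k => lseq B k t) i = 0) /lc leNgt i1.
  rewrite [RHS]/lc i1 gez0_abs; last by rewrite subr_ge0.
  by rewrite [-1 + _]addrC subrK.
rewrite /ev (lv_lc hc h1 zK z0 e) /lv exprN1; congr (_ *: _).
Qed.

Lemma mxderiv_shift (R : realType) n (F : R[i] -> 'M[R[i]]_n) (a x : R[i]) D :
  mxderiv F (x - a) D -> mxderiv (fun y => F (y - a)) x D.
Proof.
move=> h i j; have h1 := cderivB (cderiv_id x) (cderiv_cst a x).
by have := cderiv_comp h1 (h i j); rewrite subr0 mul1r.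
Qed.

Lemma cnear_shift (R : realType) (a x : R[i]) (P : R[i] -> Prop) :
  cnear (x - a) P -> cnear x (fun y => P (y - a)).
Proof.
move=> [d d0 h]; exists d => // y hy; apply: h.
by rewrite opprB addrA subrK.
Qed.

Lemma cnear_small (R : realType) (z : R[i]) (e : R) : normc z < e -> cnear z (fun y => normc y < e).
Proof.
move=> ze; exists (e - normc z) => [|y hy]; first by rewrite subr_gt0.
by have := normcD z (y - z); rewrite addrC subrK; lra.
Qed.

Lemma sector_shift (R : realType) (a x : R[i]) (th0 th1 : R) :
  sector a th0 th1 x -> sector 0 th0 th1 (x - a).
Proof. by move=> [rho [th [h1 h2 h3 ->]]]; exists rho, th; split; rewrite // addrC addKr add0r. Qed.

(** Everything is at one fixed [t]: coefficient identities between Laurent series become identities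
    between values, after which $Y$ is the inverse gauge matrix times the [W] of
    [euler_solution]. *)
Lemma solution_at (R : realType) r n (alpha : 'rV[R[i]]_r -> R[i]) (A B P P' : laurent R r n)
    (X nu : nat -> 'rV[R[i]]_r -> 'M[R[i]]_n) (d : 'I_n -> int) (t : 'rV[R[i]]_r) (K : R) :
  1 <= K -> gbl K A t -> gbl K B t -> gbl K P t -> gbl K P' t ->
  gbl K (Laurent 0 X) t -> gbl K (Laurent 0 nu) t ->
  (forall i, lcoef (lmul P P') i t = lcoef (lone R r n) i t) ->
  (forall i, lcoef (lmul P' P) i t = lcoef (lone R r n) i t) ->
  (forall i, lcoef B i t = lcoef (ladd (lmul (lderiv P) P') (lmul (lmul P A) P')) i t) ->
  (forall i, i < -1 -> lcoef B i t = 0) ->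
  (forall k, k%:R *: X k t = mconv (fun k => lcoef B (k%:Z - 1) t) (fun k => X k t) k -
     mconv (fun k => X k t) (fun k => nu k t) k) ->
  (forall z, z != 0 -> psum (fun k => nu k t) z *m zdiag d z = zdiag d z *m resonant_part d nu t) ->
  (exists2 e : R, 0 < e & forall z, normc z < e -> psum (fun k => X k t) z \in unitmx) ->
  exists2 e : R, 0 < e & forall th0 th1 L x,
    log_branch (sector 0 th0 th1) L -> sector (alpha t) th0 th1 x -> normc (x - alpha t) < e ->
    let Y := Ysol alpha (Qsol P' X d) (fun t => resonant_part d nu t - ddiag R d) L in
    is_derive x 1 (fun y => Y y t) (leval alpha A x t *m Y x t) /\ Y x t \in unitmx.
Proof.
move=> K1 hA hB hP hP' hX hnu ePP' eP'P eB hBs hrec hnil [e1 e10 hunit].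
have K0 : 0 < K by apply: lt_le_trans K1.
have K16 : 0 < 16 * K by rewrite mulr_gt0.
(* Each nested product doubles the rate, and evaluation asks for a further factor 2; the bound
   $1/(16K)$ leaves room for all uses below. *)
exists (Num.min e1 (16 * K)^-1) => [|th0 th1 L x hL hx hxe Y]; first by rewrite lt_min e10 invr_gt0.
set z := x - alpha t in hxe.
have hz : sector 0 th0 th1 z := sector_shift hx.
have z0 := sector_neq0 hz.
have K2 : K <= 2 * K by rewrite ler_pMl // ler1n.
have K22 : 2 * K <= 2 * (2 * K) by rewrite ler_pMl ?mulr_gt0 // ler1n.
have smallK u : normc u < Num.min e1 (16 * K)^-1 -> normc u * (16 * K) <= 1.
  by rewrite lt_min => /andP[_ /ltW]; rewrite -[_^-1]mul1r ler_pdivlMr.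
have nzK u : 0 <= normc u * K by rewrite mulr_ge0 ?normc_ge0 // ltW.
have near_small : cnear z (fun u => normc u < Num.min e1 (16 * K)^-1 /\ u != 0).
  exact: cnearI (cnear_small hxe) (cnear_ne z0).
have zK := smallK z hxe; have zK' := nzK z.
have h1 := gbl_one (r := r) n t K0.
have evPP' u : normc u < Num.min e1 (16 * K)^-1 -> u != 0 -> ev P t u *m ev P' t u = 1%:M.
  move=> /smallK uK u0; have uK' := nzK u.
  have uK2 : normc u * (2 * K) <= 2^-1 by lra.
  rewrite -(ev_mul hP hP' uK2 u0) -[RHS](@ev_one R r n t u).
  apply: ev_eq (gbl_mul hP hP') _ uK2 u0 ePP'; exact: gbl_le h1.
have evP'P : ev P' t z *m ev P t z = 1%:M.
  have zK2 : normc z * (2 * K) <= 2^-1 by lra.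
  rewrite -(ev_mul hP' hP zK2 z0) -[RHS](@ev_one R r n t z).
  apply: ev_eq (gbl_mul hP' hP) _ zK2 z0 eP'P; exact: gbl_le h1.
have hP2 := gbl_le K2 hP; have hP'2 := gbl_le K2 hP'.
have evB : ev B t z = ev (lderiv P) t z *m ev P' t z + ev P t z *m ev A t z *m ev P' t z.
  have zK2 : normc z * (2 * K) <= 2^-1 by lra.
  have zK4 : normc z * (2 * (2 * K)) <= 2^-1 by lra.
  have K4 : 1 <= 2 * (2 * K) by rewrite (le_trans K1) // (le_trans K2).
  have g1 := gbl_mul (gbl_deriv hP) hP'2; have g2 := gbl_mul (gbl_mul hP hA) hP'2.
  rewrite -(ev_mul hP hA zK2 z0) -(ev_mul (gbl_mul hP hA) hP'2 zK4 z0).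
  rewrite -(ev_mul (gbl_deriv hP) hP'2 zK4 z0) -(ev_add K4 g1 g2 zK4 z0).
  by apply: ev_eq (gbl_add K4 g1 g2) zK4 z0 eB; apply: gbl_le hB; apply: le_trans K22.
pose W u := psum (fun k => X k t) u *m zdiag d u *m expm (L u *: (resonant_part d nu t - ddiag R d)).
have zK4 : normc z * (4 * K) <= 1 by lra.
have hW : mxderiv W z (ev B t z *m W z).
  have zK1 : normc z * K <= 2^-1 by lra.
  rewrite (ev_simple K1 hB hBs zK1 z0) -scalemxAl.
  have [cB hcB] := hB; have [cX hcX] := hX; have [cn hcn] := hnu.
  have hC : geo_bound (cB * K ^+ `|(-1 - lord B)%R|%N) K (fun k => lcoef B (k%:Z - 1) t).
    have := geo_bound_lc (lord B) (-1) K1 hcB.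
    by have -> : (fun k => lcoef B (k%:Z - 1) t) =
      (fun k => lc (lord B) (fun k => lseq B k t) (-1 + k%:Z)) by apply/funext => k; rewrite [-1 + _]addrC.
  exact: euler_solution hcX hC hcn zK4 z0 hrec (hnil z z0) (log_cderiv hL hz).
have hpd := mxderiv_ev hP zK4 z0; have hp'd := mxderiv_ev hP' zK4 z0.
have near1 : cnear z (fun y => ev P t y *m ev P' t y = 1%:M).
  by apply: cnearW near_small => u [u1 u2]; exact: evPP'.
have hG := gauge_solution hpd hp'd near1 evP'P evB hW.
(* Needed on a whole neighbourhood of [x], as the identity is to be differentiated. *)
have YE y : normc (y - alpha t) < Num.min e1 (16 * K)^-1 -> y - alpha t != 0 ->
    Y y t = ev P' t (y - alpha t) *m W (y - alpha t).
  move=> ye y0; have yK := smallK _ ye; have yK' := nzK (y - alpha t).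
  have ya : y != alpha t by rewrite -subr_eq0.
  have yK4 : normc (y - alpha t) * (4 * K) <= 2^-1 by lra.
  have yK8 : normc (y - alpha t) * (8 * K) <= 1 by lra.
  rewrite /Y /Ysol (ev_leval (gbl_Qsol d K1 hP' hX) ya yK4) (ev_Qsol d K1 hP' hX yK8 y0).
  by rewrite /W !mulmxA.
have YxE := YE x hxe z0.
have zKA : normc (x - alpha t) * K <= 2^-1 by rewrite -/z; lra.
have xa : x != alpha t by rewrite -subr_eq0.
split.
  rewrite YxE (ev_leval hA xa zKA); apply: mxderiv_is_derive.
  apply: mxderiv_near (mxderiv_shift hG).
  by apply: cnearW (cnear_shift near_small) => y [y1 y2]; exact: YE.
rewrite YxE unitmx_mul; apply/andP; split; first by case: (mulmx1_unit evP'P).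
rewrite /W !unitmx_mul expm_unit zdiag_unit // !andbT; apply: hunit.
by move: hxe; rewrite lt_min => /andP[].
Qed.

(** By [wiener_schwarz], $\alpha(s)-\alpha(t)$ has norm at most $M\rho'/\rho=M|z|/(4(M+1))\le|z|/4$.
    This dictates a radius proportional to $|z|$; the condition $|z|\le1$ keeps it below [rho]. *)
Lemma beta_wiener (R : realType) r (alpha : 'rV[R[i]]_r -> R[i]) (t : 'rV[R[i]]_r) (rho M : R) z :
  0 < rho -> wiener t rho M alpha -> z != 0 -> normc z <= 1 ->
  let rho' := rho / (4 * (M + 1)) * normc z in
  [/\ 0 < rho', rho' <= rho & wiener t rho' 4^-1 (fun s => (alpha s - alpha t) / z)].
Proof.
move=> r0 ha z0 z1 rho'; have M0 := wiener_ge0 ha.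
have M1 : 0 < M + 1 by rewrite ltr_wpDl.
have nz : 0 < normc z by rewrite normc_gt0.
have M4 : 1 <= 4 * (M + 1) by lra.
have r'0 : 0 < rho' by rewrite mulr_gt0 // divr_gt0 // mulr_gt0.
have rr : rho' <= rho.
  rewrite /rho' -mulrA ger_pMr // mulrC ler_pdivrMr ?mulr_gt0 // mul1r; lra.
split => //; have := wiener_scale z^-1 (wiener_schwarz r'0 rr ha).
rewrite normcV => h; apply: wiener_le (wiener_ext _ h) => [|s _]; last exact: mulrC.
have -> : (normc z)^-1 * (M * (rho' / rho)) = M / (4 * (M + 1)).
  by rewrite /rho'; field; rewrite !gt_eqF.
rewrite ler_pdivrMr ?mulr_gt0 // mulrA mulVf ?mul1r ?lerDl //; lra.
Qed.

Lemma lmul_wiener (R : realType) r n (t : 'rV[R[i]]_r) (rho c c' K : R) (f g : laurent R r n) :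
  0 < rho -> 0 <= c -> 0 <= c' -> 0 <= K ->
  (forall k, mxwiener t rho (c * K ^+ k) (lseq f k)) ->
  (forall k, mxwiener t rho (c' * K ^+ k) (lseq g k)) ->
  forall k, mxwiener t rho (n%:R * (c * c') * (2 * K) ^+ k) (lseq (lmul f g) k).
Proof.
move=> r0 c0 c'0 K0 hf hg k.
have h := mxwiener_sum (index_enum 'I_k.+1) r0
  (fun l : 'I_k.+1 => mxwiener_mul r0 (hf l) (hg (k - l)%N)).
apply: mxwiener_le h; apply: (@le_trans _ _ (\sum_(l < k.+1) n%:R * (c * c') * K ^+ k)).
  apply: ler_sum => l _; rewrite -!mulrA; apply: ler_wpM2l => //.
  have lk : (l <= k)%N by rewrite -ltnS.
  have -> : K ^+ k = K ^+ l * K ^+ (k - l) by rewrite -exprD subnKC.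
  by rewrite le_eqVlt; apply/orP; left; apply/eqP; ring.
rewrite sumr_const card_ord -[leLHS]mulr_natl exprMn [leRHS]mulrCA; apply: ler_wpM2r.
  by rewrite !mulr_ge0 // exprn_ge0.
by rewrite -natrX ler_nat ltn_expl.
Qed.

Lemma zlaurent_wiener (R : realType) r n (d : 'I_n -> int) (t : 'rV[R[i]]_r) (rho K : R) :
  0 < rho -> 1 <= K -> forall k, mxwiener t rho (1 * K ^+ k) (lseq (zlaurent R r d) k).
Proof.
move=> r0 K1 k; rewrite mul1r; apply: mxwiener_const => // i j.
apply: le_trans (exprn_ege1 k K1); exact: (zlaurent_bound d k t).
Qed.

Lemma Qsol_wiener (R : realType) r n (t : 'rV[R[i]]_r) (rho K : R) (P : laurent R r n) X d :
  0 < rho -> 1 <= K -> (forall k, mxwiener t rho (K ^+ k.+1) (lseq P k)) ->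
  (forall k, mxwiener t rho (K ^+ k.+1) (X k)) ->
  exists2 c, 0 <= c & forall k, mxwiener t rho (c * (4 * K) ^+ k) (lseq (Qsol P X d) k).
Proof.
move=> r0 K1 hP hX; have K0 : 0 <= K by apply: le_trans K1.
have K2 : 0 <= 2 * K by rewrite mulr_ge0.
have hX1 k : mxwiener t rho (K * K ^+ k) (lseq (Laurent 0 X) k) by rewrite -exprS; exact: hX.
have h1 := lmul_wiener r0 K0 ler01 K0 hX1 (zlaurent_wiener d t r0 K1).
have hP2 k : mxwiener t rho (K * (2 * K) ^+ k) (lseq P k).
  apply: mxwiener_le (hP k); rewrite exprS; apply: ler_wpM2l => //.
  by rewrite lerXn2r ?nnegrE // ler_peMl // ler1n.
have c0 : 0 <= n%:R * (K * 1) by rewrite !mulr_ge0.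
exists (n%:R * (K * (n%:R * (K * 1)))); first by rewrite !mulr_ge0.
move=> k; have := lmul_wiener r0 K0 c0 K2 hP2 h1 k.
by rewrite (_ : 2 * (2 * K) = 4 * K) //; ring.
Qed.

(** Only the indices $|d_i-d_j|$ occur in [resonant_part], and [S] bounds them all. *)
Lemma resonant_wiener (R : realType) r n (t : 'rV[R[i]]_r) (rho K : R) (d : 'I_n -> int)
    (nu : nat -> 'rV[R[i]]_r -> 'M[R[i]]_n) :
  0 < rho -> 1 <= K -> (forall k, mxwiener t rho (K ^+ k.+1) (nu k)) ->
  exists2 M, 0 <= M & mxwiener t rho M (fun s => resonant_part d nu s - ddiag R d).
Proof.
move=> r0 K1 hnu; have K0 : 0 <= K by apply: le_trans K1.
have [b b0 hb] := matrix_bound (ddiag R d).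
pose S := (\sum_(ij : 'I_n * 'I_n) `|d ij.1 - d ij.2|)%N.
have S0 : 0 <= K ^+ S.+1 by exact: exprn_ge0.
exists (K ^+ S.+1 + b); first exact: addr_ge0.
apply: mxwiener_sub; last exact: mxwiener_const.
move=> i j; case: (boolP (d j <= d i)) => dij; last first.
  have := wiener_const t (0 : R[i]) r0; rewrite normc0 => /(wiener_le S0).
  by apply: wiener_ext => s _; rewrite mxE (negbTE dij).
have h : K ^+ `|d i - d j|%N.+1 <= K ^+ S.+1.
  by apply: ler_weXn2l => //; rewrite ltnS /S (bigD1 (i, j)) //= leq_addr.
by apply: wiener_le h (wiener_ext _ (hnu _ i j)) => s _; rewrite mxE dij.
Qed.

(** The exponent has three sources: [lord Q] from the Laurent series, [N1] from the exponential of
    the logarithm times [At], [S] from differentiating on a polydisc of radius proportional to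
    $|z|$. The constant [CC] may vary with [t] and the branch; the exponent depends on [Q], [N1] and
    [m] only. *)
Lemma Ysol_pderiv_bound (R : realType) r n (alpha : 'rV[R[i]]_r -> R[i]) (Q : laurent R r n)
    (At : 'rV[R[i]]_r -> 'M[R[i]]_n) (t : 'rV[R[i]]_r) (rho c K MA M : R) (N1 : nat)
    (th0 th1 : R) (L : R[i] -> R[i]) (m : 'I_r -> nat) :
  0 < rho -> 0 <= c -> 0 < K -> 0 <= MA -> n%:R * MA <= N1%:R ->
  (forall k, mxwiener t rho (c * K ^+ k) (lseq Q k)) -> mxwiener t rho MA At ->
  wiener t rho M alpha -> th0 < th1 -> log_branch (sector 0 th0 th1) L ->
  let S := (\sum_j m j)%N in
  exists2 CC : R, 0 <= CC & forall x, sector (alpha t) th0 th1 x ->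
    normc (x - alpha t) <= 1 -> normc (x - alpha t) * (4 * K) <= 1 ->
    mx_analytic_at (Ysol alpha Q At L x) t /\
    forall i j, normc (pderiv m (Ysol alpha Q At L x) t i j) <=
      CC * normc (x - alpha t) ^ (lord Q - N1%:Z - S%:Z).
Proof.
move=> r0 c0 K0 MA0 hN1 hQ hA ha th01 hL S; have M0 := wiener_ge0 ha.
have [CL CL0 hCL] := log_bound th01 hL.
pose kap := rho / (4 * (M + 1)).
have kap0 : 0 < kap by rewrite divr_gt0 // mulr_gt0 // ltr_wpDl.
exists ((2 ^+ S) ^+ S * (n%:R * (2 ^+ `|lord Q|%N * (2 * c) * expR (N1%:R * (CL + 2))) / kap ^+ S)).
  rewrite !mulr_ge0 ?invr_ge0 ?exprn_ge0 ?expR_ge0 ?(ltW kap0) //.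
move=> x hx; set z := x - alpha t => z1 zK.
have hz : sector 0 th0 th1 z := sector_shift hx.
have z0 := sector_neq0 hz; have nz : 0 < normc z by rewrite normc_gt0.
have [r'0 rr hb] := beta_wiener r0 ha z0 z1; rewrite -/kap in r'0 rr hb.
pose f s := (alpha s - alpha t) / z.
have f0 : f t = 0 by rewrite /f subrr mul0r.
have hxf s : pdisc t (kap * normc z) s -> x - alpha s = z * (1 - f s).
  by move=> _; rewrite /f mulrBr mulr1 mulrC divfK // /z; ring.
have hQ' k := mxwiener_shrink (ltW r'0) rr (hQ k).
have hA' := mxwiener_shrink (ltW r'0) rr hA.
have [Yh hYh hW] := Ysol_near r'0 c0 K0 MA0 hQ' hA' hb f0 hxf zK hL hz.
split; first exact: mxwiener_analytic r'0 hYh hW.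
move=> i j; rewrite (nbhs_singleton (near_eq_pderiv m hYh)).
apply: le_trans (pderiv_bound m r'0 hW i j) _; rewrite -/S -[leRHS]mulrA; apply: ler_wpM2l.
  by rewrite !exprn_ge0.
have e1 : normc z ^ (lord Q - N1%:Z - S%:Z) = normc z ^ lord Q * (normc z)^-1 ^+ N1 * (normc z)^-1 ^+ S.
  by rewrite !expfzDr ?gt_eqF // -!exprnN !exprVn.
(* As $|z|\le1$, $|\ln|z||=-\ln|z|$ and $e^{N_1|\ln|z||}=|z|^{-N_1}$; the bounded part [CL] of the
   logarithm and the 2 coming from [ell] go into the constant. *)
have hE : expR (n%:R * ((normc (L z) + 2) * MA)) <= expR (N1%:R * (CL + 2)) * (normc z)^-1 ^+ N1.
  have -> : (normc z)^-1 ^+ N1 = expR (N1%:R * - ln (normc z)).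
    by rewrite expRM_natl expRN lnK // posrE.
  rewrite -expRD ler_expR.
  have ln0 : ln (normc z) <= 0 by apply: ln_le0.
  have hLz := hCL z hz; rewrite ler0_norm // in hLz.
  rewrite mulrCA mulrC -mulrDr.
  apply: ler_pM; rewrite ?mulr_ge0 ?addr_ge0 ?normc_ge0 //; lra.
rewrite e1 exprMn invfM -!exprVn.
set a := normc z ^ lord Q; set b := 2 ^+ _; set E := expR _ in hE *; set F := expR _ in hE *.
set u := _ ^+ N1 in hE *; set v := (normc z)^-1 ^+ S; set w := kap^-1 ^+ S.
pose G := n%:R * (b * (2 * c)) * a * v * w.
have G0 : 0 <= G.
  rewrite !mulr_ge0 ?exprn_ge0 ?invr_ge0 ?(ltW kap0) ?normc_ge0 //; apply: ltW; exact: expzR_pos.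
have -> : n%:R * (a * b * (2 * c) * E) * (w * v) = G * E by rewrite /G; ring.
have -> : n%:R * (b * (2 * c) * F) * w * (a * u * v) = G * (F * u) by rewrite /G; ring.
exact: ler_wpM2l.
Qed.

(** * The theorem *)

Definition opdisc (R : realType) r (t0 : 'rV[R[i]]_r) (rho : R) : set 'rV[R[i]]_r :=
  [set t | forall j, normc (t 0 j - t0 0 j) < rho].

Lemma opdisc_open (R : realType) r (t0 : 'rV[R[i]]_r) (rho : R) : open (opdisc t0 rho).
Proof.
rewrite openE => t ht; apply/nbhs_mxcP.
have a0 j : 0 < rho - normc (t 0 j - t0 0 j) by rewrite subr_gt0; exact: ht.
pose S := \sum_j (rho - normc (t 0 j - t0 0 j))^-1.
have S0 : 0 <= S by apply: sumr_ge0 => j _; rewrite invr_ge0 ltW.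
have S1 : 0 < S + 1 by rewrite ltr_wpDl.
exists (S + 1)^-1; first by rewrite invr_gt0.
move=> s hs j; have := hs 0 j => h.
have h1 : (S + 1)^-1 <= rho - normc (t 0 j - t0 0 j).
  rewrite invf_ple ?posrE //; apply: (@le_trans _ _ S); last by rewrite lerDl.
  rewrite /S (bigD1 j) //= lerDl; apply: sumr_ge0 => l _; rewrite invr_ge0 ltW //.
have := normcD (s 0 j - t 0 j) (t 0 j - t0 0 j); rewrite addrA subrK; lra.
Qed.

(** The polydisc is star-shaped: a union of segments issuing from [t0]. *)
Lemma opdisc_connected (R : realType) r (t0 : 'rV[R[i]]_r) (rho : R) :
  0 < rho -> connected (opdisc t0 rho).
Proof.
move=> r0; pose g (s : 'rV[R[i]]_r) (l : R) : 'rV[R[i]]_r := t0 + l%:C *: (s - t0).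
have -> : opdisc t0 rho = \bigcup_(s in opdisc t0 rho) (g s @` `[0, 1]).
  apply/seteqP; split=> [s hs|s [s' hs' [l /= /itvP hl <-]] j].
    by exists s => //; exists 1; rewrite /= ?in_itv /= ?ler01 ?lexx // /g scale1r addrC subrK.
  rewrite /g !mxE [t0 0 j + _]addrC addrK normcM normc_ler0 ?hl //.
  apply: le_lt_trans (hs' j); rewrite ler_piMl ?normc_ge0 ?hl //.
apply: bigcup_connected => [|s hs].
  exists t0 => s hs; exists 0; rewrite /= ?in_itv /= ?ler01 ?lexx //.
  by rewrite /g scale0r addr0.
apply: connected_continuous_connected; first exact: segment_connected.
apply: continuous_subspaceT => l; apply/cvg_mxcP => i j; apply/cvgcP => e e0.
have M1 : 0 < normc (s i j - t0 i j) + 1 by rewrite ltr_wpDl ?normc_ge0.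
near=> l'.
have h : `|l' - l| < e / (normc (s i j - t0 i j) + 1).
  by near: l'; apply: cvgr_distC_lt; [exact: cvg_id|rewrite divr_gt0].
rewrite /g !mxE opprD addrACA subrr add0r -mulrBl -rmorphB normcM normc_real.
move: h; rewrite ltr_pdivlMr //; apply: le_lt_trans.
by rewrite ler_wpM2l // lerDl.
Unshelve. all: by end_near. Qed.

Lemma mxwiener_recenter (R : realType) r n (t0 t1 : 'rV[R[i]]_r) rho rho' M
    (F : 'rV[R[i]]_r -> 'M[R[i]]_n) :
  0 < rho' -> 0 <= rho -> (forall j, normc (t1 0 j - t0 0 j) + rho' <= rho) ->
  mxwiener t0 rho M F -> mxwiener t1 rho' M F.
Proof. by move=> r0 rho0 h hF i j; apply: wiener_recenter h (hF i j). Qed.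

Theorem corollary2p7 (R : realType) (r n : nat) (U : set 'rV[R[i]]_r)
    (alpha : 'rV[R[i]]_r -> R[i]) (A : laurent R r n)
    (openU : open U) (connectedU : connected U) (U0 : U 0)
    (analytic_alpha : analytic_on U alpha) (alpha0 : alpha 0 = 0)
    (glA : in_gl U alpha A) (regA : param_regular_singular U alpha A) :
  exists U' : set 'rV[R[i]]_r,
    [/\ U' !=set0, open U', connected U' & U' `<=` U] /\
    exists (Q : laurent R r n) (At : 'rV[R[i]]_r -> 'M[R[i]]_n),
      [/\ in_gl U' alpha Q, mx_analytic_on U' At,
          fundamental_solution U' alpha A Q At &
          forall m : 'I_r -> nat, exists N : int,
          forall t, U' t ->
          forall (th0 th1 : R) (L : R[i] -> R[i]),
            th0 < th1 -> th1 - th0 < 2 * pi ->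
            log_branch (sector 0 th0 th1) L ->
            (x - alpha t) ^ N *: pderiv m (Ysol alpha Q At L x) t
              @[x --> within (sector (alpha t) th0 th1) (nbhs (alpha t))]
              --> (0 : 'M[R[i]]_n)].
Proof.
have [B [glB [simpleB _] [P [P' [glP glP' PP' P'P eB]]]]] := regA.
have [t0 [rho [K [[r0 K0 sub] [hC hP' ha]]]]] :=
  uniform_coef_bound openU U0 glB glP' analytic_alpha.
have [rho' [K' [X [nu [d [[[r'0 rr] K'0 hX hnu] [hrec hnil hunit]]]]]]] :=
  regular_data r0 K0 hC.
(* Every [t] in [opdisc t0 del] is the centre of a polydisc of the same radius [del] inside that of
   radius [rho'], so the bounds recentred at [t] are uniform. *)
pose del := rho' / 2; have del0 : 0 < del by rewrite divr_gt0.
pose K1 := Num.max 1 (Num.max K K').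
have K11 : 1 <= K1 by rewrite le_max lexx.
have KK1 : K <= K1 by rewrite /K1 !le_max lexx orbT.
have K'K1 : K' <= K1 by rewrite /K1 !le_max lexx !orbT.
have K10 : 0 <= K1 by apply: le_trans K11.
have cen t : opdisc t0 del t -> forall j, normc (t 0 j - t0 0 j) + del <= rho'.
  by move=> ht j; have := ht j; rewrite /del; lra.
have cen' t : opdisc t0 del t -> forall j, normc (t 0 j - t0 0 j) + del <= rho.
  by move=> ht j; apply: le_trans (cen t ht j) rr.
have inU' t : opdisc t0 del t -> pdisc t0 rho' t.
  by move=> ht j; have := ht j; rewrite /del; lra.
have inU t : opdisc t0 del t -> U t.
  by move=> ht; apply: sub; exact: pdisc_le rr _ (inU' t ht).
have hP1 t : opdisc t0 del t -> forall k, mxwiener t del (K1 ^+ k.+1) (lseq P' k).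
  move=> ht k; apply: mxwiener_le (mxwiener_recenter del0 (ltW r0) (cen' t ht) (hP' k)).
  by rewrite lerXn2r ?nnegrE.
have hX1 t : opdisc t0 del t -> forall k, mxwiener t del (K1 ^+ k.+1) (X k).
  move=> ht k; apply: mxwiener_le (mxwiener_recenter del0 (ltW r'0) (cen t ht) (hX k)).
  by rewrite lerXn2r ?nnegrE.
have hnu1 t : opdisc t0 del t -> forall k, mxwiener t del (K1 ^+ k.+1) (nu k).
  move=> ht k; apply: mxwiener_le (mxwiener_recenter del0 (ltW r'0) (cen t ht) (hnu k)).
  by rewrite lerXn2r ?nnegrE.
have hnu0 k : mxwiener t0 rho' (K1 ^+ k.+1) (nu k).
  by apply: mxwiener_le (hnu k); rewrite lerXn2r ?nnegrE.
have [MA MA0 hMA] := resonant_wiener d r'0 K11 hnu0.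
pose At t := resonant_part d nu t - ddiag R d.
pose Q := Qsol P' X d.
have hA1 t : opdisc t0 del t -> mxwiener t del MA At.
  by move=> ht; exact: mxwiener_recenter del0 (ltW r'0) (cen t ht) hMA.
have ha1 t : opdisc t0 del t -> wiener t del K alpha.
  by move=> ht; exact: wiener_recenter del0 (ltW r0) (cen' t ht) ha.
have K40 : 0 < 4 * K1 by rewrite mulr_gt0 // (lt_le_trans ltr01).
have K160 : 0 < 4 * (4 * K1) by rewrite mulr_gt0.
exists (opdisc t0 del); split.
  split; [|exact: opdisc_open|exact: opdisc_connected|exact: inU].
  by exists t0 => j; rewrite subrr normc0.
exists Q, At; split.
- split=> [k i j t ht|t ht].
    have [c c0 hc] := Qsol_wiener d del0 K11 (hP1 t ht) (hX1 t ht).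
    by apply/analytic_atP; exists del, (c * (4 * K1) ^+ k); split => //; exact: hc.
  have [c c0 hc] := Qsol_wiener d del0 K11 (hP1 t ht) (hX1 t ht).
  have gb : geo_bound c (4 * K1) (fun k => lseq Q k t).
    by split => // k i j; exact: wiener_bound (ltW del0) (hc k i j) (pdisc_center _ (ltW del0)).
  exists ((2 * (4 * K1))^-1)%:C; first by rewrite ltcR invr_gt0 mulr_gt0.
  move=> x /andP[x0 xe]; rewrite normr_gt0 subr_eq0 in x0.
  apply/cvg_ex; eexists; apply: leval_cvg gb x0 _.
  move: xe; rewrite normc_ltC -[_^-1]mul1r ltr_pdivlMr ?mulr_gt0 //; lra.
- by move=> i j t ht; apply/analytic_atP; exists del, MA; split => //; exact: hA1.
- move=> t ht; have Ut := inU t ht.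
  have [k1 k11 g1] := in_gl_gbl glA Ut; have [k2 k21 g2] := in_gl_gbl glB Ut.
  have [k3 k31 g3] := in_gl_gbl glP Ut; have [k4 k41 g4] := in_gl_gbl glP' Ut.
  (* A rate common to all series at this [t]. The coefficients of [A] were bounded pointwise only,
     so the radius obtained here depends on [t], as [fundamental_solution] allows. *)
  pose kk := k1 + k2 + k3 + k4 + K1.
  have kk1 : 1 <= kk by rewrite /kk; lra.
  have gX (Z : nat -> 'rV[R[i]]_r -> 'M[R[i]]_n) :
      (forall k, mxwiener t del (K1 ^+ k.+1) (Z k)) -> gbl kk (Laurent 0 Z) t.
    move=> hZ; have KK : K1 <= kk by rewrite /kk; lra.
    apply: gbl_le KK _; exists K1; split => //; first exact: lt_le_trans K11.
    move=> k i j; rewrite -exprS.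
    exact: wiener_bound (ltW del0) (hZ k i j) (pdisc_center _ (ltW del0)).
  have [e e0 he] := @solution_at R r n alpha A B P P' X nu d t kk kk1
    (g1 kk (ltac:(rewrite /kk; lra))) (g2 kk (ltac:(rewrite /kk; lra)))
    (g3 kk (ltac:(rewrite /kk; lra))) (g4 kk (ltac:(rewrite /kk; lra)))
    (gX X (hX1 t ht)) (gX nu (hnu1 t ht)) (fun i => PP' i t Ut) (fun i => P'P i t Ut)
    (fun i => eB i t Ut) (fun i hi => simpleB i t hi Ut) (fun k => hrec k t (inU' t ht))
    (fun z hz => hnil t z hz) (hunit t (inU' t ht)).
  exists (Num.min e (Num.min 1 (4 * (4 * K1))^-1))%:C.
    by rewrite ltcR !lt_min e0 ltr01 /= invr_gt0 mulr_gt0.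
  move=> th0 th1 L x th01 _ hL hx; rewrite normc_ltC !lt_min => /and3P[xe x1 xK] Y.
  have [hd hu] := he th0 th1 L x hL hx xe; split => //.
  have [c c0 hc] := Qsol_wiener d del0 K11 (hP1 t ht) (hX1 t ht).
  have nM : n%:R * MA <= (Num.bound (n%:R * MA))%:R.
    by apply: ltW; apply: archi_boundP; rewrite mulr_ge0.
  (* The estimate without any differentiation is invoked for the analyticity in [t] that it also
     delivers. *)
  have [CC CC0 hCC] := Ysol_pderiv_bound (fun=> 0%N) del0 c0 K40 MA0 nM hc (hA1 t ht) (ha1 t ht) th01 hL.
  apply: (hCC x hx (ltW x1) _).1.
  by move: xK; rewrite -[_^-1]mul1r ltr_pdivlMr // => /ltW.
move=> m; pose N1 := Num.bound (n%:R * MA).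
have nM : n%:R * MA <= N1%:R.
  by apply: ltW; apply: archi_boundP; rewrite mulr_ge0.
pose S := (\sum_j m j)%N.
(* This exponent leaves one factor $|x-\alpha(t)|$. It is computed from [lord Q], [MA] and [m],
   hence independent of [t], the sector and the branch. *)
exists (1 - (lord Q - N1%:Z - S%:Z)) => t ht th0 th1 L th01 _ hL.
have [c c0 hc] := Qsol_wiener d del0 K11 (hP1 t ht) (hX1 t ht).
have [CC CC0 hCC] := Ysol_pderiv_bound m del0 c0 K40 MA0 nM hc (hA1 t ht) (ha1 t ht) th01 hL.
apply/cvg_mxcP => i j; apply/cvgcP => e e0.
have C1 : 0 < CC + 1 by rewrite ltr_wpDl.
rewrite /within /=; apply/nbhscP.
exists (Num.min (e / (CC + 1)) (Num.min 1 (4 * (4 * K1))^-1)).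
  by rewrite !lt_min divr_gt0 //= ltr01 /= invr_gt0 mulr_gt0.
move=> x; rewrite !lt_min => /and3P[xe x1 xK] hx.
have z0 := sector_neq0 (sector_shift hx).
have nz : 0 < normc (x - alpha t) by rewrite normc_gt0.
have xK' : normc (x - alpha t) * (4 * (4 * K1)) <= 1.
  by move: xK; rewrite -[_^-1]mul1r ltr_pdivlMr // => /ltW.
have [_ hb] := hCC x hx (ltW x1) xK'.
have h0 : (0 : 'M[R[i]]_n) i j = 0 by rewrite mxE.
rewrite -[lord P' + _]/(lord Q) h0 subr0 mxE normcM normc_expz.
apply: le_lt_trans (ler_wpM2l (ltW (expzR_pos _ nz)) (hb i j)) _.
rewrite mulrCA -expfzDr ?gt_eqF // subrK expr1z mulrC.
move: xe; rewrite ltr_pdivlMr //; apply: le_lt_trans.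
by rewrite ler_wpM2l ?normc_ge0 // lerDl.
Qed.
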